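(* Let $m$ be a nonnegative integer, let $0<d<\pi$, and let $g_2(z)=(1-e^{-z})^m$. Assume that $f$ is analytic in $\phi_2(\mathscr{D}_d)$, and that there exist positive constants $K$, $\alpha$ and $\beta$ such that $$\left|\frac{f(z)}{g_2(z)}\right|\leq K\left|\frac{z}{1+z}\right|^{\alpha}|e^{-z}|^{\beta}$$ holds for all $z\in\phi_2(\mathscr{D}_d)$. Let $\mu=\min\{\alpha,\beta\}$, and for each positive integer $n$ let $$M=\left\lceil\frac{\mu}{\alpha}n\right\rceil,\quad N=\left\lceil\frac{\mu}{\beta}n\right\rceil,\quad h=\sqrt{\frac{\pi d}{\mu n}}.$$ Then there exists a constant $C$ independent of $n$ such that, for all positive integers $n$, $$\sup_{t\in(0,\infty)}\left|f^{(m)}(t)-\sum_{k=-M}^{N}\frac{f(\phi_2(kh))}{g_2(\phi_2(kh))}\left(\frac{\mathrm{d}}{\mathrm{d}t}\right)^m\left\{g_2(t)\,S(k,h)(\phi_2^{-1}(t))\right\}\right|\leq C n^{(m+1)/2}\exp\left(-\sqrt{\pi d\mu n}\right).$$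
   Context: For $d>0$, $\mathscr{D}_d=\{\zeta\in\mathbb{C}:|\operatorname{Im}\zeta|<d\}$. The map $\phi_2$ is $\phi_2(\zeta)=\log(1+e^{\zeta})$ (principal logarithm), considered on $\mathscr{D}_d$ with $d<\pi$; it maps $\mathbb{R}$ onto $(0,\infty)$, and for $t\in(0,\infty)$, $\phi_2^{-1}(t)=\log(e^t-1)$. For $h>0$ and an integer $k$, the Sinc function is $S(k,h)(x)=\dfrac{\sin[\pi(x-kh)/h]}{\pi(x-kh)/h}$ for $x\neq kh$, and $S(k,h)(kh)=1$. *)

(* Defs.v *)
From Stdlib Require Import Reals ZArith.
From Coquelicot Require Import Coquelicot.
Open Scope R_scope.

(** * Complex exponential, argument, principal logarithm *)

Definition Cexp (z : C) : C :=
  (exp (Re z) * cos (Im z), exp (Re z) * sin (Im z)).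

(* Principal argument, with values in (-PI, PI]; meaningless at [z = 0]. *)
Definition Carg (z : C) : R :=
  if Rlt_dec (Im z) 0 then - acos (Re z / Cmod z) else acos (Re z / Cmod z).

Definition Clog (z : C) : C := (ln (Cmod z), Carg z).

(** * Analyticity and iterated derivatives *)

(* The derivative is the complex one (scalars in [C_AbsRing]). A function is
   analytic at a point when it is differentiable on a neighbourhood of it; on an
   open set this is differentiability at each point of the set. *)
Definition analytic_on (D : C -> Prop) (f : C -> C) : Prop :=
  forall z : C, D z ->
    locally z (fun w : C =>
      @ex_derive C_AbsRing C_NormedModule f w).

Fixpoint C_derive_n (f : C -> C) (n : nat) (z : C) : C :=
  match n with
  | O => f z
  | S p => C_derive (C_derive_n f p) z
  end.

(* (d/dt)^n of a complex-valued function of a real variable. *)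
Definition RC_derive_n (F : R -> C) (n : nat) (t : R) : C :=
  (Derive_n (fun s => Re (F s)) n t, Derive_n (fun s => Im (F s)) n t).

(** * Strip, conformal map, Sinc functions *)

Definition strip (d : R) (zeta : C) : Prop := Rabs (Im zeta) < d.

Definition phi2 (zeta : C) : C := Clog (1 + Cexp zeta)%C.

Definition phi2_inv (t : R) : R := ln (exp t - 1).

Definition phi2_image (d : R) (z : C) : Prop :=
  exists zeta : C, strip d zeta /\ z = phi2 zeta.

Definition g2 (m : nat) (z : C) : C := Cpow (1 - Cexp (- z)) m.

Definition Sinc (k : Z) (h x : R) : R :=
  if Req_EM_T x (IZR k * h) then 1
  else sin (PI * (x - IZR k * h) / h) / (PI * (x - IZR k * h) / h).

(** * Ceiling, sums over integer intervals *)

(* [Int_part] is the floor function. *)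
Definition Zceil (x : R) : Z := (- Int_part (- x))%Z.

(* Sum of [F k] over the integers a <= k <= b (zero if b < a). *)
Definition C_sum_Z (F : Z -> C) (a b : Z) : C :=
  @sum_n_m C_AbelianMonoid (fun j : nat => F (a + Z.of_nat j - 1)%Z)
    1 (Z.to_nat (b - a + 1)).

(** * Step size, truncation indices and approximation *)

Definition step (d mu : R) (n : nat) : R := sqrt (PI * d / (mu * INR n)).

Definition trunc (mu a : R) (n : nat) : Z := Zceil (mu / a * INR n).

Definition sinc_approx (m : nat) (f : C -> C) (M N : Z) (h t : R) : C :=
  C_sum_Z
    (fun k : Z =>
       (f (phi2 (IZR k * h)%R) / g2 m (phi2 (IZR k * h)%R)
        * RC_derive_n
            (fun s : R => g2 m (RtoC s) * RtoC (Sinc k h (phi2_inv s))) m t)%C)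
    (- M) N.

(* Main.v *)
Require Import Defs.
From Stdlib Require Import Reals ZArith Lra Lia List Classical ClassicalEpsilon.
From Coquelicot Require Import Coquelicot.
Open Scope R_scope.

(** Let [F(z) = f(phi2(z)) / g2(phi2(z))], which is holomorphic in the strip
    [|Im z| < d] and decays like [e^(alpha x)] at [-oo] and [e^(-beta x)] at [+oo].
    Put [s(z) = sin(pi z / h)] and [D_z(w) = (s(w) - s(z)) / (w - z)], an entire
    function of [w]. Cauchy's formula for [F(w) / (w - z)] and the residues of
    [F(w) D_z(w) / s(w)] at the nodes [k h] (one Cauchy formula for each cell
    [(k-1/2) h < x < (k+1/2) h] of a long rectangle) give
    [F(z) - sum_k F(kh) S_k(z) = s(z)/(2 pi i) * integral of F(w) / ((w - z) s(w))].
    The sides [y = d', - d'] of the rectangle contribute [O(e^(-pi d/h))] when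
    [d - d' <= h / pi], the vertical ones can be pushed to infinity, and the terms
    [k < -M] and [k > N] form geometric sums of size
    [O((e^(-alpha M h) + e^(-beta N h)) / h)].

    This error bound holds uniformly for [|Im z| <= c h], so Cauchy's estimates on
    squares of size of order [h] bound the derivatives of the error [G] up to the
    order [m] at the cost of a factor [h^(-m)]. Finally the approximation error is the
    [m]-th derivative of [u^m G(x)] with [u = 1 - e^(-t)] and [x = phi2_inv t]; since
    [dx/dt = 1/u], the factor [u^m] absorbs the singularity at [t = 0] and that
    derivative is a combination of the [G^(i)(x)], [i <= m], with coefficients bounded
    on [t > 0]. *)

(** * Complex differentiability *)

(* Coquelicot puts two distinct (equivalent) uniform structures on [C]; this one
   has the discs as balls. *)
Notation CU := (AbsRing_UniformSpace C_AbsRing).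

(** The parameters are balanced: [PI d / h] equals [sqrt (PI d mu n)], while [alpha M h] and
    [beta N h] are at least as large, so one exponential controls all error terms. The power of [n]
    comes from [h], of order [n^(-1/2)]: the geometric sums cost one factor [1/h], the [m]
    derivatives cost [h^(-m)]. Every constant has to be uniform in [n]. This rests on [h <= H] with
    [H = sqrt (PI d / mu)], the step for [n = 1]. The hypotheses control [F] in the open strip and
    give no boundary values, so the horizontal sides stay at a height below [d] that moves with [h];
    a gap of at most [h / PI] changes the exponential by a factor at most [e]. The width [c h] in
    Cauchy's estimates is the largest order for which [sin (pi z / h)] stays bounded independently
    of [h]. All contours are boundaries of rectangles parallel to the axes, so that a contour
    integral is a combination of four integrals over real intervals. *)

Definition near (z : C) (P : C -> Prop) : Prop :=
  exists r, 0 < r /\ forall w, Cmod (w - z)%C < r -> P w.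

Lemma near_locally (z : C) (P : C -> Prop) : near z P <-> @locally CU z P.
Proof.
  split.
  - intros [r [hr H]]. exists (mkposreal r hr). intros w hw. apply H, hw.
  - intros [r H]. exists r. split; [apply cond_pos|]. intros w hw. apply H, hw.
Qed.

Lemma near_self (z : C) (P : C -> Prop) : near z P -> P z.
Proof.
  intros [r [hr H]]. apply H. replace (z - z)%C with (RtoC 0) by ring.
  now rewrite Cmod_0.
Qed.

Lemma near_and (z : C) (P Q : C -> Prop) :
  near z P -> near z Q -> near z (fun w => P w /\ Q w).
Proof. rewrite !near_locally. apply filter_and. Qed.

Lemma near_imp (z : C) (P Q : C -> Prop) :
  (forall w, P w -> Q w) -> near z P -> near z Q.
Proof. intros H [r [hr K]]. exists r. split; auto. Qed.

Lemma near_near (z : C) (P : C -> Prop) : near z P -> near z (fun w => near w P).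
Proof.
  intros H. apply near_locally in H. apply locally_locally in H.
  apply near_locally. revert H. apply filter_imp. intros w. apply near_locally.
Qed.

Definition ccont (f : C -> C) (z : C) : Prop := @continuous CU CU f z.

Lemma continuous_CU (U : UniformSpace) (f : U -> C) (x : U) :
  @continuous U CU f x <->
  forall e, 0 < e -> locally x (fun y => Cmod (f y - f x)%C < e).
Proof.
  split.
  - intros H e he. apply (proj1 (filterlim_locally (U := CU) f (f x)) H (mkposreal e he)).
  - intros H. apply (filterlim_locally (U := CU) f (f x)). intros e. apply (H e (cond_pos e)).
Qed.

Lemma ccontP (f : C -> C) (z : C) :
  ccont f z <-> forall e, 0 < e -> near z (fun w => Cmod (f w - f z)%C < e).
Proof.
  unfold ccont. rewrite continuous_CU.
  split; intros H e he; apply near_locally, H, he.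
Qed.

(** The source space is kept general: it is [CU] for functions of a complex variable and the real
    line for curves. *)
Lemma contC_plus {U : UniformSpace} (f g : U -> C) (x : U) : @continuous U CU f x -> @continuous U CU g x ->
  @continuous U CU (fun y => f y + g y)%C x.
Proof. apply (@continuous_plus U C_AbsRing (AbsRing_NormedModule C_AbsRing)). Qed.

Lemma contC_opp {U : UniformSpace} (f : U -> C) (x : U) : @continuous U CU f x -> @continuous U CU (fun y => - f y)%C x.
Proof. apply (@continuous_opp U C_AbsRing (AbsRing_NormedModule C_AbsRing)). Qed.

Lemma contC_minus {U : UniformSpace} (f g : U -> C) (x : U) : @continuous U CU f x -> @continuous U CU g x ->
  @continuous U CU (fun y => f y - g y)%C x.
Proof. intros. apply contC_plus; [|apply contC_opp]; assumption. Qed.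

Lemma contC_mult {U : UniformSpace} (f g : U -> C) (x : U) : @continuous U CU f x -> @continuous U CU g x ->
  @continuous U CU (fun y => f y * g y)%C x.
Proof. apply (@continuous_mult U C_AbsRing). Qed.

Lemma contC_const {U : UniformSpace} (c : C) (x : U) : @continuous U CU (fun _ => c) x.
Proof. apply continuous_const. Qed.

Lemma ccont_inv (z : C) : z <> 0 -> ccont Cinv z.
Proof.
  intros hz. apply ccontP. intros e he.
  assert (hm : 0 < Cmod z) by now apply Cmod_gt_0.
  (* The first radius gives [|w| > |z| / 2]; with it, the second one makes [|w - z| / (|w| |z|)]
     smaller than [e]. *)
  exists (Rmin (Cmod z / 2) (e * (Cmod z * Cmod z) / 2)). split.
  { apply Rmin_case; [lra|]. apply Rdiv_lt_0_compat; [|lra].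
    repeat apply Rmult_lt_0_compat; assumption. }
  intros w hw.
  assert (h1 : Cmod (w - z) < Cmod z / 2) by (eapply Rlt_le_trans; [apply hw|apply Rmin_l]).
  assert (h2 : Cmod (w - z) < e * (Cmod z * Cmod z) / 2)
    by (eapply Rlt_le_trans; [apply hw|apply Rmin_r]).
  assert (h3 : Cmod z / 2 < Cmod w).
  { assert (Cmod z <= Cmod w + Cmod (w - z)); [|lra].
    replace z with (w + - (w - z))%C at 1 by ring.
    rewrite <- (Cmod_opp (w - z)). apply Cmod_triangle. }
  assert (hw0 : w <> 0) by (apply Cmod_gt_0; lra).
  replace (/ w - / z)%C with (- (w - z) / (w * z))%C by (field; repeat split; auto).
  rewrite Cmod_div by now apply Cmult_neq_0.
  rewrite Cmod_opp, Cmod_mult. apply Rlt_div_l; [apply Rmult_lt_0_compat; lra|]. revert h2 h3 hm he. generalize (Cmod (w - z)) (Cmod w) (Cmod z). intros a b c; intros.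
  assert (0 < e * c * (b - c / 2)) by (repeat apply Rmult_lt_0_compat; lra). lra.
Qed.

Lemma contC_inv {U : UniformSpace} (f : U -> C) (x : U) : f x <> 0 ->
  @continuous U CU f x -> @continuous U CU (fun y => / f y)%C x.
Proof.
  intros hf H. apply (@continuous_comp U CU CU f Cinv); [exact H|]. now apply ccont_inv.
Qed.

Lemma contC_div {U : UniformSpace} (f g : U -> C) (x : U) : g x <> 0 ->
  @continuous U CU f x -> @continuous U CU g x -> @continuous U CU (fun y => f y / g y)%C x.
Proof. intros. apply contC_mult; [|apply contC_inv]; assumption. Qed.

Lemma contC_comp {U : UniformSpace} (g : U -> C) (f : C -> C) (x : U) :
  @continuous U CU g x -> ccont f (g x) -> @continuous U CU (fun y => f (g y)) x.
Proof. apply (@continuous_comp U CU CU). Qed.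

Lemma ccont_id (z : C) : ccont (fun w => w) z.
Proof. exact (@continuous_id CU z). Qed.

Lemma ccont_const (c z : C) : ccont (fun _ => c) z.
Proof. exact (@contC_const CU c z). Qed.

Lemma ccont_plus (f g : C -> C) (z : C) :
  ccont f z -> ccont g z -> ccont (fun w => f w + g w)%C z.
Proof. exact (@contC_plus CU f g z). Qed.

Lemma ccont_minus (f g : C -> C) (z : C) :
  ccont f z -> ccont g z -> ccont (fun w => f w - g w)%C z.
Proof. exact (@contC_minus CU f g z). Qed.

Lemma ccont_mult (f g : C -> C) (z : C) :
  ccont f z -> ccont g z -> ccont (fun w => f w * g w)%C z.
Proof. exact (@contC_mult CU f g z). Qed.

Lemma ccont_div (f g : C -> C) (z : C) : g z <> 0 ->
  ccont f z -> ccont g z -> ccont (fun w => f w / g w)%C z.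
Proof. exact (@contC_div CU f g z). Qed.

Lemma ccont_comp (f g : C -> C) (z : C) :
  ccont f (g z) -> ccont g z -> ccont (fun w => f (g w)) z.
Proof. intros Hf Hg. exact (@contC_comp CU g f z Hg Hf). Qed.

Lemma ccont_nonzero (f : C -> C) (z : C) : ccont f z -> f z <> 0 ->
  near z (fun w => f w <> 0).
Proof.
  intros H hz. assert (hm : 0 < Cmod (f z)) by now apply Cmod_gt_0.
  generalize (proj1 (ccontP f z) H _ hm). apply near_imp. intros w hw h0.
  rewrite h0 in hw. replace (0 - f z)%C with (- f z)%C in hw by ring.
  rewrite Cmod_opp in hw. lra.
Qed.

(* Caratheodory's form of [is_derive]: the algebra of derivatives reduces to
   that of continuous functions. *)
Definition cder (f : C -> C) (z l : C) : Prop :=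
  exists q, ccont q z /\ q z = l /\ forall w, (f w = f z + q w * (w - z))%C.

Definition holo (f : C -> C) (z : C) : Prop := exists l, cder f z l.

Lemma cder_bound (f : C -> C) (z l : C) : cder f z l <->
  forall e, 0 < e ->
    near z (fun w => Cmod (f w - f z - l * (w - z))%C <= e * Cmod (w - z)%C).
Proof.
  split.
  - intros [q [hq [<- H]]] e he.
    generalize (proj1 (ccontP q z) hq e he). apply near_imp. intros w hw.
    replace (f w - f z - q z * (w - z))%C with ((q w - q z) * (w - z))%C
      by (rewrite (H w); ring).
    rewrite Cmod_mult. apply Rmult_le_compat_r; [apply Cmod_ge_0|lra].
  - intros H.
    (* The difference quotient, completed by [l] at [z]; its continuity at [z] is the
       differentiability of [f]. *)
    exists (fun w => if Ceq_dec w z then l else ((f w - f z) / (w - z))%C).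
    split; [|split].
    + apply ccontP. intros e he.
      destruct (H (e / 2)) as [r [hr K]]; [lra|].
      exists r. split; [exact hr|]. intros w hw.
      destruct (Ceq_dec z z) as [_|n]; [|now elim n].
      destruct (Ceq_dec w z) as [->|n].
      { replace (l - l)%C with (RtoC 0) by ring. now rewrite Cmod_0. }
      assert (hn : (w - z <> 0)%C) by now apply Cminus_eq_contra.
      assert (hm : 0 < Cmod (w - z)) by now apply Cmod_gt_0.
      replace ((f w - f z) / (w - z) - l)%C with ((f w - f z - l * (w - z)) / (w - z))%C
        by (field; repeat split; auto).
      rewrite Cmod_div by auto. apply Rlt_div_l; [exact hm|].
      specialize (K w hw). nra.
    + destruct (Ceq_dec z z) as [_|n]; [reflexivity|now elim n].
    + intros w. destruct (Ceq_dec w z) as [->|n]; [ring|].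
      field. now apply Cminus_eq_contra.
Qed.

(** The bridge to the derivative that underlies [analytic_on] and [C_derive]. *)
Lemma cder_is_derive (f : C -> C) (z l : C) :
  cder f z l <-> @is_derive C_AbsRing C_NormedModule f z l.
Proof.
  rewrite cder_bound. split.
  - intros H. split; [apply (is_linear_scal_l (K := C_AbsRing) (V := C_NormedModule))|].
    intros x hx. apply (@is_filter_lim_locally_unique C_AbsRing (AbsRing_NormedModule C_AbsRing)) in hx.
    subst x. intros e. apply near_locally.
    generalize (H e (cond_pos e)). apply near_imp. intros w hw.
    replace (l * (w - z))%C with ((w - z) * l)%C in hw by ring. exact hw.
  - intros [_ H] e he.
    specialize (H z (fun P h => h) (mkposreal e he)). apply near_locally in H.
    revert H. apply near_imp. intros w hw.
    replace (l * (w - z))%C with ((w - z) * l)%C by ring. exact hw.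
Qed.

Lemma holo_ex_derive (f : C -> C) (z : C) :
  holo f z <-> @ex_derive C_AbsRing C_NormedModule f z.
Proof. split; intros [l H]; exists l; now apply cder_is_derive. Qed.

Lemma C_derive_cder (f : C -> C) (z l : C) : cder f z l -> C_derive f z = l.
Proof. intros H. now apply is_C_derive_unique, cder_is_derive. Qed.

Lemma holo_cder (f : C -> C) (z : C) : holo f z -> cder f z (C_derive f z).
Proof. intros [l H]. now rewrite (C_derive_cder f z l H). Qed.

Lemma cder_cont (f : C -> C) (z l : C) : cder f z l -> ccont f z.
Proof.
  intros [q [hq [_ H]]].
  apply (@continuous_ext CU CU (fun w => f z + q w * (w - z))%C).
  { intros w. now rewrite (H w). }
  apply ccont_plus; [apply ccont_const|]. apply ccont_mult; [exact hq|].
  apply ccont_minus; [apply ccont_id|apply ccont_const].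
Qed.

Lemma holo_cont (f : C -> C) (z : C) : holo f z -> ccont f z.
Proof. intros [l H]. now apply cder_cont with l. Qed.

Lemma cder_ext (f g : C -> C) (z l : C) :
  near z (fun w => f w = g w) -> cder f z l -> cder g z l.
Proof.
  rewrite !cder_bound. intros E H e he.
  generalize (near_and _ _ _ E (H e he)). apply near_imp. intros w [hw K].
  now rewrite <- hw, <- (near_self _ _ E).
Qed.

Lemma holo_ext (f g : C -> C) (z : C) :
  near z (fun w => f w = g w) -> holo f z -> holo g z.
Proof. intros E [l H]. exists l. now apply cder_ext with f. Qed.

Lemma cder_const (c z : C) : cder (fun _ => c) z 0.
Proof.
  exists (fun _ => 0). split; [apply ccont_const|]. split; [reflexivity|]. intros; ring.
Qed.

Lemma cder_id (z : C) : cder (fun w => w) z 1.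
Proof.
  exists (fun _ => 1). split; [apply ccont_const|]. split; [reflexivity|]. intros; ring.
Qed.

Lemma cder_plus (f g : C -> C) (z a b : C) :
  cder f z a -> cder g z b -> cder (fun w => f w + g w)%C z (a + b)%C.
Proof.
  intros [p [hp [<- Hp]]] [q [hq [<- Hq]]].
  exists (fun w => p w + q w)%C. split; [now apply ccont_plus|]. split; [reflexivity|].
  intros w. rewrite (Hp w), (Hq w). ring.
Qed.

Lemma cder_mult (f g : C -> C) (z a b : C) :
  cder f z a -> cder g z b -> cder (fun w => f w * g w)%C z (a * g z + f z * b)%C.
Proof.
  intros Df Dg. assert (cg := cder_cont _ _ _ Dg).
  destruct Df as [p [hp [<- Hp]]]. destruct Dg as [q [hq [<- Hq]]].
  exists (fun w => p w * g w + f z * q w)%C. split; [|split; [reflexivity|]].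
  - apply ccont_plus; apply ccont_mult; try assumption. apply ccont_const.
  - intros w. rewrite (Hp w), (Hq w). ring.
Qed.

Lemma cder_inv (f : C -> C) (z a : C) : f z <> 0 ->
  cder f z a -> cder (fun w => / f w)%C z (- a / (f z * f z))%C.
Proof.
  intros h0 Df. assert (cf := cder_cont _ _ _ Df).
  destruct (ccont_nonzero f z cf h0) as [r [hr hn]].
  destruct Df as [p [hp [<- Hp]]].
  set (q := fun w => (- p w / (f w * f z))%C).
  (* [cder] demands an identity at every [w], and this one can fail at zeros of [f] away from [z].
     It is therefore imposed on a model function that agrees with [/ f] near [z]. *)
  apply cder_ext with (fun w => / f z + q w * (w - z))%C.
  { exists r. split; [exact hr|]. intros w hw. unfold q.
    specialize (hn w hw).
    replace (- p w / (f w * f z) * (w - z))%C with (- (p w * (w - z)) / (f w * f z))%C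
      by (field; repeat split; auto).
    replace (p w * (w - z))%C with (f w - f z)%C by (rewrite (Hp w); ring).
    field; auto. }
  exists q. split; [|split; [reflexivity|]].
  - apply ccont_div; [now apply Cmult_neq_0|now apply (@contC_opp CU)|].
    apply ccont_mult; [exact cf|apply ccont_const].
  - intros w. ring.
Qed.

Lemma cder_comp (f g : C -> C) (z a b : C) :
  cder f (g z) a -> cder g z b -> cder (fun w => f (g w)) z (a * b)%C.
Proof.
  intros [p [hp [<- Hp]]] Dg. assert (cg := cder_cont _ _ _ Dg).
  destruct Dg as [q [hq [<- Hq]]].
  exists (fun w => p (g w) * q w)%C. split; [|split; [reflexivity|]].
  - apply ccont_mult; [|exact hq]. now apply ccont_comp.
  - intros w. assert (E : (g w - g z = q w * (w - z))%C) by (rewrite (Hq w); ring).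
    rewrite (Hp (g w)), E. ring.
Qed.

Lemma cder_scal (c : C) (f : C -> C) (z a : C) :
  cder f z a -> cder (fun w => c * f w)%C z (c * a)%C.
Proof.
  intros H. replace (c * a)%C with (0 * f z + c * a)%C by ring.
  apply cder_mult; [apply cder_const|exact H].
Qed.

Lemma cder_minus (f g : C -> C) (z a b : C) :
  cder f z a -> cder g z b -> cder (fun w => f w - g w)%C z (a - b)%C.
Proof.
  intros Hf Hg. generalize (cder_plus _ _ _ _ _ Hf (cder_scal (- (1))%C _ _ _ Hg)).
  replace (a + - (1) * b)%C with (a - b)%C by ring.
  apply cder_ext. exists 1. split; [lra|]. intros; ring.
Qed.

Lemma holo_const (c z : C) : holo (fun _ => c) z.
Proof. eexists; apply cder_const. Qed.

Lemma holo_id (z : C) : holo (fun w => w) z.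
Proof. eexists; apply cder_id. Qed.

Lemma holo_plus (f g : C -> C) (z : C) :
  holo f z -> holo g z -> holo (fun w => f w + g w)%C z.
Proof. intros [a Hf] [b Hg]; eexists; eapply cder_plus; eassumption. Qed.

Lemma holo_minus (f g : C -> C) (z : C) :
  holo f z -> holo g z -> holo (fun w => f w - g w)%C z.
Proof. intros [a Hf] [b Hg]; eexists; eapply cder_minus; eassumption. Qed.

Lemma holo_mult (f g : C -> C) (z : C) :
  holo f z -> holo g z -> holo (fun w => f w * g w)%C z.
Proof. intros [a Hf] [b Hg]; eexists; eapply cder_mult; eassumption. Qed.

Lemma holo_div (f g : C -> C) (z : C) : g z <> 0 ->
  holo f z -> holo g z -> holo (fun w => f w / g w)%C z.
Proof.
  intros h Hf [b Hg]. apply holo_mult; [exact Hf|]. eexists; eapply cder_inv; eassumption.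
Qed.

Lemma holo_comp (f g : C -> C) (z : C) :
  holo f (g z) -> holo g z -> holo (fun w => f (g w)) z.
Proof. intros [a Hf] [b Hg]; eexists; eapply cder_comp; eassumption. Qed.

Lemma holo_pow (f : C -> C) (n : nat) (z : C) : holo f z -> holo (fun w => Cpow (f w) n) z.
Proof.
  intros H. induction n as [|n IH]; [exact (holo_const 1 z)|].
  exact (holo_mult f (fun w => Cpow (f w) n) z H IH).
Qed.

(** * Curves and integrals *)

Lemma Cmod_le_abs (z : C) : Cmod z <= Rabs (fst z) + Rabs (snd z).
Proof.
  destruct z as [x y]. simpl.
  replace (x, y) with (RtoC x + Ci * RtoC y)%C by (unfold Cplus, Cmult, Ci, RtoC; simpl; f_equal; ring).
  eapply Rle_trans; [apply Cmod_triangle|].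
  rewrite Cmod_mult, Cmod_Ci, !Cmod_R. lra.
Qed.

Lemma abs_fst_le (z : C) : Rabs (fst z) <= Cmod z.
Proof. eapply Rle_trans; [|apply Rmax_Cmod]. apply Rmax_l. Qed.

Lemma abs_snd_le (z : C) : Rabs (snd z) <= Cmod z.
Proof. eapply Rle_trans; [|apply Rmax_Cmod]. apply Rmax_r. Qed.

Lemma contC_pair {U : UniformSpace} (g : U -> C) (x : U) :
  @continuous U CU g x <->
  continuous (fun y => fst (g y)) x /\ continuous (fun y => snd (g y)) x.
Proof.
  rewrite continuous_CU. split.
  - intros H. split; apply (filterlim_locally (U := R_UniformSpace)); intros e;
      generalize (H e (cond_pos e)); apply filter_imp; intros y hy;
      eapply Rle_lt_trans; try exact hy.
    + apply (abs_fst_le (g y - g x)%C).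
    + apply (abs_snd_le (g y - g x)%C).
  - intros [H1 H2] e he.
    assert (he2 : 0 < e / 2) by lra.
    generalize (filter_and _ _ (proj1 (filterlim_locally (U := R_UniformSpace) _ _) H1 (mkposreal _ he2))
       (proj1 (filterlim_locally (U := R_UniformSpace) _ _) H2 (mkposreal _ he2))).
    apply filter_imp. intros y [h1 h2].
    change (Rabs (fst (g y) - fst (g x)) < e / 2) in h1.
    change (Rabs (snd (g y) - snd (g x)) < e / 2) in h2.
    eapply Rle_lt_trans; [apply Cmod_le_abs|]. simpl. unfold Rminus in *. lra.
Qed.

(** Componentwise, in agreement with [RC_derive_n]. *)
Definition rder (g : R -> C) (t : R) (l : C) : Prop :=
  is_derive (fun s => fst (g s)) t (fst l) /\ is_derive (fun s => snd (g s)) t (snd l).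

Lemma is_derive_caratheodory (f : R -> R) (x l : R) :
  is_derive f x l <->
  exists p : R -> R, continuous p x /\ p x = l /\ forall s, f s = f x + p s * (s - x).
Proof.
  split.
  - intros H. apply is_derive_Reals in H.
    exists (fun s => if Req_EM_T s x then l else (f s - f x) / (s - x)).
    split; [|split].
    + apply (filterlim_locally (U := R_UniformSpace)). intros e.
      destruct (H e (cond_pos e)) as [r K]. exists r. intros s hs.
      destruct (Req_EM_T x x) as [_|n]; [|now elim n].
      destruct (Req_EM_T s x) as [->|n]; [apply ball_center|].
      change (Rabs (s - x) < r) in hs.
      change (Rabs ((f s - f x) / (s - x) - l) < e).
      replace s with (x + (s - x)) at 1 by ring. apply K; [lra|exact hs].
    + destruct (Req_EM_T x x) as [_|n]; [reflexivity|now elim n].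
    + intros s. destruct (Req_EM_T s x) as [->|n]; [ring|]. field. lra.
  - intros [p [hp [<- H]]]. apply is_derive_Reals. intros e he.
    destruct (proj1 (filterlim_locally (U := R_UniformSpace) _ _) hp (mkposreal e he)) as [r K].
    exists r. intros h h0 hr. rewrite (H (x + h)).
    replace ((f x + p (x + h) * (x + h - x) - f x) / h) with (p (x + h)) by (field; exact h0).
    apply (K (x + h)). change (Rabs (x + h - x) < r).
    now replace (x + h - x) with h by ring.
Qed.

(** In this form the chain rule for a holomorphic function along a curve is a product of two
    continuous slopes. *)
Lemma rder_caratheodory (g : R -> C) (t : R) (l : C) :
  rder g t l <->
  exists p : R -> C, @continuous R_UniformSpace CU p t /\ p t = l /\
    forall s, (g s = g t + p s * RtoC (s - t))%C.
Proof.
  unfold rder. rewrite !is_derive_caratheodory. split.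
  - intros [[p1 [c1 [e1 H1]]] [p2 [c2 [e2 H2]]]].
    exists (fun s => (p1 s, p2 s)). split; [|split].
    + apply contC_pair. split; assumption.
    + rewrite e1, e2. now destruct l.
    + intros s. apply injective_projections; unfold Cplus, Cmult, RtoC; simpl.
      * rewrite (H1 s). ring.
      * rewrite (H2 s). ring.
  - intros [p [c [<- H]]]. apply contC_pair in c. destruct c as [c1 c2].
    split; [exists (fun s => fst (p s))|exists (fun s => snd (p s))];
      (split; [assumption|split; [reflexivity|]]); intros s; rewrite (H s);
      unfold Cplus, Cmult, RtoC; simpl; ring.
Qed.

Lemma rder_comp (f : C -> C) (g : R -> C) (t : R) (a b : C) :
  cder f (g t) a -> rder g t b -> rder (fun s => f (g s)) t (a * b)%C.
Proof.
  rewrite !rder_caratheodory. intros [q [hq [<- H]]] [p [hp [<- K]]].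
  exists (fun s => q (g s) * p s)%C. split; [|split; [reflexivity|]].
  - apply contC_mult; [|exact hp]. apply contC_comp; [|exact hq].
    apply (@continuous_ext R_UniformSpace CU (fun s => g t + p s * RtoC (s - t))%C).
    { intros s. now rewrite (K s). }
    apply contC_plus; [apply contC_const|]. apply contC_mult; [exact hp|].
    apply contC_pair. split; simpl; [|apply continuous_const].
    apply (continuous_minus (V := R_NormedModule)); [apply continuous_id|apply continuous_const].
  - intros s. assert (E : (g s - g t = p s * RtoC (s - t))%C) by (rewrite (K s); ring).
    rewrite (H (g s)), E. ring.
Qed.

Lemma rder_affine (a b : C) (t : R) : rder (fun s => a + RtoC s * b)%C t b.
Proof.
  split; simpl; auto_derive; auto; ring.
Qed.

Lemma dot_le (z w : C) : fst z * fst w + snd z * snd w <= Cmod z * Cmod w.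
Proof.
  replace (fst z * fst w + snd z * snd w) with (fst (Cconj z * w)%C) by (simpl; ring).
  eapply Rle_trans; [apply Rle_abs|]. rewrite <- (Cmod_conj z), <- Cmod_mult.
  apply abs_fst_le.
Qed.

Lemma Cmod_sqr (z : C) : Cmod z * Cmod z = fst z * fst z + snd z * snd z.
Proof. generalize (Cmod2_alt z). unfold Re, Im. intros H. simpl in H. lra. Qed.

(* The mean value inequality follows from the real one applied to the scalar
   product of the curve with its total increment. *)
Lemma curve_MVT (g g' : R -> C) (a b B : R) : a <= b ->
  (forall t, a <= t <= b -> rder g t (g' t) /\ Cmod (g' t) <= B) ->
  Cmod (g b - g a)%C <= B * (b - a).
Proof.
  intros hab H. set (D := (g b - g a)%C).
  destruct (Req_dec (Cmod D) 0) as [h0|h0].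
  { rewrite h0. apply Rmult_le_pos; [|lra].
    destruct (H a) as [_ h]; [lra|]. eapply Rle_trans; [apply Cmod_ge_0|exact h]. }
  assert (hD : 0 < Cmod D) by (generalize (Cmod_ge_0 D); lra).
  destruct (MVT_gen (fun t => fst D * fst (g t) + snd D * snd (g t)) a b
    (fun t => fst D * fst (g' t) + snd D * snd (g' t))) as [c [hc E]].
  - rewrite Rmin_left, Rmax_right by lra. intros t ht. destruct (H t) as [[h1 h2] _]; [lra|].
    apply (is_derive_plus (V := R_NormedModule)); apply is_derive_scal; assumption.
  - rewrite Rmin_left, Rmax_right by lra. intros t ht. destruct (H t) as [[h1 h2] _]; [lra|].
    apply continuity_pt_filterlim.
    apply (ex_derive_continuous (V := R_NormedModule)
      (fun t => fst D * fst (g t) + snd D * snd (g t)) t).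
    exists (fst D * fst (g' t) + snd D * snd (g' t)).
    apply (is_derive_plus (V := R_NormedModule)); apply is_derive_scal; assumption.
  - rewrite Rmin_left, Rmax_right in hc by lra.
    assert (E2 : Cmod D * Cmod D = (fst D * fst (g' c) + snd D * snd (g' c)) * (b - a)).
    { rewrite <- E, Cmod_sqr. unfold D. simpl. ring. }
    destruct (H c hc) as [_ hB]. assert (h := dot_le D (g' c)).
    apply Rmult_le_reg_l with (Cmod D); [exact hD|]. rewrite E2.
    apply Rle_trans with (Cmod D * Cmod (g' c) * (b - a)).
    + apply Rmult_le_compat_r; lra.
    + rewrite Rmult_assoc. apply Rmult_le_compat_l; [lra|].
      apply Rmult_le_compat_r; lra.
Qed.

Lemma segment_MVT (f f' : C -> C) (a b : C) (B : R) :
  (forall s, 0 <= s <= 1 -> let z := (a + RtoC s * (b - a))%C in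
     cder f z (f' z) /\ Cmod (f' z) <= B) ->
  Cmod (f b - f a)%C <= B * Cmod (b - a)%C.
Proof.
  intros H. set (g := fun s => f (a + RtoC s * (b - a))%C).
  assert (K : Cmod (g 1 - g 0)%C <= (B * Cmod (b - a)%C) * (1 - 0)).
  { apply (curve_MVT g (fun s => f' (a + RtoC s * (b - a)) * (b - a))%C); [lra|].
    intros t ht. destruct (H t ht) as [h1 h2]. split.
    - apply rder_comp; [exact h1|]. apply rder_affine.
    - rewrite Cmod_mult. apply Rmult_le_compat_r; [apply Cmod_ge_0|exact h2]. }
  unfold g in K.
  replace (a + 1 * (b - a))%C with b in K by ring.
  replace (a + 0 * (b - a))%C with a in K by ring. lra.
Qed.

(** * Integrals of complex-valued functions of a real variable *)

Definition is_Cint (g : R -> C) (a b : R) (I : C) : Prop :=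
  is_RInt (fun t => fst (g t)) a b (fst I) /\ is_RInt (fun t => snd (g t)) a b (snd I).

Definition Cint (g : R -> C) (a b : R) : C :=
  (RInt (fun t => fst (g t)) a b, RInt (fun t => snd (g t)) a b).

Lemma is_Cint_unique (g : R -> C) (a b : R) (I : C) : is_Cint g a b I -> Cint g a b = I.
Proof.
  intros [h1 h2]. unfold Cint.
  rewrite (is_RInt_unique _ _ _ _ h1), (is_RInt_unique _ _ _ _ h2). now destruct I.
Qed.

Lemma Cint_correct (g : R -> C) (a b : R) : a <= b ->
  (forall t, a <= t <= b -> @continuous R_UniformSpace CU g t) -> is_Cint g a b (Cint g a b).
Proof.
  intros hab H. split; apply (RInt_correct (V := R_CompleteNormedModule));
    apply (ex_RInt_continuous (V := R_CompleteNormedModule)); rewrite Rmin_left, Rmax_right by lra;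
    intros t ht; now apply contC_pair, H.
Qed.

Lemma is_Cint_plus (f g : R -> C) (a b : R) (I J : C) :
  is_Cint f a b I -> is_Cint g a b J -> is_Cint (fun t => f t + g t)%C a b (I + J)%C.
Proof. intros [h1 h2] [k1 k2]. split; simpl; now apply (is_RInt_plus (V := R_NormedModule)). Qed.

Lemma is_Cint_scal (c : C) (g : R -> C) (a b : R) (I : C) :
  is_Cint g a b I -> is_Cint (fun t => c * g t)%C a b (c * I)%C.
Proof.
  intros [h1 h2]. split; simpl.
  - apply (is_RInt_minus (V := R_NormedModule)); now apply (is_RInt_scal (V := R_NormedModule)).
  - apply (is_RInt_plus (V := R_NormedModule)); now apply (is_RInt_scal (V := R_NormedModule)).
Qed.

Lemma Cint_ext (f g : R -> C) (a b : R) : a <= b ->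
  (forall t, a < t < b -> f t = g t) -> Cint f a b = Cint g a b.
Proof.
  intros hab E. unfold Cint. f_equal; apply RInt_ext;
    rewrite Rmin_left, Rmax_right by lra; intros t ht; simpl; now rewrite E.
Qed.

Lemma is_Cint_Chasles (g : R -> C) (a b c : R) (I J : C) :
  is_Cint g a b I -> is_Cint g b c J -> is_Cint g a c (I + J)%C.
Proof. intros [h1 h2] [k1 k2]. split; simpl; now apply (is_RInt_Chasles (V := R_NormedModule)) with b. Qed.

Lemma Cint_Chasles (g : R -> C) (a b c : R) : a <= b -> b <= c ->
  (forall t, a <= t <= c -> @continuous R_UniformSpace CU g t) ->
  Cint g a c = (Cint g a b + Cint g b c)%C.
Proof.
  intros hab hbc H. apply is_Cint_unique, is_Cint_Chasles with b;
    apply Cint_correct; try assumption; intros t ht; apply H; lra.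
Qed.

Lemma Cint_point (g : R -> C) (a : R) : Cint g a a = 0.
Proof. unfold Cint. now rewrite !RInt_point. Qed.

Lemma is_Cint_FTC (g g' : R -> C) (a b : R) : a <= b ->
  (forall t, a <= t <= b -> rder g t (g' t)) ->
  (forall t, a <= t <= b -> @continuous R_UniformSpace CU g' t) ->
  is_Cint g' a b (g b - g a)%C.
Proof.
  intros hab H K. split;
    [apply (is_RInt_derive (V := R_CompleteNormedModule) (fun t => fst (g t)))
    |apply (is_RInt_derive (V := R_CompleteNormedModule) (fun t => snd (g t)))];
    rewrite Rmin_left, Rmax_right by lra;
    intros t ht; try (now apply H); now apply contC_pair, K.
Qed.

(** [|I|^2] is the integral of the scalar product of [I] with [g], hence at most [|I|] times the
    integral of [B]; dividing by [|I|] gives the claim. *)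
Lemma is_Cint_norm (g : R -> C) (B : R -> R) (a b : R) (I : C) (J : R) : a <= b ->
  (forall t, a <= t <= b -> Cmod (g t) <= B t) ->
  is_Cint g a b I -> is_RInt B a b J -> Cmod I <= J.
Proof.
  intros hab H [h1 h2] hB.
  destruct (Req_dec (Cmod I) 0) as [h0|h0].
  { rewrite h0. apply (is_RInt_ge_0 B a b); auto.
    intros t ht. eapply Rle_trans; [apply Cmod_ge_0|apply H; lra]. }
  assert (hI : 0 < Cmod I) by (generalize (Cmod_ge_0 I); lra).
  apply Rmult_le_reg_l with (Cmod I); [exact hI|]. rewrite Cmod_sqr.
  apply (is_RInt_le (fun t => fst I * fst (g t) + snd I * snd (g t)) (fun t => Cmod I * B t) a b);
    [exact hab| | |].
  - apply (is_RInt_plus (V := R_NormedModule)); now apply (is_RInt_scal (V := R_NormedModule)).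
  - now apply (is_RInt_scal (V := R_NormedModule)).
  - intros t ht. eapply Rle_trans; [apply dot_le|]. apply Rmult_le_compat_l; [lra|].
    apply H; lra.
Qed.

Lemma is_Cint_norm_const (g : R -> C) (B : R) (a b : R) (I : C) : a <= b ->
  (forall t, a <= t <= b -> Cmod (g t) <= B) -> is_Cint g a b I -> Cmod I <= B * (b - a).
Proof.
  intros hab H hI. apply (is_Cint_norm g (fun _ => B) a b I); auto.
  rewrite Rmult_comm. apply (is_RInt_const (V := R_NormedModule)).
Qed.

(** * Cauchy's theorem on rectangles *)

(** The counterclockwise integral along the boundary of [[x1, x2] x [y1, y2]]: bottom, right, top,
    left, with [dz = i dy] on the vertical sides. *)
Definition rint (f : C -> C) (x1 x2 y1 y2 : R) : C :=
  (Cint (fun x => f (x, y1)) x1 x2 + Ci * Cint (fun y => f (x2, y)) y1 y2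
   - Cint (fun x => f (x, y2)) x1 x2 - Ci * Cint (fun y => f (x1, y)) y1 y2)%C.

Definition edge (x1 x2 y1 y2 : R) (z : C) : Prop :=
  x1 <= fst z <= x2 /\ y1 <= snd z <= y2 /\
  (fst z = x1 \/ fst z = x2 \/ snd z = y1 \/ snd z = y2).

Ltac solve_edge :=
  unfold edge; simpl;
  (split; [lra || (intuition lra)|split; [lra || (intuition lra)|tauto]]).

Lemma line_h (f : C -> C) (x y : R) :
  ccont f (x, y) -> @continuous R_UniformSpace CU (fun t => f (t, y)) x.
Proof.
  intros H. apply (@contC_comp R_UniformSpace (fun t => (t, y))); [|exact H].
  apply contC_pair. split; simpl; [apply continuous_id|apply continuous_const].
Qed.

Lemma line_v (f : C -> C) (x y : R) :
  ccont f (x, y) -> @continuous R_UniformSpace CU (fun t => f (x, t)) y.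
Proof.
  intros H. apply (@contC_comp R_UniformSpace (fun t => (x, t))); [|exact H].
  apply contC_pair. split; simpl; [apply continuous_const|apply continuous_id].
Qed.

Lemma rint_correct (f : C -> C) (x1 x2 y1 y2 : R) : x1 <= x2 -> y1 <= y2 ->
  (forall z, edge x1 x2 y1 y2 z -> ccont f z) ->
  is_Cint (fun x => f (x, y1)) x1 x2 (Cint (fun x => f (x, y1)) x1 x2) /\
  is_Cint (fun y => f (x2, y)) y1 y2 (Cint (fun y => f (x2, y)) y1 y2) /\
  is_Cint (fun x => f (x, y2)) x1 x2 (Cint (fun x => f (x, y2)) x1 x2) /\
  is_Cint (fun y => f (x1, y)) y1 y2 (Cint (fun y => f (x1, y)) y1 y2).
Proof.
  intros hx hy H.
  split; [|split; [|split]]; apply Cint_correct; try assumption; intros t ht;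
    (apply line_h || apply line_v); apply H; solve_edge.
Qed.

Lemma rint_plus (f g : C -> C) (x1 x2 y1 y2 : R) : x1 <= x2 -> y1 <= y2 ->
  (forall z, edge x1 x2 y1 y2 z -> ccont f z) ->
  (forall z, edge x1 x2 y1 y2 z -> ccont g z) ->
  rint (fun w => f w + g w)%C x1 x2 y1 y2 = (rint f x1 x2 y1 y2 + rint g x1 x2 y1 y2)%C.
Proof.
  intros hx hy Hf Hg.
  destruct (rint_correct f x1 x2 y1 y2 hx hy Hf) as [a1 [a2 [a3 a4]]].
  destruct (rint_correct g x1 x2 y1 y2 hx hy Hg) as [b1 [b2 [b3 b4]]].
  unfold rint.
  rewrite (is_Cint_unique _ _ _ _ (is_Cint_plus _ _ _ _ _ _ a1 b1)),
    (is_Cint_unique _ _ _ _ (is_Cint_plus _ _ _ _ _ _ a2 b2)),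
    (is_Cint_unique _ _ _ _ (is_Cint_plus _ _ _ _ _ _ a3 b3)),
    (is_Cint_unique _ _ _ _ (is_Cint_plus _ _ _ _ _ _ a4 b4)).
  ring.
Qed.

Lemma rint_scal (c : C) (f : C -> C) (x1 x2 y1 y2 : R) : x1 <= x2 -> y1 <= y2 ->
  (forall z, edge x1 x2 y1 y2 z -> ccont f z) ->
  rint (fun w => c * f w)%C x1 x2 y1 y2 = (c * rint f x1 x2 y1 y2)%C.
Proof.
  intros hx hy Hf.
  destruct (rint_correct f x1 x2 y1 y2 hx hy Hf) as [a1 [a2 [a3 a4]]].
  unfold rint.
  rewrite (is_Cint_unique _ _ _ _ (is_Cint_scal c _ _ _ _ a1)),
    (is_Cint_unique _ _ _ _ (is_Cint_scal c _ _ _ _ a2)),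
    (is_Cint_unique _ _ _ _ (is_Cint_scal c _ _ _ _ a3)),
    (is_Cint_unique _ _ _ _ (is_Cint_scal c _ _ _ _ a4)).
  ring.
Qed.

Lemma rint_ext (f g : C -> C) (x1 x2 y1 y2 : R) : x1 <= x2 -> y1 <= y2 ->
  (forall z, edge x1 x2 y1 y2 z -> f z = g z) ->
  rint f x1 x2 y1 y2 = rint g x1 x2 y1 y2.
Proof.
  intros hx hy H. unfold rint.
  rewrite (Cint_ext (fun x => f (x, y1)) (fun x => g (x, y1))),
    (Cint_ext (fun x => f (x, y2)) (fun x => g (x, y2))),
    (Cint_ext (fun y => f (x1, y)) (fun y => g (x1, y))),
    (Cint_ext (fun y => f (x2, y)) (fun y => g (x2, y)));
    try assumption; [reflexivity| | | |]; intros t ht; apply H; solve_edge.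
Qed.

Lemma rint_minus (f g : C -> C) (x1 x2 y1 y2 : R) : x1 <= x2 -> y1 <= y2 ->
  (forall z, edge x1 x2 y1 y2 z -> ccont f z) ->
  (forall z, edge x1 x2 y1 y2 z -> ccont g z) ->
  rint (fun w => f w - g w)%C x1 x2 y1 y2 = (rint f x1 x2 y1 y2 - rint g x1 x2 y1 y2)%C.
Proof.
  intros hx hy Hf Hg.
  rewrite (rint_ext _ (fun w => f w + (- (1)) * g w)%C); try assumption; [|intros; ring].
  rewrite rint_plus; try assumption; [rewrite rint_scal; try assumption; ring|].
  intros z hz. apply ccont_mult; [apply ccont_const|now apply Hg].
Qed.

Lemma rint_hsplit (f : C -> C) (x1 x2 x3 y1 y2 : R) : x1 <= x2 -> x2 <= x3 ->
  (forall x, x1 <= x <= x3 -> ccont f (x, y1) /\ ccont f (x, y2)) ->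
  rint f x1 x3 y1 y2 = (rint f x1 x2 y1 y2 + rint f x2 x3 y1 y2)%C.
Proof.
  intros h1 h2 H. unfold rint.
  rewrite (Cint_Chasles (fun x => f (x, y1)) x1 x2 x3 h1 h2 (fun t ht => line_h _ _ _ (proj1 (H t ht)))),
    (Cint_Chasles (fun x => f (x, y2)) x1 x2 x3 h1 h2 (fun t ht => line_h _ _ _ (proj2 (H t ht)))).
  ring.
Qed.

Lemma rint_vsplit (f : C -> C) (x1 x2 y1 y2 y3 : R) : y1 <= y2 -> y2 <= y3 ->
  (forall y, y1 <= y <= y3 -> ccont f (x1, y) /\ ccont f (x2, y)) ->
  rint f x1 x2 y1 y3 = (rint f x1 x2 y1 y2 + rint f x1 x2 y2 y3)%C.
Proof.
  intros h1 h2 H. unfold rint.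
  rewrite (Cint_Chasles (fun y => f (x1, y)) y1 y2 y3 h1 h2 (fun t ht => line_v _ _ _ (proj1 (H t ht)))),
    (Cint_Chasles (fun y => f (x2, y)) y1 y2 y3 h1 h2 (fun t ht => line_v _ _ _ (proj2 (H t ht)))).
  ring.
Qed.

Lemma Cmod_rint_triangle (f : C -> C) (x1 x2 y1 y2 : R) :
  Cmod (rint f x1 x2 y1 y2) <=
  Cmod (Cint (fun x => f (x, y1)) x1 x2) + Cmod (Cint (fun y => f (x2, y)) y1 y2)
  + Cmod (Cint (fun x => f (x, y2)) x1 x2) + Cmod (Cint (fun y => f (x1, y)) y1 y2).
Proof.
  assert (hi : forall z, Cmod (Ci * z) = Cmod z)
    by (intros z; rewrite Cmod_mult, Cmod_Ci; ring).
  unfold rint, Cminus.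
  repeat (eapply Rle_trans; [apply Cmod_triangle|]; apply Rplus_le_compat);
    rewrite ?Cmod_opp, ?hi; lra.
Qed.

Lemma rint_norm (f : C -> C) (x1 x2 y1 y2 B : R) : x1 <= x2 -> y1 <= y2 ->
  (forall z, edge x1 x2 y1 y2 z -> ccont f z) ->
  (forall z, edge x1 x2 y1 y2 z -> Cmod (f z) <= B) ->
  Cmod (rint f x1 x2 y1 y2) <= 2 * B * ((x2 - x1) + (y2 - y1)).
Proof.
  intros hx hy Hf HB.
  destruct (rint_correct f x1 x2 y1 y2 hx hy Hf) as [a1 [a2 [a3 a4]]].
  eapply Rle_trans; [apply Cmod_rint_triangle|].
  assert (N := fun g a b I h => is_Cint_norm_const g B a b I h).
  apply N in a1; [|exact hx|intros t ht; apply HB; solve_edge].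
  apply N in a2; [|exact hy|intros t ht; apply HB; solve_edge].
  apply N in a3; [|exact hx|intros t ht; apply HB; solve_edge].
  apply N in a4; [|exact hy|intros t ht; apply HB; solve_edge].
  lra.
Qed.

(** Each side contributes the increment of [P] between its corners, and the four increments cancel
    around the boundary. *)
Lemma rint_primitive (P f : C -> C) (x1 x2 y1 y2 : R) : x1 <= x2 -> y1 <= y2 ->
  (forall z, edge x1 x2 y1 y2 z -> cder P z (f z)) ->
  (forall z, edge x1 x2 y1 y2 z -> ccont f z) ->
  rint f x1 x2 y1 y2 = 0.
Proof.
  intros hx hy HP Hf.
  assert (Hh : forall y, (y = y1 \/ y = y2) ->
    Cint (fun x => f (x, y)) x1 x2 = (P (x2, y) - P (x1, y))%C).
  { intros y e. apply is_Cint_unique.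
    apply (is_Cint_FTC (fun x => P (x, y))); [exact hx| |].
    - intros t ht. replace (f (t, y)) with (f (t, y) * 1)%C by ring.
      apply (rder_comp P (fun x => (x, y))).
      + apply HP. solve_edge.
      + split; simpl; auto_derive; auto.
    - intros t ht. apply line_h, Hf. solve_edge. }
  assert (Hv : forall x, (x = x1 \/ x = x2) ->
    (Ci * Cint (fun y => f (x, y)) y1 y2)%C = (P (x, y2) - P (x, y1))%C).
  { intros x e.
    assert (Hc : forall t, y1 <= t <= y2 ->
      @continuous R_UniformSpace CU (fun y => f (x, y)) t)
      by (intros t ht; apply line_v, Hf; solve_edge).
    rewrite <- (is_Cint_unique _ _ _ _ (is_Cint_scal Ci (fun y : R => f (x, y)) _ _ _ (Cint_correct (fun y : R => f (x, y)) _ _ hy Hc))).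
    apply is_Cint_unique.
    apply (is_Cint_FTC (fun y => P (x, y))); [exact hy| |].
    - intros t ht. rewrite Cmult_comm.
      apply (rder_comp P (fun y => (x, y))).
      + apply HP. solve_edge.
      + split; simpl; auto_derive; auto.
    - intros t ht. apply contC_mult; [apply contC_const|now apply Hc]. }
  unfold rint. rewrite !Hh, !Hv by auto. ring.
Qed.

(* Cousin's lemma, where only dyadic cells are tested so that their shape does not
   degenerate. *)
Lemma dyadic_cousin (P : R -> R -> R -> R -> Prop) (a b w0 h0 : R) :
  0 <= w0 -> 0 <= h0 ->
  (forall x y w h,
     P x y (w / 2) (h / 2) -> P (x + w / 2) y (w / 2) (h / 2) ->
     P x (y + h / 2) (w / 2) (h / 2) -> P (x + w / 2) (y + h / 2) (w / 2) (h / 2) ->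
     P x y w h) ->
  (forall p q, a <= p <= a + w0 -> b <= q <= b + h0 -> exists r, 0 < r /\
     forall x y n, let w := w0 / 2 ^ n in let h := h0 / 2 ^ n in
       x <= p <= x + w -> y <= q <= y + h -> w < r -> h < r -> P x y w h) ->
  P a b w0 h0.
Proof.
  intros hw hh split4 loc. apply NNPP. intros hn.
  assert (pick : forall x y w h, ~ P x y w h -> exists s : R * R,
    ~ P (fst s) (snd s) (w / 2) (h / 2) /\
    (fst s = x \/ fst s = x + w / 2) /\ (snd s = y \/ snd s = y + h / 2)).
  { intros x y w h np. apply NNPP. intros no. apply np, split4; apply NNPP; intros np';
      apply no.
    - exists (x, y); auto.
    - exists (x + w / 2, y); auto.
    - exists (x, y + h / 2); auto.
    - exists (x + w / 2, y + h / 2); auto. }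
  (* The default value [s] is never reached: by [inv], [P] fails on every cell of the sequence. *)
  set (nxt := fun (w h : R) (s : R * R) =>
    match excluded_middle_informative (~ P (fst s) (snd s) w h) with
    | left np => proj1_sig (constructive_indefinite_description _ (pick _ _ _ _ np))
    | right _ => s
    end).
  set (s := fix s n := match n with O => (a, b) | S m => nxt (w0 / 2 ^ m) (h0 / 2 ^ m) (s m) end).
  assert (inv : forall n, ~ P (fst (s n)) (snd (s n)) (w0 / 2 ^ n) (h0 / 2 ^ n)).
  { induction n as [|n IH].
    - simpl. now rewrite !Rdiv_1_r.
    - simpl s. unfold nxt.
      destruct (excluded_middle_informative _) as [np|np]; [|exfalso; exact (np IH)].
      destruct (constructive_indefinite_description _ _) as [t ht]. simpl. destruct ht as [h1 _].
      replace (w0 / (2 * 2 ^ n)) with (w0 / 2 ^ n / 2) by (field; apply pow_nonzero; lra).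
      replace (h0 / (2 * 2 ^ n)) with (h0 / 2 ^ n / 2) by (field; apply pow_nonzero; lra).
      exact h1. }
  assert (stp : forall n,
    (fst (s (S n)) = fst (s n) \/ fst (s (S n)) = fst (s n) + w0 / 2 ^ n / 2) /\
    (snd (s (S n)) = snd (s n) \/ snd (s (S n)) = snd (s n) + h0 / 2 ^ n / 2)).
  { intros n. simpl s. unfold nxt.
    destruct (excluded_middle_informative _) as [np|np]; [|exfalso; exact (np (inv n))].
    destruct (constructive_indefinite_description _ _) as [t ht]. simpl. apply ht. }
  (* Nested intervals: the left ends increase and the right ends [u n + l / 2^n] decrease, so the
     supremum of the left ends lies in all of them. *)
  assert (lim : forall (u : nat -> R) (l : R), 0 <= l ->
    (forall n, u (S n) = u n \/ u (S n) = u n + l / 2 ^ n / 2) ->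
    exists p, forall n, u n <= p <= u n + l / 2 ^ n).
  { intros u l hl hu.
    assert (hp : forall n, 0 <= l / 2 ^ n)
      by (intros; apply Rdiv_le_0_compat; [lra|apply pow_lt; lra]).
    assert (hS : forall n, l / 2 ^ S n = l / 2 ^ n / 2)
      by (intros; simpl; field; apply pow_nonzero; lra).
    assert (up : forall n k, u n <= u (k + n)%nat).
    { intros n k. induction k as [|k IH]; [simpl; lra|].
      simpl. specialize (hp (k + n)%nat). destruct (hu (k + n)%nat); lra. }
    assert (dn : forall n k, u (k + n)%nat + l / 2 ^ (k + n) <= u n + l / 2 ^ n).
    { intros n k. induction k as [|k IH]; [simpl; lra|].
      change (S k + n)%nat with (S (k + n)). rewrite hS.
      specialize (hp (k + n)%nat). destruct (hu (k + n)%nat); lra. }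
    assert (ub : forall n m, u m <= u n + l / 2 ^ n).
    { intros n m. apply Rle_trans with (u (m + n)%nat).
      - rewrite Nat.add_comm. apply up.
      - specialize (dn n m). specialize (hp (m + n)%nat). lra. }
    destruct (completeness (fun x => exists n, x = u n)) as [p [h1 h2]].
    - exists (u O + l / 2 ^ 0). intros x [n ->]. apply ub.
    - exists (u O). now exists O.
    - exists p. intros n. split; [apply h1; now exists n|].
      apply h2. intros x [k ->]. apply ub. }
  destruct (lim (fun n => fst (s n)) w0 hw (fun n => proj1 (stp n))) as [p hp].
  destruct (lim (fun n => snd (s n)) h0 hh (fun n => proj2 (stp n))) as [q hq].
  destruct (loc p q) as [r [hr K]].
  { specialize (hp O). simpl in hp. lra. }
  { specialize (hq O). simpl in hq. lra. }
  (* An [n] for which both [w0 / 2^n] and [h0 / 2^n] are below [r]; the summand 1 keeps the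
     denominator positive for a degenerate rectangle. *)
  destruct (pow_lt_1_zero (1 / 2)) with (y := r / (w0 + h0 + 1)) as [n hN].
  { rewrite Rabs_pos_eq; lra. }
  { apply Rdiv_lt_0_compat; lra. }
  specialize (hN n (le_n n)).
  assert (h2n : 0 < 2 ^ n) by (apply pow_lt; lra).
  rewrite Rabs_pos_eq in hN by (apply pow_le; lra).
  replace ((1 / 2) ^ n) with (/ 2 ^ n) in hN
    by (unfold Rdiv; rewrite Rmult_1_l; symmetry; apply pow_inv).
  assert (0 < / 2 ^ n) by now apply Rinv_0_lt_compat.
  apply Rlt_div_r in hN; [|lra].
  apply (inv n), K; [apply hp|apply hq| |]; unfold Rdiv; nra.
Qed.

(** The allowance [e (w^2 + h^2)] adds up exactly when a cell is cut in four. On a small cell it is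
    respected, because the affine approximation of [f] has a primitive and only the remainder
    contributes to the integral. *)
Lemma rint_goursat (f : C -> C) (x1 x2 y1 y2 : R) : x1 <= x2 -> y1 <= y2 ->
  (forall z, x1 <= fst z <= x2 -> y1 <= snd z <= y2 -> holo f z) ->
  rint f x1 x2 y1 y2 = 0.
Proof.
  intros hx hy H.
  set (A := (x2 - x1) * (x2 - x1) + (y2 - y1) * (y2 - y1)).
  assert (Hc : forall x y, x1 <= x <= x2 -> y1 <= y <= y2 -> ccont f (x, y))
    by (intros; apply holo_cont, H; simpl; assumption).
  assert (main : forall e, 0 < e -> Cmod (rint f x1 x2 y1 y2) <= e * A).
  { intros e he.
    assert (K : x1 <= x1 -> y1 <= y1 -> 0 <= x2 - x1 -> 0 <= y2 - y1 ->
      x1 + (x2 - x1) <= x2 -> y1 + (y2 - y1) <= y2 ->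
      Cmod (rint f x1 (x1 + (x2 - x1)) y1 (y1 + (y2 - y1))) <=
      e * ((x2 - x1) * (x2 - x1) + (y2 - y1) * (y2 - y1))).
    { apply (dyadic_cousin (fun x y w h => x1 <= x -> y1 <= y -> 0 <= w -> 0 <= h ->
        x + w <= x2 -> y + h <= y2 ->
        Cmod (rint f x (x + w) y (y + h)) <= e * (w * w + h * h))); try lra.
      - intros x y w h q1 q2 q3 q4 i1 i2 i3 i4 i5 i6.
        rewrite (rint_hsplit f x (x + w / 2)) by (try lra; intros; split; apply Hc; lra).
        rewrite (rint_vsplit f x (x + w / 2) y (y + h / 2)) by (try lra; intros; split; apply Hc; lra).
        rewrite (rint_vsplit f (x + w / 2) (x + w) y (y + h / 2)) by (try lra; intros; split; apply Hc; lra).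
        replace (x + w / 2 + w / 2) with (x + w) in * by field.
        replace (y + h / 2 + h / 2) with (y + h) in * by field.
        specialize (q1 ltac:(lra) ltac:(lra) ltac:(lra) ltac:(lra) ltac:(lra) ltac:(lra)).
        specialize (q2 ltac:(lra) ltac:(lra) ltac:(lra) ltac:(lra) ltac:(lra) ltac:(lra)).
        specialize (q3 ltac:(lra) ltac:(lra) ltac:(lra) ltac:(lra) ltac:(lra) ltac:(lra)).
        specialize (q4 ltac:(lra) ltac:(lra) ltac:(lra) ltac:(lra) ltac:(lra) ltac:(lra)).
        eapply Rle_trans; [apply Cmod_triangle|].
        eapply Rle_trans; [apply Rplus_le_compat; apply Cmod_triangle|].
        lra.
      - intros p q hp hq.
        destruct (H (p, q)) as [l Hl]; [simpl; lra|simpl; lra|].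
        (* Points of the boundary are within [w + h] of the base point and the boundary has length
           [2 (w + h)], so [e / 4] leads to [e (w + h)^2 / 2 <= e (w^2 + h^2)]. *)
        destruct (proj1 (cder_bound _ _ _) Hl (e / 4)) as [r [hr Kr]]; [lra|].
        exists (r / 2). split; [lra|].
        intros x y n w h hxp hyq hwr hhr i1 i2 i3 i4 i5 i6. clearbody w h. clear n.
        assert (Hd : forall z, edge x (x + w) y (y + h) z -> Cmod (z - (p, q)) <= w + h).
        { intros z [j1 [j2 _]]. eapply Rle_trans; [apply Cmod_le_abs|].
          simpl. apply Rplus_le_compat; apply Rabs_le; lra. }
        assert (Hz : forall z, edge x (x + w) y (y + h) z -> ccont f z).
        { intros z [j1 [j2 _]]. rewrite (surjective_pairing z). apply Hc; lra. }
        set (L := fun z => (f (p, q) + l * (z - (p, q)))%C).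
        assert (cL : forall z, ccont L z).
        { intros z. apply ccont_plus; [apply ccont_const|].
          apply ccont_mult; [apply ccont_const|].
          apply ccont_minus; [apply ccont_id|apply ccont_const]. }
        assert (E : rint f x (x + w) y (y + h) = rint (fun z => f z - L z)%C x (x + w) y (y + h)).
        { rewrite rint_minus by (try lra; auto).
          rewrite (rint_primitive (fun z => f (p, q) * z + (l / 2) * ((z - (p, q)) * (z - (p, q))))%C L);
            try lra; auto; [ring|].
          intros z _.
          assert (D1 := cder_minus _ _ _ _ _ (cder_id z) (cder_const (p, q) z)).
          assert (D2 := cder_scal (l / 2)%C _ _ _ (cder_mult _ _ _ _ _ D1 D1)).
          assert (D3 := cder_plus _ _ _ _ _ (cder_scal (f (p, q)) _ _ _ (cder_id z)) D2).
          cbv beta in D3. unfold L.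
          replace (f (p, q) + l * (z - (p, q)))%C with
            (f (p, q) * 1 + l / 2 * ((1 - 0) * (z - (p, q)) + (z - (p, q)) * (1 - 0)))%C;
            [exact D3|]. field. }
        rewrite E.
        eapply Rle_trans; [apply (rint_norm _ _ _ _ _ (e / 4 * (w + h))); try lra|].
        + intros z hz. apply ccont_minus; auto.
        + intros z hz. specialize (Hd z hz).
          replace (f z - L z)%C with (f z - f (p, q) - l * (z - (p, q)))%C by (unfold L; ring).
          eapply Rle_trans; [apply Kr; lra|]. apply Rmult_le_compat_l; lra.
        + assert (0 <= (w - h) * (w - h)) by apply Rle_0_sqr.
          assert (0 <= e * ((w - h) * (w - h))) by (apply Rmult_le_pos; lra).
          replace (x + w - x + (y + h - y)) with (w + h) by ring.
          replace (2 * (e / 4 * (w + h)) * (w + h))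
            with (e * (w * w + h * h) - e * ((w - h) * (w - h)) / 2) by field. lra. }
    replace (x1 + (x2 - x1)) with x2 in K by ring.
    replace (y1 + (y2 - y1)) with y2 in K by ring.
    apply K; lra. }
  apply Cmod_eq_0. apply Rle_antisym; [|apply Cmod_ge_0].
  apply le_epsilon. intros e he. rewrite Rplus_0_l.
  assert (hA : 0 <= A) by (unfold A; nra).
  eapply Rle_trans; [apply (main (e / (A + 1))); apply Rdiv_lt_0_compat; lra|].
  replace (e / (A + 1) * A) with (e * (A / (A + 1))) by (field; lra).
  assert (A / (A + 1) <= 1) by (apply Rle_div_l; lra). nra.
Qed.

(** * Cauchy's formula and its consequences *)

Definition inside (x1 x2 y1 y2 : R) (z : C) : Prop :=
  x1 < fst z < x2 /\ y1 < snd z < y2.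

Definition inrect (x1 x2 y1 y2 : R) (z : C) : Prop :=
  x1 <= fst z <= x2 /\ y1 <= snd z <= y2.

Lemma edge_inrect (x1 x2 y1 y2 : R) (z : C) : edge x1 x2 y1 y2 z -> inrect x1 x2 y1 y2 z.
Proof. unfold edge, inrect. tauto. Qed.

(** Goursat's lemma removes everything except a small square around [a]; there [g] is bounded by
    continuity, and the integral is of the order of the side. *)
Lemma rint_removable (g : C -> C) (a : C) (x1 x2 y1 y2 : R) :
  inside x1 x2 y1 y2 a ->
  (forall z, inrect x1 x2 y1 y2 z -> ccont g z) ->
  (forall z, inrect x1 x2 y1 y2 z -> z <> a -> holo g z) ->
  rint g x1 x2 y1 y2 = 0.
Proof.
  destruct a as [a1 a2]. intros [h1 h2] Hc Hh. simpl in h1, h2.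
  destruct (proj1 (ccontP g (a1, a2)) (Hc (a1, a2) ltac:(split; simpl; lra)) 1 Rlt_0_1) as [r [hr Hr]].
  set (B := Cmod (g (a1, a2)) + 1).
  assert (hB : 0 < B) by (generalize (Cmod_ge_0 (g (a1, a2))); unfold B; lra).
  apply Cmod_eq_0, Rle_antisym; [|apply Cmod_ge_0].
  apply le_epsilon. intros e he. rewrite Rplus_0_l.
  (* The square has half-side [m]: [r / 4] keeps it in the disc where [|g| <= B], and [e / (8 B)]
     makes the bound [2 B (4 m)] at most [e]. *)
  assert (hm : exists m, 0 < m /\ m <= a1 - x1 /\ m <= x2 - a1 /\ m <= a2 - y1 /\ m <= y2 - a2
     /\ m <= r / 4 /\ m <= e / (8 * B)).
  { exists (Rmin (Rmin (a1 - x1) (x2 - a1)) (Rmin (Rmin (a2 - y1) (y2 - a2)) (Rmin (r / 4) (e / (8 * B))))).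
    assert (0 < e / (8 * B)) by (apply Rdiv_lt_0_compat; lra).
    unfold Rmin. repeat destruct (Rle_dec _ _); lra. }
  destruct hm as [m [m0 [m1 [m2 [m3 [m4 [m5 m6]]]]]]].
  assert (Hc' : forall x y, x1 <= x <= x2 -> y1 <= y <= y2 -> ccont g (x, y))
    by (intros; apply Hc; split; simpl; lra).
  assert (Hh' : forall z, inrect x1 x2 y1 y2 z -> fst z <> a1 \/ snd z <> a2 -> holo g z).
  { intros z hz [n|n]; apply Hh; auto; intros ->; now apply n. }
  rewrite (rint_hsplit g x1 (a1 - m) x2) by (try lra; intros; split; apply Hc'; lra).
  rewrite (rint_goursat g x1 (a1 - m)); try lra;
    [|intros z i1 i2; apply Hh'; [split; lra|left; lra]].
  rewrite (rint_hsplit g (a1 - m) (a1 + m) x2) by (try lra; intros; split; apply Hc'; lra).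
  rewrite (rint_goursat g (a1 + m) x2); try lra;
    [|intros z i1 i2; apply Hh'; [split; lra|left; lra]].
  rewrite (rint_vsplit g (a1 - m) (a1 + m) y1 (a2 - m) y2) by (try lra; intros; split; apply Hc'; lra).
  rewrite (rint_goursat g (a1 - m) (a1 + m) y1 (a2 - m)); try lra;
    [|intros z i1 i2; apply Hh'; [split; lra|right; lra]].
  rewrite (rint_vsplit g (a1 - m) (a1 + m) (a2 - m) (a2 + m) y2) by (try lra; intros; split; apply Hc'; lra).
  rewrite (rint_goursat g (a1 - m) (a1 + m) (a2 + m) y2); try lra;
    [|intros z i1 i2; apply Hh'; [split; lra|right; lra]].
  rewrite !Cplus_0_l, !Cplus_0_r.
  eapply Rle_trans; [apply (rint_norm g _ _ _ _ B); try lra|].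
  - intros z [i1 [i2 _]]. apply Hc; split; lra.
  - intros z [i1 [i2 _]].
    assert (d : Cmod (z - (a1, a2)) < r).
    { eapply Rle_lt_trans; [apply Cmod_le_abs|]. simpl.
      assert (Rabs (fst z + - a1) <= m) by (apply Rabs_le; lra).
      assert (Rabs (snd z + - a2) <= m) by (apply Rabs_le; lra). lra. }
    specialize (Hr z d). unfold B.
    replace (g z) with (g (a1, a2) + (g z - g (a1, a2)))%C at 1 by ring.
    eapply Rle_trans; [apply Cmod_triangle|]. lra.
  - apply Rle_div_r in m6; [|lra].
    replace (a1 + m - (a1 - m) + (a2 + m - (a2 - m))) with (4 * m) by ring. lra.
Qed.

(** The curve is a logarithm of [w - a] up to an additive constant. Since the argument is expressed
    by an arctangent with the fixed ordinate [q] in the denominator, it is smooth along the whole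
    line. *)
Lemma rder_log_h (p q x : R) : q <> 0 ->
  rder (fun t => (/ 2 * ln ((t - p) * (t - p) + q * q), - atan ((t - p) / q))) x
    (Cinv (x - p, q)).
Proof.
  intros hq. assert (h1 := Rlt_0_sqr q hq). assert (h2 := Rle_0_sqr (x - p)).
  unfold Rsqr in h1, h2.
  split; simpl; auto_derive; trivial; try lra; field; repeat split; trivial; apply Rgt_not_eq; lra.
Qed.

(** Here the curve is [- i] times a logarithm, because the factor [i] of [dz = i dy] stays outside
    the integral in [rint]. *)
Lemma rder_log_v (p q y : R) : p <> 0 ->
  rder (fun t => (atan ((t - q) / p), - / 2 * ln (p * p + (t - q) * (t - q)))) y
    (Cinv (p, y - q)).
Proof.
  intros hp. assert (h1 := Rlt_0_sqr p hp). assert (h2 := Rle_0_sqr (y - q)).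
  unfold Rsqr in h1, h2.
  split; simpl; auto_derive; trivial; try lra; field; repeat split; trivial; apply Rgt_not_eq; lra.
Qed.

Lemma atan_complement (p q : R) : 0 < p -> 0 < q -> atan (p / q) + atan (q / p) = PI / 2.
Proof.
  intros hp hq. replace (q / p) with (/ (p / q)) by (field; lra).
  rewrite atan_inv by (apply Rdiv_lt_0_compat; lra). ring.
Qed.

Lemma inside_not_edge (x1 x2 y1 y2 : R) (a z : C) :
  inside x1 x2 y1 y2 a -> edge x1 x2 y1 y2 z -> (z - a <> 0)%C.
Proof.
  intros [h1 h2] [_ [_ h]]. apply Cminus_eq_contra. intros ->. lra.
Qed.

Lemma ccont_kernel (x1 x2 y1 y2 : R) (a z : C) :
  inside x1 x2 y1 y2 a -> edge x1 x2 y1 y2 z -> ccont (fun w => / (w - a))%C z.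
Proof.
  intros ha hz. apply (@contC_inv CU (fun w => w - a)%C).
  - now apply (inside_not_edge x1 x2 y1 y2).
  - apply ccont_minus; [apply ccont_id|apply ccont_const].
Qed.

(** The real logarithms cancel at the corners. Of the eight arctangents, the two belonging to one
    corner are complementary, so the four corners contribute [4 (PI / 2)]. *)
Lemma winding_rect (a : C) (x1 x2 y1 y2 : R) : inside x1 x2 y1 y2 a ->
  rint (fun w => / (w - a))%C x1 x2 y1 y2 = (2 * PI * Ci)%C.
Proof.
  intros ha. assert (hk := ccont_kernel x1 x2 y1 y2 a).
  destruct a as [p q]. destruct ha as [h1 h2]. simpl in h1, h2.
  assert (hc : forall z, edge x1 x2 y1 y2 z -> ccont (fun w => / (w - (p, q)))%C z)
    by (intros z hz; apply hk; [split; simpl; lra|exact hz]).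
  pose (gh := fun y t : R => (/ 2 * ln ((t - p) * (t - p) + (y - q) * (y - q)), - atan ((t - p) / (y - q)))).
  pose (gv := fun x t : R => (atan ((t - q) / (x - p)), - / 2 * ln ((x - p) * (x - p) + (t - q) * (t - q)))).
  assert (Eh : forall y, (y = y1 \/ y = y2) ->
    Cint (fun x => / ((x, y) - (p, q)))%C x1 x2 = (gh y x2 - gh y x1)%C).
  { intros y e. apply is_Cint_unique. apply (is_Cint_FTC (gh y)); [lra| |].
    - intros t _. apply rder_log_h. destruct e; lra.
    - intros t ht. apply (line_h (fun w => / (w - (p, q)))%C), hc. solve_edge. }
  assert (Ev : forall x, (x = x1 \/ x = x2) ->
    Cint (fun y => / ((x, y) - (p, q)))%C y1 y2 = (gv x y2 - gv x y1)%C).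
  { intros x e. apply is_Cint_unique. apply (is_Cint_FTC (gv x)); [lra| |].
    - intros t _. apply rder_log_v. destruct e; lra.
    - intros t ht. apply (line_v (fun w => / (w - (p, q)))%C), hc. solve_edge. }
  unfold rint. rewrite !Eh, !Ev by auto. unfold gh, gv.
  (* [A] and [B] give every arctangent positive arguments, as [atan_complement] requires. *)
  assert (A : forall u v, u < 0 -> atan (u / v) = - atan (- u / v))
    by (intros; rewrite <- atan_opp; f_equal; unfold Rdiv; ring).
  assert (B : forall u v, v < 0 -> atan (u / v) = - atan (u / - v))
    by (intros; rewrite <- atan_opp; f_equal; field; lra).
  assert (c1 := atan_complement (x2 - p) (y2 - q) ltac:(lra) ltac:(lra)).
  assert (c2 := atan_complement (x2 - p) (q - y1) ltac:(lra) ltac:(lra)).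
  assert (c3 := atan_complement (p - x1) (y2 - q) ltac:(lra) ltac:(lra)).
  assert (c4 := atan_complement (p - x1) (q - y1) ltac:(lra) ltac:(lra)).
  rewrite (A (x1 - p) (y1 - q)), (A (x1 - p) (y2 - q)), (A (y1 - q) (x1 - p)), (A (y1 - q) (x2 - p)) by lra.
  rewrite (B (x2 - p) (y1 - q)), (B (- (x1 - p)) (y1 - q)), (B (y2 - q) (x1 - p)), (B (- (y1 - q)) (x1 - p)) by lra.
  replace (- (x1 - p)) with (p - x1) by ring. replace (- (y1 - q)) with (q - y1) by ring.
  apply injective_projections; simpl; lra.
Qed.

(** The value at [w = a] fills the removable singularity. The function [D_z] of the overview is
    [ddiff (sine h) z]. *)
Definition ddiff (f : C -> C) (a w : C) : C :=
  if Ceq_dec w a then C_derive f a else ((f w - f a) / (w - a))%C.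

Lemma ddiff_neq (f : C -> C) (a w : C) : w <> a -> ddiff f a w = ((f w - f a) / (w - a))%C.
Proof. intros h. unfold ddiff. now destruct (Ceq_dec w a). Qed.

Lemma ddiff_eq (f : C -> C) (a : C) : ddiff f a a = C_derive f a.
Proof. unfold ddiff. destruct (Ceq_dec a a) as [_|n]; [reflexivity|now elim n]. Qed.

Lemma ddiff_mult (f : C -> C) (a w : C) : (f w = f a + (w - a) * ddiff f a w)%C.
Proof.
  unfold ddiff. destruct (Ceq_dec w a) as [->|n]; [ring|]. field. now apply Cminus_eq_contra.
Qed.

Lemma ddiff_cont (f : C -> C) (a : C) : holo f a -> ccont (ddiff f a) a.
Proof.
  intros H. destruct (holo_cder _ _ H) as [q [hq [e E]]].
  apply (@continuous_ext CU CU q); [|exact hq].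
  intros w. unfold ddiff. destruct (Ceq_dec w a) as [->|n]; [exact e|].
  change (q w = ((f w - f a) / (w - a))%C). rewrite (E w). field. now apply Cminus_eq_contra.
Qed.

Lemma near_neq (a z : C) : z <> a -> near z (fun w => w <> a).
Proof.
  intros h. exists (Cmod (z - a)). split.
  - now apply Cmod_gt_0, Cminus_eq_contra.
  - intros w hw ->. rewrite <- Cmod_opp in hw.
    replace (- (a - z))%C with (z - a)%C in hw by ring. lra.
Qed.

Lemma ddiff_holo_neq (f : C -> C) (a z : C) : z <> a -> holo f z -> holo (ddiff f a) z.
Proof.
  intros h H. apply holo_ext with (fun w => (f w - f a) / (w - a))%C.
  - generalize (near_neq _ _ h). apply near_imp. intros w hw. now rewrite ddiff_neq.
  - apply holo_div; [now apply Cminus_eq_contra| |];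
      (apply holo_minus; [|apply holo_const]); [exact H|apply holo_id].
Qed.

(** On the contour, [f w / (w - a)] is [ddiff f a w + f a / (w - a)]; the first part integrates to
    zero by [rint_removable], the second gives the winding number. *)
Lemma cauchy_formula (f : C -> C) (a : C) (x1 x2 y1 y2 : R) : inside x1 x2 y1 y2 a ->
  (forall z, inrect x1 x2 y1 y2 z -> holo f z) ->
  rint (fun w => f w / (w - a))%C x1 x2 y1 y2 = (2 * PI * Ci * f a)%C.
Proof.
  intros ha H. assert (hx : x1 <= x2 /\ y1 <= y2) by (destruct ha; lra). destruct hx as [hx hy].
  assert (hia : inrect x1 x2 y1 y2 a) by (destruct ha; split; lra).
  assert (K : rint (ddiff f a) x1 x2 y1 y2 = 0).
  { apply (rint_removable _ a); auto.
    - intros z hz. destruct (Ceq_dec z a) as [->|n]; [now apply ddiff_cont, H|].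
      apply holo_cont, ddiff_holo_neq; auto.
    - intros z hz n. apply ddiff_holo_neq; auto. }
  rewrite (rint_ext _ (fun w => ddiff f a w + f a * (/ (w - a)))%C); auto.
  - rewrite rint_plus, rint_scal, winding_rect, K; auto; [ring| | |].
    + intros z hz. now apply (ccont_kernel x1 x2 y1 y2).
    + intros z hz. apply edge_inrect in hz.
      destruct (Ceq_dec z a) as [->|n]; [now apply ddiff_cont, H|].
      apply holo_cont, ddiff_holo_neq; auto.
    + intros z hz. apply ccont_mult; [apply ccont_const|]. now apply (ccont_kernel x1 x2 y1 y2).
  - intros z hz. assert (n := inside_not_edge _ _ _ _ _ _ ha hz).
    rewrite ddiff_neq by (intros ->; apply n; ring). field. exact n.
Qed.

Lemma Cmod_rev_triangle (z w : C) : Cmod z - Cmod w <= Cmod (z - w)%C.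
Proof.
  replace z with ((z - w) + w)%C at 1 by ring.
  generalize (Cmod_triangle (z - w)%C w). lra.
Qed.

Lemma Cmod_minus_sym (z w : C) : Cmod (z - w)%C = Cmod (w - z)%C.
Proof. now rewrite <- (Cmod_opp (z - w)), Copp_minus_distr. Qed.

Lemma continuous_Cmod {U : UniformSpace} (g : U -> C) (x : U) :
  @continuous U CU g x -> continuous (fun y => Cmod (g y)) x.
Proof.
  rewrite continuous_CU. intros H. apply (filterlim_locally (U := R_UniformSpace)). intros e.
  generalize (H e (cond_pos e)). apply filter_imp. intros y hy.
  change (Rabs (Cmod (g y) - Cmod (g x)) < e).
  assert (h1 := Cmod_rev_triangle (g y) (g x)). assert (h2 := Cmod_rev_triangle (g x) (g y)).
  rewrite Cmod_minus_sym in h2. apply Rabs_lt_between. lra.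
Qed.

Lemma curve_bounded (g : R -> C) (a b : R) : a <= b ->
  (forall t, a <= t <= b -> @continuous R_UniformSpace CU g t) ->
  exists B, forall t, a <= t <= b -> Cmod (g t) <= B.
Proof.
  intros hab H.
  destruct (continuity_ab_maj (fun t => Cmod (g t)) a b hab) as [m [hm _]].
  - intros t ht. apply continuity_pt_filterlim. now apply continuous_Cmod, H.
  - now exists (Cmod (g m)).
Qed.

Lemma edge_bounded (f : C -> C) (x1 x2 y1 y2 : R) : x1 <= x2 -> y1 <= y2 ->
  (forall z, edge x1 x2 y1 y2 z -> ccont f z) ->
  exists B, 0 <= B /\ forall z, edge x1 x2 y1 y2 z -> Cmod (f z) <= B.
Proof.
  intros hx hy H.
  destruct (curve_bounded (fun x => f (x, y1)) x1 x2 hx) as [b1 h1];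
    [intros t ht; apply line_h, H; solve_edge|].
  destruct (curve_bounded (fun x => f (x, y2)) x1 x2 hx) as [b2 h2];
    [intros t ht; apply line_h, H; solve_edge|].
  destruct (curve_bounded (fun y => f (x1, y)) y1 y2 hy) as [b3 h3];
    [intros t ht; apply line_v, H; solve_edge|].
  destruct (curve_bounded (fun y => f (x2, y)) y1 y2 hy) as [b4 h4];
    [intros t ht; apply line_v, H; solve_edge|].
  exists (Rmax (Rmax b1 b2) (Rmax b3 b4)).
  assert (q1 := Rmax_l (Rmax b1 b2) (Rmax b3 b4)). assert (q2 := Rmax_r (Rmax b1 b2) (Rmax b3 b4)).
  assert (q3 := Rmax_l b1 b2). assert (q4 := Rmax_r b1 b2).
  assert (q5 := Rmax_l b3 b4). assert (q6 := Rmax_r b3 b4).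
  split.
  - specialize (h1 x1 ltac:(lra)). generalize (Cmod_ge_0 (f (x1, y1))). lra.
  - intros [x y] [i1 [i2 i3]]. simpl in *.
    destruct i3 as [e|[e|[e|e]]]; rewrite e in *;
    [specialize (h3 y i2)|specialize (h4 y i2)|specialize (h1 x i1)|specialize (h2 x i1)]; lra.
Qed.

(** * Cauchy integrals as functions of the pole *)

Lemma inside_gap (x1 x2 y1 y2 : R) (a : C) : inside x1 x2 y1 y2 a ->
  exists r, 0 < r /\ forall c, Cmod c < r ->
    inside x1 x2 y1 y2 (a + c)%C /\
    forall w, edge x1 x2 y1 y2 w -> r <= Cmod (w - (a + c))%C.
Proof.
  destruct a as [p q]. intros [h1 h2]. simpl in h1, h2.
  assert (hm : exists m, 0 < m /\ m <= p - x1 /\ m <= x2 - p /\ m <= q - y1 /\ m <= y2 - q).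
  { exists (Rmin (Rmin (p - x1) (x2 - p)) (Rmin (q - y1) (y2 - q))).
    unfold Rmin. repeat destruct (Rle_dec _ _); lra. }
  destruct hm as [m hm]. exists (m / 2). split; [lra|].
  intros [c1 c2] hc.
  assert (k1 := abs_fst_le (c1, c2)). assert (k2 := abs_snd_le (c1, c2)). simpl in k1, k2.
  assert (k3 : Rabs c1 < m / 2) by lra. assert (k4 : Rabs c2 < m / 2) by lra.
  apply Rabs_lt_between in k3. apply Rabs_lt_between in k4.
  split; [split; simpl; lra|].
  intros [x y] [i1 [i2 i3]]. simpl in *.
  destruct i3 as [e|[e|[e|e]]];
    [eapply Rle_trans; [|apply abs_fst_le]|eapply Rle_trans; [|apply abs_fst_le]
    |eapply Rle_trans; [|apply abs_snd_le]|eapply Rle_trans; [|apply abs_snd_le]]; simpl;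
    [rewrite Rabs_left1|rewrite Rabs_pos_eq|rewrite Rabs_left1|rewrite Rabs_pos_eq]; lra.
Qed.

(** A quadratic remainder of the kernel, uniform on the contour, passes through the integral by the
    length bound; this is differentiation under the integral sign. *)
Lemma rint_param (k : C -> C -> C) (k' : C -> C) (a : C) (x1 x2 y1 y2 r M : R) :
  x1 <= x2 -> y1 <= y2 -> 0 < r -> 0 <= M ->
  (forall c w, Cmod c < r -> edge x1 x2 y1 y2 w -> ccont (k (a + c)%C) w) ->
  (forall w, edge x1 x2 y1 y2 w -> ccont k' w) ->
  (forall c w, Cmod c < r -> edge x1 x2 y1 y2 w ->
     Cmod (k (a + c)%C w - k a w - c * k' w)%C <= M * (Cmod c * Cmod c)) ->
  cder (fun z => rint (k z) x1 x2 y1 y2) a (rint k' x1 x2 y1 y2).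
Proof.
  intros hx hy hr hM Hk Hk' HB. apply cder_bound. intros e he.
  set (L := 2 * M * (x2 - x1 + (y2 - y1)) + 1).
  assert (hL : 0 < L) by (unfold L; assert (0 <= M * (x2 - x1 + (y2 - y1))) by (apply Rmult_le_pos; lra); lra).
  exists (Rmin r (e / L)). split.
  { apply Rmin_case; [lra|]. apply Rdiv_lt_0_compat; lra. }
  intros z hz. set (c := (z - a)%C). assert (Ez : z = (a + c)%C) by (unfold c; ring).
  fold c in hz. rewrite Ez.
  assert (h1 : Cmod c < r) by (eapply Rlt_le_trans; [exact hz|apply Rmin_l]).
  assert (h2 : Cmod c < e / L) by (eapply Rlt_le_trans; [exact hz|apply Rmin_r]).
  assert (h0 := Cmod_ge_0 c).
  assert (Ha : forall w, edge x1 x2 y1 y2 w -> ccont (k a) w).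
  { intros w hw. replace a with (a + 0)%C by ring. apply Hk; [rewrite Cmod_0; lra|exact hw]. }
  replace (rint (k (a + c)%C) x1 x2 y1 y2 - rint (k a) x1 x2 y1 y2 - rint k' x1 x2 y1 y2 * c)%C
    with (rint (fun w => (k (a + c)%C w - k a w) - c * k' w)%C x1 x2 y1 y2).
  - eapply Rle_trans; [apply (rint_norm _ _ _ _ _ (M * (Cmod c * Cmod c))); auto|].
    + intros w hw. apply ccont_minus; [apply ccont_minus; auto|apply ccont_mult; [apply ccont_const|auto]].
    + apply Rlt_div_r in h2; [|exact hL].
      assert (0 <= Cmod c * (e - Cmod c * L)) by (apply Rmult_le_pos; lra).
      assert (0 <= Cmod c * Cmod c) by now apply Rmult_le_pos.
      unfold L in *.
      replace (2 * (M * (Cmod c * Cmod c)) * (x2 - x1 + (y2 - y1)))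
        with (e * Cmod c - Cmod c * (e - Cmod c * (2 * M * (x2 - x1 + (y2 - y1)) + 1)) - Cmod c * Cmod c)
        by ring. lra.
  - rewrite (rint_minus (fun w => k (a + c)%C w - k a w)%C (fun w => c * k' w)%C); auto.
    + rewrite rint_minus, rint_scal by auto. ring.
    + intros w hw. apply ccont_minus; auto.
    + intros w hw. apply ccont_mult; [apply ccont_const|auto].
Qed.

Lemma Cmod_inv_le (z : C) (r : R) : 0 < r -> r <= Cmod z -> Cmod (/ z)%C <= / r.
Proof.
  intros hr h. rewrite Cmod_inv by (apply Cmod_gt_0; lra). apply Rinv_le_contravar; assumption.
Qed.

Lemma Cmod_mult_le (z w : C) (a b : R) : Cmod z <= a -> Cmod w <= b -> Cmod (z * w)%C <= a * b.
Proof. intros. rewrite Cmod_mult. apply Rmult_le_compat; auto using Cmod_ge_0. Qed.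

(** The density [p] is only continuous on the contour, so [f w / (w - a)] is admissible as well;
    [ddiff_holo] uses this. *)
Lemma cauchy_integral_cder (p : C -> C) (a : C) (x1 x2 y1 y2 : R) : inside x1 x2 y1 y2 a ->
  (forall z, edge x1 x2 y1 y2 z -> ccont p z) ->
  cder (fun z => rint (fun w => p w * / (w - z))%C x1 x2 y1 y2) a
    (rint (fun w => p w * (/ (w - a) * / (w - a)))%C x1 x2 y1 y2).
Proof.
  intros ha Hp. assert (hx : x1 <= x2 /\ y1 <= y2) by (destruct ha; lra). destruct hx as [hx hy].
  destruct (inside_gap _ _ _ _ _ ha) as [r [hr Hr]].
  destruct (edge_bounded p _ _ _ _ hx hy Hp) as [B [hB0 hB]].
  assert (hr' : 0 < / r) by now apply Rinv_0_lt_compat.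
  apply (rint_param (fun z w => p w * / (w - z))%C _ a _ _ _ _ r (B * (/ r * (/ r * / r)))); auto.
  - repeat apply Rmult_le_pos; lra.
  - intros c w hc hw. apply ccont_mult; [auto|]. apply (ccont_kernel x1 x2 y1 y2); [|exact hw]. now apply Hr.
  - intros w hw. apply ccont_mult; [auto|]. apply ccont_mult; now apply (ccont_kernel x1 x2 y1 y2).
  - intros c w hc hw. destruct (Hr c hc) as [i1 i2]. specialize (i2 w hw).
    destruct (Hr 0) as [_ i3]; [rewrite Cmod_0; lra|]. specialize (i3 w hw). rewrite Cplus_0_r in i3.
    assert (n1 := inside_not_edge _ _ _ _ _ _ ha hw). assert (n2 := inside_not_edge _ _ _ _ _ _ i1 hw).
    replace (p w * / (w - (a + c)) - p w * / (w - a) - c * (p w * (/ (w - a) * / (w - a))))%C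
      with ((p w * (/ (w - a) * (/ (w - a) * / (w - (a + c))))) * (c * c))%C by (field; auto).
    apply Cmod_mult_le; [|rewrite Cmod_mult; lra].
    apply Cmod_mult_le; [now apply hB|].
    repeat apply Cmod_mult_le; apply Cmod_inv_le; assumption.
Qed.

Lemma cauchy_integral2_holo (p : C -> C) (a : C) (x1 x2 y1 y2 : R) : inside x1 x2 y1 y2 a ->
  (forall z, edge x1 x2 y1 y2 z -> ccont p z) ->
  holo (fun z => rint (fun w => p w * (/ (w - z) * / (w - z)))%C x1 x2 y1 y2) a.
Proof.
  intros ha Hp. assert (hx : x1 <= x2 /\ y1 <= y2) by (destruct ha; lra). destruct hx as [hx hy].
  destruct (inside_gap _ _ _ _ _ ha) as [r [hr Hr]].
  destruct (edge_bounded p _ _ _ _ hx hy Hp) as [B [hB0 hB]].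
  assert (hr' : 0 < / r) by now apply Rinv_0_lt_compat.
  set (i := / r) in *.
  eexists. apply (rint_param (fun z w => p w * (/ (w - z) * / (w - z)))%C
    (fun w => p w * (2 * (/ (w - a) * (/ (w - a) * / (w - a)))))%C a _ _ _ _ r
    (B * (i * (i * (i * i)) + 2 * (i * (i * (i * i)))))); auto.
  - apply Rmult_le_pos; [lra|]. assert (0 <= i * (i * (i * i))) by (repeat apply Rmult_le_pos; lra). lra.
  - intros c w hc hw. apply ccont_mult; [auto|].
    apply ccont_mult; (apply (ccont_kernel x1 x2 y1 y2); [|exact hw]); now apply Hr.
  - intros w hw. assert (kk := ccont_kernel _ _ _ _ _ _ ha hw).
    apply ccont_mult; [auto|]. apply ccont_mult; [apply ccont_const|].
    apply ccont_mult; [exact kk|]. apply ccont_mult; exact kk.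
  - intros c w hc hw. destruct (Hr c hc) as [i1 i2]. specialize (i2 w hw).
    destruct (Hr 0) as [_ i3]; [rewrite Cmod_0; lra|]. specialize (i3 w hw). rewrite Cplus_0_r in i3.
    assert (n1 := inside_not_edge _ _ _ _ _ _ ha hw). assert (n2 := inside_not_edge _ _ _ _ _ _ i1 hw).
    replace (p w * (/ (w - (a + c)) * / (w - (a + c))) - p w * (/ (w - a) * / (w - a))
       - c * (p w * (2 * (/ (w - a) * (/ (w - a) * / (w - a))))))%C
      with ((p w * (/ (w - a) * (/ (w - a) * (/ (w - (a + c)) * / (w - (a + c))))
          + 2 * (/ (w - a) * (/ (w - a) * (/ (w - a) * / (w - (a + c))))))) * (c * c))%C
      by (field; auto).
    apply Cmod_mult_le; [|rewrite Cmod_mult; lra].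
    apply Cmod_mult_le; [now apply hB|].
    eapply Rle_trans; [apply Cmod_triangle|]. apply Rplus_le_compat.
    + repeat apply Cmod_mult_le; apply Cmod_inv_le; assumption.
    + apply Cmod_mult_le; [rewrite Cmod_R, Rabs_pos_eq; lra|].
      repeat apply Cmod_mult_le; apply Cmod_inv_le; assumption.
Qed.

Lemma inside_near (x1 x2 y1 y2 : R) (a : C) : inside x1 x2 y1 y2 a ->
  near a (inside x1 x2 y1 y2).
Proof.
  intros ha. destruct (inside_gap _ _ _ _ _ ha) as [r [hr Hr]]. exists r. split; [exact hr|].
  intros w hw. replace w with (a + (w - a))%C by ring. now apply Hr.
Qed.

Lemma PI_neqC : RtoC PI <> 0.
Proof. intros e. apply RtoC_inj in e. generalize PI_RGT_0. lra. Qed.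

Lemma two_pi_i_neq : (2 * PI * Ci <> 0)%C.
Proof.
  repeat apply Cmult_neq_0; [|apply PI_neqC|apply Ci_nz].
  intros e. apply RtoC_inj in e. lra.
Qed.

Lemma cauchy_derivative (f : C -> C) (a : C) (x1 x2 y1 y2 : R) : inside x1 x2 y1 y2 a ->
  (forall z, inrect x1 x2 y1 y2 z -> holo f z) ->
  C_derive f a =
    (/ (2 * PI * Ci) * rint (fun w => f w * (/ (w - a) * / (w - a))) x1 x2 y1 y2)%C.
Proof.
  intros ha H. apply C_derive_cder.
  apply cder_ext with (fun z => / (2 * PI * Ci) * rint (fun w => f w * / (w - z)) x1 x2 y1 y2)%C.
  - generalize (inside_near _ _ _ _ _ ha). apply near_imp. intros z hz.
    assert (E := cauchy_formula f z _ _ _ _ hz H). unfold Cdiv in E. rewrite E.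
    rewrite Cmult_assoc, Cinv_l by exact two_pi_i_neq. ring.
  - apply cder_scal, cauchy_integral_cder; [exact ha|].
    intros z hz. now apply holo_cont, H, edge_inrect.
Qed.

Lemma inside_square (a : C) (s : R) : 0 < s ->
  inside (fst a - s) (fst a + s) (snd a - s) (snd a + s) a.
Proof. intros hs. split; lra. Qed.

Lemma near_square (a : C) (P : C -> Prop) : near a P -> exists s, 0 < s /\
  forall w, inrect (fst a - s) (fst a + s) (snd a - s) (snd a + s) w -> P w.
Proof.
  intros [r [hr H]]. exists (r / 4). split; [lra|]. intros w [h1 h2]. apply H.
  eapply Rle_lt_trans; [apply Cmod_le_abs|]. simpl.
  assert (Rabs (fst w + - fst a) <= r / 4) by (apply Rabs_le; lra).
  assert (Rabs (snd w + - snd a) <= r / 4) by (apply Rabs_le; lra). lra.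
Qed.

(** Near [a] the derivative is the contour integral with squared kernel, which is differentiable in
    its pole. *)
Lemma holo_derive (f : C -> C) (a : C) : near a (holo f) -> holo (C_derive f) a.
Proof.
  intros H. destruct (near_square _ _ H) as [s [hs Hs]]. assert (ha := inside_square a s hs).
  apply holo_ext with (fun z => / (2 * PI * Ci) * rint (fun w => f w * (/ (w - z) * / (w - z)))
     (fst a - s) (fst a + s) (snd a - s) (snd a + s))%C.
  - generalize (inside_near _ _ _ _ _ ha). apply near_imp. intros z hz.
    now rewrite (cauchy_derivative f z _ _ _ _ hz).
  - apply holo_mult; [apply holo_const|]. apply cauchy_integral2_holo; [exact ha|].
    intros z hz. now apply holo_cont, Hs, edge_inrect.
Qed.

(** On the square of half-side [s] the kernel is at most [1 / s^2] and the perimeter is [8 s];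
    dividing [8 B / s] by [2 PI] leaves at most [2 B / s], since [PI > 2]. *)
Lemma cauchy_estimate (f : C -> C) (a : C) (s B : R) : 0 < s ->
  (forall w, inrect (fst a - s) (fst a + s) (snd a - s) (snd a + s) w ->
     holo f w /\ Cmod (f w) <= B) ->
  Cmod (C_derive f a) <= 2 / s * B.
Proof.
  intros hs H. assert (ha := inside_square a s hs).
  assert (hB : 0 <= B).
  { destruct (H a) as [_ h]; [split; lra|]. eapply Rle_trans; [apply Cmod_ge_0|exact h]. }
  rewrite (cauchy_derivative f a _ _ _ _ ha) by (intros; now apply H).
  assert (hp := PI_RGT_0). assert (hp2 := PI2_1). assert (hs' := Rinv_0_lt_compat s hs).
  assert (K : Cmod (rint (fun w => f w * (/ (w - a) * / (w - a)))%C
    (fst a - s) (fst a + s) (snd a - s) (snd a + s)) <= 8 * B * / s).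
  { eapply Rle_trans; [apply (rint_norm _ _ _ _ _ (B * (/ s * / s))); try lra|].
    - intros z hz. apply ccont_mult; [now apply holo_cont, H, edge_inrect|].
      apply ccont_mult; now apply (ccont_kernel _ _ _ _ _ _ ha hz).
    - intros z hz. apply Cmod_mult_le; [now apply H, edge_inrect|].
      assert (hd : s <= Cmod (z - a)).
      { destruct hz as [i1 [i2 [e|[e|[e|e]]]]];
        [eapply Rle_trans; [|apply abs_fst_le]|eapply Rle_trans; [|apply abs_fst_le]
        |eapply Rle_trans; [|apply abs_snd_le]|eapply Rle_trans; [|apply abs_snd_le]]; simpl;
        rewrite e; [rewrite Rabs_left1|rewrite Rabs_pos_eq|rewrite Rabs_left1|rewrite Rabs_pos_eq]; lra. }
      apply Cmod_mult_le; apply Cmod_inv_le; assumption.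
    - apply Req_le. field. lra. }
  rewrite Cmod_mult, Cmod_inv by exact two_pi_i_neq.
  rewrite !Cmod_mult, Cmod_Ci, !Cmod_R, !Rabs_pos_eq by lra.
  assert (0 <= B * / s) by (apply Rmult_le_pos; lra).
  apply Rmult_le_reg_l with (2 * PI * 1); [lra|].
  rewrite <- Rmult_assoc, Rinv_r by lra. unfold Rdiv. nra.
Qed.

(** Partial fractions of [1 / ((w - a) (w - z))] show that the divided difference is the Cauchy
    integral with density [f w / (w - a)]. *)
Lemma ddiff_holo (f : C -> C) (a : C) : near a (holo f) -> holo (ddiff f a) a.
Proof.
  intros H. destruct (near_square _ _ H) as [s [hs Hs]]. assert (ha := inside_square a s hs).
  set (x1 := fst a - s) in *. set (x2 := fst a + s) in *.
  set (y1 := snd a - s) in *. set (y2 := snd a + s) in *.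
  assert (hx : x1 <= x2 /\ y1 <= y2) by (destruct ha; lra). destruct hx as [hx hy].
  assert (Hf : forall z, edge x1 x2 y1 y2 z -> ccont f z)
    by (intros z hz; now apply holo_cont, Hs, edge_inrect).
  assert (Hk : forall b z, inside x1 x2 y1 y2 b -> edge x1 x2 y1 y2 z -> ccont (fun w => f w * / (w - b))%C z)
    by (intros b z hb hz; apply ccont_mult; [auto|now apply (ccont_kernel x1 x2 y1 y2)]).
  apply holo_ext with (fun z => / (2 * PI * Ci) *
    rint (fun w => (f w * / (w - a)) * / (w - z)) x1 x2 y1 y2)%C.
  - generalize (inside_near _ _ _ _ _ ha). apply near_imp. intros z hz.
    destruct (Ceq_dec z a) as [->|n].
    + rewrite ddiff_eq, (cauchy_derivative f a _ _ _ _ ha Hs). f_equal.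
      apply rint_ext; auto. intros w _. ring.
    + assert (hn := Cminus_eq_contra _ _ n). rewrite ddiff_neq by exact n.
      assert (E1 := cauchy_formula f a _ _ _ _ ha Hs). assert (E2 := cauchy_formula f z _ _ _ _ hz Hs).
      unfold Cdiv in E1, E2.
      rewrite (rint_ext _ (fun w => / (z - a) * (f w * / (w - z) - f w * / (w - a)))%C); auto.
      * rewrite rint_scal, rint_minus, E1, E2; auto; [field; repeat split; [exact hn|exact Ci_nz|exact PI_neqC]|].
        intros w hw. apply ccont_minus; auto.
      * intros w hw. field. repeat split; auto; now apply (inside_not_edge x1 x2 y1 y2).
  - apply holo_mult; [apply holo_const|]. eexists. apply cauchy_integral_cder; auto.
Qed.

(** * Exponential, sine and logarithm *)

Lemma Cexp_plus (z w : C) : Cexp (z + w)%C = (Cexp z * Cexp w)%C.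
Proof.
  unfold Cexp. destruct z as [a b], w as [c d]. simpl.
  rewrite exp_plus, cos_plus, sin_plus. apply injective_projections; simpl; ring.
Qed.

Lemma Cexp_0 : Cexp 0 = 1.
Proof. unfold Cexp. simpl. rewrite exp_0, cos_0, sin_0. apply injective_projections; simpl; ring. Qed.

Lemma Cmod_Cexp (z : C) : Cmod (Cexp z) = exp (fst z).
Proof.
  unfold Cmod, Cexp, Re, Im. simpl.
  replace (exp (fst z) * cos (snd z) * (exp (fst z) * cos (snd z) * 1) +
     exp (fst z) * sin (snd z) * (exp (fst z) * sin (snd z) * 1))
    with ((exp (fst z)) ^ 2 * ((sin (snd z))² + (cos (snd z))²)) by (unfold Rsqr; ring).
  rewrite sin2_cos2, Rmult_1_r. apply sqrt_pow2. left. apply exp_pos.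
Qed.

Lemma Cexp_neq_0 (z : C) : Cexp z <> 0.
Proof. apply Cmod_gt_0. rewrite Cmod_Cexp. apply exp_pos. Qed.

Lemma Cexp_opp (z : C) : Cexp (- z)%C = (/ Cexp z)%C.
Proof.
  assert (h := Cexp_neq_0 z).
  replace (/ Cexp z)%C with (/ Cexp z * Cexp (z + - z))%C
    by (rewrite Cplus_opp_r, Cexp_0; ring).
  rewrite Cexp_plus. field. exact h.
Qed.

Lemma rder_Cexp_line (c : C) (s : R) :
  rder (fun t => Cexp (RtoC t * c)) s (c * Cexp (RtoC s * c))%C.
Proof.
  destruct c as [a b].
  assert (E : forall t, Cexp (RtoC t * (a, b)) = (exp (t * a) * cos (t * b), exp (t * a) * sin (t * b))).
  { intros t. unfold Cexp, Re, Im. simpl.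
    replace (t * a - 0 * b) with (t * a) by ring. now replace (t * b + 0 * a) with (t * b) by ring. }
  split.
  - apply is_derive_ext with (fun t => exp (t * a) * cos (t * b)); [intros t; now rewrite E|].
    rewrite E. simpl. auto_derive; trivial. ring.
  - apply is_derive_ext with (fun t => exp (t * a) * sin (t * b)); [intros t; now rewrite E|].
    rewrite E. simpl. auto_derive; trivial. ring.
Qed.

Lemma exp_le (x y : R) : x <= y -> exp x <= exp y.
Proof. intros [h| ->]; [left; now apply exp_increasing|lra]. Qed.

Lemma Cmod_Cexp_line (c : C) (s : R) : 0 <= s <= 1 -> Cmod (Cexp (RtoC s * c)) <= exp (Cmod c).
Proof.
  intros hs. rewrite Cmod_Cexp. apply exp_le. simpl.
  generalize (Rle_trans _ _ _ (Rle_abs _) (abs_fst_le c)) (Cmod_ge_0 c). nra.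
Qed.

Lemma Cexp_minus_1 (c : C) : Cmod (Cexp c - 1)%C <= Cmod c * exp (Cmod c).
Proof.
  assert (H := curve_MVT (fun t => Cexp (RtoC t * c)) (fun t => c * Cexp (RtoC t * c))%C
    0 1 (Cmod c * exp (Cmod c)) Rle_0_1). cbv beta in H.
  replace (RtoC 1 * c)%C with c in H by ring.
  replace (RtoC 0 * c)%C with (RtoC 0) in H by ring. rewrite Cexp_0 in H.
  eapply Rle_trans; [apply H|lra]. intros t ht. split; [apply rder_Cexp_line|].
  rewrite Cmod_mult. apply Rmult_le_compat_l; [apply Cmod_ge_0|now apply Cmod_Cexp_line].
Qed.

(** Mean value inequality for [e^(t c) - t c] on [[0, 1]], whose derivative [c (e^(t c) - 1)] is
    controlled by the first-order bound. *)
Lemma Cexp_order2 (c : C) :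
  Cmod (Cexp c - 1 - c)%C <= Cmod c * Cmod c * exp (Cmod c).
Proof.
  assert (H := curve_MVT (fun t => Cexp (RtoC t * c) - RtoC t * c)%C
    (fun t => c * (Cexp (RtoC t * c) - 1))%C
    0 1 (Cmod c * Cmod c * exp (Cmod c)) Rle_0_1). cbv beta in H.
  replace (RtoC 1 * c)%C with c in H by ring.
  replace (RtoC 0 * c)%C with (RtoC 0) in H by ring. rewrite Cexp_0 in H.
  replace (Cexp c - c - (1 - 0))%C with (Cexp c - 1 - c)%C in H by ring.
  eapply Rle_trans; [apply H|lra]. intros t ht. split.
  - destruct (rder_Cexp_line c t) as [h1 h2]. split.
    + replace (fst (c * (Cexp (RtoC t * c) - 1))%C)
        with (minus (fst (c * Cexp (RtoC t * c))%C) (fst c))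
        by (unfold minus, plus, opp; simpl; ring).
      apply (is_derive_minus (V := R_NormedModule) (fun s => fst (Cexp (RtoC s * c)))); [exact h1|].
      simpl. auto_derive; trivial; ring.
    + replace (snd (c * (Cexp (RtoC t * c) - 1))%C)
        with (minus (snd (c * Cexp (RtoC t * c))%C) (snd c))
        by (unfold minus, plus, opp; simpl; ring).
      apply (is_derive_minus (V := R_NormedModule) (fun s => snd (Cexp (RtoC s * c)))); [exact h2|].
      simpl. auto_derive; trivial; ring.
  - rewrite Cmod_mult, Rmult_assoc. apply Rmult_le_compat_l; [apply Cmod_ge_0|].
    assert (h0 := Cmod_ge_0 c).
    assert (hm : Cmod (RtoC t * c) <= Cmod c)
      by (rewrite Cmod_mult, Cmod_R, Rabs_pos_eq by lra; nra).
    eapply Rle_trans; [apply Cexp_minus_1|].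
    apply Rmult_le_compat; [apply Cmod_ge_0|left; apply exp_pos|exact hm|now apply exp_le].
Qed.

Lemma cder_Cexp (z : C) : cder Cexp z (Cexp z).
Proof.
  apply cder_bound. intros e he. assert (h3 := exp_pos (fst z)).
  exists (Rmin 1 (e / (exp (fst z) * exp 1))). assert (h4 := exp_pos 1).
  assert (h5 : 0 < exp (fst z) * exp 1) by now apply Rmult_lt_0_compat.
  split; [apply Rmin_case; [lra|now apply Rdiv_lt_0_compat]|].
  intros w hw. set (c := (w - z)%C) in *. replace w with (z + c)%C by (unfold c; ring).
  assert (h1 : Cmod c < 1) by (eapply Rlt_le_trans; [exact hw|apply Rmin_l]).
  assert (h2 : Cmod c < e / (exp (fst z) * exp 1)) by (eapply Rlt_le_trans; [exact hw|apply Rmin_r]).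
  apply Rlt_div_r in h2; [|exact h5].
  rewrite Cexp_plus.
  replace (Cexp z * Cexp c - Cexp z - Cexp z * c)%C with (Cexp z * (Cexp c - 1 - c))%C by ring.
  rewrite Cmod_mult, Cmod_Cexp.
  eapply Rle_trans; [apply Rmult_le_compat_l; [lra|apply Cexp_order2]|].
  assert (h0 := Cmod_ge_0 c).
  apply Rle_trans with (exp (fst z) * (Cmod c * Cmod c * exp 1)).
  - apply Rmult_le_compat_l; [lra|]. apply Rmult_le_compat_l; [now apply Rmult_le_pos|].
    apply exp_le. lra.
  - replace (exp (fst z) * (Cmod c * Cmod c * exp 1))
      with ((Cmod c * (exp (fst z) * exp 1)) * Cmod c) by ring.
    apply Rmult_le_compat_r; lra.
Qed.

(** * Complex sine and cosine *)

Definition Csin (z : C) : C := (sin (fst z) * cosh (snd z), cos (fst z) * sinh (snd z)).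
Definition Ccos (z : C) : C := (cos (fst z) * cosh (snd z), - (sin (fst z) * sinh (snd z))).

(** The exponential form serves for differentiation; moduli and zeros are read off from the
    coordinates. *)
Lemma Csin_Cexp (z : C) : Csin z = (- Ci / 2 * (Cexp (Ci * z) - Cexp (- Ci * z)))%C.
Proof.
  destruct z as [x y]. unfold Csin, Cexp, cosh, sinh, Re, Im. simpl.
  replace (0 * x - 1 * y) with (- y) by ring.
  replace (- 0 * x - - (1) * y) with y by ring.
  replace (0 * y + 1 * x) with x by ring.
  replace (- 0 * y + - (1) * x) with (- x) by ring.
  rewrite cos_neg, sin_neg. apply injective_projections; simpl; field.
Qed.

Lemma Ccos_Cexp (z : C) : Ccos z = (/ 2 * (Cexp (Ci * z) + Cexp (- Ci * z)))%C.
Proof.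
  destruct z as [x y]. unfold Ccos, Cexp, cosh, sinh, Re, Im. simpl.
  replace (0 * x - 1 * y) with (- y) by ring.
  replace (- 0 * x - - (1) * y) with y by ring.
  replace (0 * y + 1 * x) with x by ring.
  replace (- 0 * y + - (1) * x) with (- x) by ring.
  rewrite cos_neg, sin_neg. apply injective_projections; simpl; field.
Qed.

Lemma cder_Csin (z : C) : cder Csin z (Ccos z).
Proof.
  apply cder_ext with (fun w => - Ci / 2 * (Cexp (Ci * w) - Cexp (- Ci * w)))%C.
  { exists 1. split; [lra|]. intros w _. now rewrite Csin_Cexp. }
  rewrite Ccos_Cexp.
  assert (D : forall c, cder (fun w => Cexp (c * w)%C) z (Cexp (c * z) * (c * 1))%C)
    by (intros c; apply cder_comp; [apply cder_Cexp|apply cder_scal, cder_id]).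
  assert (K := cder_scal (- Ci / 2)%C _ _ _ (cder_minus _ _ _ _ _ (D Ci) (D (- Ci)%C))).
  replace (/ 2 * (Cexp (Ci * z) + Cexp (- Ci * z)))%C
    with (- Ci / 2 * (Cexp (Ci * z) * (Ci * 1) - Cexp (- Ci * z) * (- Ci * 1)))%C; [exact K|].
  assert (Ci * Ci = - (1))%C by (apply injective_projections; simpl; ring).
  replace (- Ci / 2 * (Cexp (Ci * z) * (Ci * 1) - Cexp (- Ci * z) * (- Ci * 1)))%C
    with (- (Ci * Ci) * / 2 * (Cexp (Ci * z) + Cexp (- Ci * z)))%C by (unfold Cdiv; ring).
  rewrite H. ring.
Qed.

Lemma cosh2_sinh2 (y : R) : cosh y * cosh y = 1 + sinh y * sinh y.
Proof.
  unfold cosh, sinh.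
  assert (exp y * exp (- y) = 1) by (rewrite <- exp_plus, Rplus_opp_r; apply exp_0).
  lra.
Qed.

Lemma cosh_pos (y : R) : 0 < cosh y.
Proof. unfold cosh. generalize (exp_pos y) (exp_pos (- y)). lra. Qed.

Lemma cosh_le_exp (y : R) : cosh y <= exp (Rabs y).
Proof.
  unfold cosh. assert (exp y <= exp (Rabs y)) by (apply exp_le, Rle_abs).
  assert (exp (- y) <= exp (Rabs y)) by (apply exp_le; rewrite <- Rabs_Ropp; apply Rle_abs). lra.
Qed.

(** The source of the growth bound, of the location of the zeros, and of the lower bounds on both
    kinds of sides of the contour. *)
Lemma Cmod_Csin_sqr (z : C) :
  Cmod (Csin z) * Cmod (Csin z) = sin (fst z) * sin (fst z) + sinh (snd z) * sinh (snd z).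
Proof.
  rewrite Cmod_sqr. simpl. assert (h := cosh2_sinh2 (snd z)). assert (h2 := sin2_cos2 (fst z)).
  unfold Rsqr in h2.
  replace (sin (fst z) * cosh (snd z) * (sin (fst z) * cosh (snd z)) +
    cos (fst z) * sinh (snd z) * (cos (fst z) * sinh (snd z)))
  with (sin (fst z) * sin (fst z) * (cosh (snd z) * cosh (snd z)) +
    cos (fst z) * cos (fst z) * (sinh (snd z) * sinh (snd z))) by ring.
  rewrite h. replace (cos (fst z) * cos (fst z)) with (1 - sin (fst z) * sin (fst z)) by lra. ring.
Qed.

Lemma le_of_sqr_le (a b : R) : 0 <= b -> a * a <= b * b -> a <= b.
Proof. intros hb h. apply Rnot_lt_le. intros hab. nra. Qed.

Lemma Cmod_Csin_le (z : C) : Cmod (Csin z) <= exp (Rabs (snd z)).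
Proof.
  eapply Rle_trans; [|apply cosh_le_exp]. apply le_of_sqr_le; [left; apply cosh_pos|].
  rewrite Cmod_Csin_sqr, cosh2_sinh2. assert (h2 := sin2_cos2 (fst z)). unfold Rsqr in h2.
  assert (0 <= cos (fst z) * cos (fst z)) by apply Rle_0_sqr. lra.
Qed.

Lemma Cmod_Ccos_le (z : C) : Cmod (Ccos z) <= exp (Rabs (snd z)).
Proof.
  eapply Rle_trans; [|apply cosh_le_exp]. apply le_of_sqr_le; [left; apply cosh_pos|].
  rewrite Cmod_sqr. simpl. assert (h2 := sin2_cos2 (fst z)). unfold Rsqr in h2.
  assert (h := cosh2_sinh2 (snd z)).
  replace (cos (fst z) * cosh (snd z) * (cos (fst z) * cosh (snd z)) +
    - (sin (fst z) * sinh (snd z)) * - (sin (fst z) * sinh (snd z)))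
  with (cos (fst z) * cos (fst z) * (cosh (snd z) * cosh (snd z)) +
    sin (fst z) * sin (fst z) * (sinh (snd z) * sinh (snd z))) by ring.
  rewrite h. replace (cos (fst z) * cos (fst z)) with (1 - sin (fst z) * sin (fst z)) by lra.
  assert (0 <= sin (fst z) * sin (fst z)) by apply Rle_0_sqr. lra.
Qed.

Lemma Csin_eq_0 (z : C) : Csin z = 0 -> snd z = 0 /\ sin (fst z) = 0.
Proof.
  intros h. assert (h1 := Cmod_Csin_sqr z). rewrite h, Cmod_0 in h1.
  assert (a1 := Rle_0_sqr (sin (fst z))). assert (a2 := Rle_0_sqr (sinh (snd z))).
  unfold Rsqr in a1, a2. split; [|nra].
  assert (e : sinh (snd z) = 0) by nra.
  destruct (Rtotal_order (snd z) 0) as [l|[l|l]]; [|exact l|];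
    apply sinh_lt in l; rewrite sinh_0 in l; lra.
Qed.

Lemma sin_IZR_PI (k : Z) : sin (IZR k * PI) = 0.
Proof. apply sin_eq_0_1. now exists k. Qed.

Lemma Csin_shift (w : C) (k : Z) :
  Csin (w + RtoC (IZR k * PI))%C = (RtoC (cos (IZR k * PI)) * Csin w)%C.
Proof.
  unfold Csin. simpl. rewrite sin_plus, cos_plus, sin_IZR_PI, Rplus_0_r.
  apply injective_projections; simpl; ring.
Qed.

Lemma cos_IZR_PI_sqr (k : Z) : cos (IZR k * PI) * cos (IZR k * PI) = 1.
Proof.
  assert (h := sin2_cos2 (IZR k * PI)). rewrite sin_IZR_PI in h. unfold Rsqr in h. lra.
Qed.

Definition csinc : C -> C := ddiff Csin 0.

Lemma holo_Csin (z : C) : holo Csin z.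
Proof. eexists. apply cder_Csin. Qed.

Lemma near_all (z : C) (P : C -> Prop) : (forall w, P w) -> near z P.
Proof. intros H. exists 1. split; [lra|auto]. Qed.

Lemma Csin_0 : Csin 0 = 0.
Proof. unfold Csin. simpl. rewrite sin_0, sinh_0. apply injective_projections; simpl; ring. Qed.

Lemma Ccos_0 : Ccos 0 = 1.
Proof. unfold Ccos. simpl. rewrite cos_0, sin_0, cosh_0. apply injective_projections; simpl; ring. Qed.

Lemma csinc_0 : csinc 0 = 1.
Proof. unfold csinc. rewrite ddiff_eq, (C_derive_cder _ _ _ (cder_Csin 0)). apply Ccos_0. Qed.

Lemma Csin_csinc (w : C) : Csin w = (w * csinc w)%C.
Proof. rewrite (ddiff_mult Csin 0 w), Csin_0. fold csinc. ring. Qed.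

Lemma holo_csinc (w : C) : holo csinc w.
Proof.
  destruct (Ceq_dec w 0) as [->|n].
  - apply ddiff_holo, near_all, holo_Csin.
  - apply ddiff_holo_neq; [exact n|apply holo_Csin].
Qed.

(** Mean value inequality for the sine on the segment from 0 to [w]; the resulting factor [|w|]
    cancels, so small [w] cost nothing. *)
Lemma Cmod_csinc_le (w : C) : Cmod (csinc w) <= exp (Rabs (snd w)).
Proof.
  destruct (Ceq_dec w 0) as [->|n].
  { rewrite csinc_0, Cmod_1. rewrite <- exp_0. apply exp_le, Rabs_pos. }
  assert (hw : 0 < Cmod w) by now apply Cmod_gt_0.
  apply Rmult_le_reg_l with (Cmod w); [exact hw|].
  rewrite <- Cmod_mult, <- Csin_csinc.
  assert (H := segment_MVT Csin Ccos 0 w (exp (Rabs (snd w)))).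
  rewrite Csin_0 in H. replace (w - 0)%C with w in H by ring.
  replace (Csin w - 0)%C with (Csin w) in H by ring.
  rewrite Rmult_comm. apply H. intros s hs z. split; [apply cder_Csin|].
  eapply Rle_trans; [apply Cmod_Ccos_le|]. apply exp_le. unfold z. simpl.
  replace (0 + (s * snd w + 0 * fst w)) with (s * snd w) by ring.
  rewrite Rabs_mult, Rabs_pos_eq by lra. generalize (Rabs_pos (snd w)). nra.
Qed.

(** The only zero of the sine in this vertical strip is 0, where [csinc] equals 1. *)
Lemma csinc_neq_0 (w : C) : - PI < fst w < PI -> csinc w <> 0.
Proof.
  intros hw h. assert (h1 := Csin_csinc w). rewrite h, Cmult_0_r in h1.
  apply Csin_eq_0 in h1. destruct h1 as [h1 h2].
  assert (e : fst w = 0).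
  { destruct (Rtotal_order (fst w) 0) as [l|[l|l]]; [|exact l|].
    - assert (k := sin_gt_0 (- fst w)). rewrite sin_neg in k. lra.
    - assert (k := sin_gt_0 (fst w)). lra. }
  assert (w = 0) as -> by (apply injective_projections; assumption).
  rewrite csinc_0 in h. apply C1_nz. exact h.
Qed.

(** * The slit plane and the principal logarithm *)

Definition slit (z : C) : Prop := 0 < fst z \/ snd z <> 0.

(** The quantity [|z| + Re z] is the denominator of the half-angle formula; it also makes openness
    evident. *)
Lemma slit_pos (z : C) : slit z <-> 0 < Cmod z + fst z.
Proof.
  assert (h := Cmod_sqr z). assert (h0 := Cmod_ge_0 z).
  assert (h1 := Rle_0_sqr (snd z)). unfold Rsqr in h1. split.
  - intros [h2|h2]; [lra|]. assert (h3 := Rlt_0_sqr _ h2). unfold Rsqr in h3.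
    apply Rnot_le_lt. intros h4. assert (Cmod z <= - fst z) by lra. nra.
  - intros h2. destruct (Req_dec (snd z) 0) as [e|n]; [left|now right].
    apply Rnot_le_lt. intros h3. rewrite e in h. nra.
Qed.

Lemma slit_neq_0 (z : C) : slit z -> z <> 0.
Proof. intros [h|h] ->; simpl in h; [lra|now apply h]. Qed.

Lemma cos_2atan (u : R) : cos (2 * atan u) = (1 - u * u) / (1 + u * u).
Proof.
  assert (h := Rle_0_sqr u). unfold Rsqr in h.
  rewrite cos_2a_cos, cos_atan. unfold Rsqr.
  replace (2 * (1 / sqrt (1 + u * u)) * (1 / sqrt (1 + u * u)))
    with (2 * / (sqrt (1 + u * u) * sqrt (1 + u * u)))
    by (field; apply Rgt_not_eq, sqrt_lt_R0; lra).
  rewrite sqrt_sqrt by lra. field. lra.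
Qed.

Lemma sin_2atan (u : R) : sin (2 * atan u) = 2 * u / (1 + u * u).
Proof.
  assert (h := Rle_0_sqr u). unfold Rsqr in h.
  rewrite sin_2a, cos_atan, sin_atan. unfold Rsqr.
  replace (2 * (u / sqrt (1 + u * u)) * (1 / sqrt (1 + u * u)))
    with (2 * u * / (sqrt (1 + u * u) * sqrt (1 + u * u)))
    by (field; apply Rgt_not_eq, sqrt_lt_R0; lra).
  rewrite sqrt_sqrt by lra. field. lra.
Qed.

Lemma half_angle (z : C) : slit z ->
  cos (2 * atan (snd z / (Cmod z + fst z))) = fst z / Cmod z /\
  sin (2 * atan (snd z / (Cmod z + fst z))) = snd z / Cmod z.
Proof.
  intros hz. assert (hm : 0 < Cmod z) by now apply Cmod_gt_0, slit_neq_0.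
  apply slit_pos in hz. assert (hs := Cmod_sqr z).
  set (r := Cmod z) in *. set (x := fst z) in *. set (y := snd z) in *.
  assert (hy : y * y = (r - x) * (r + x)) by lra.
  rewrite cos_2atan, sin_2atan.
  assert (E : y / (r + x) * (y / (r + x)) = (r - x) / (r + x)).
  { transitivity (y * y / ((r + x) * (r + x))); [field; lra|]. rewrite hy. field. lra. }
  rewrite E.
  split; field; split; lra.
Qed.

(** The tangent of half the argument is [y / (|z| + x)]. This single formula is continuous on the
    whole slit plane, whereas the definition changes branch across the positive axis. *)
Lemma Carg_atan (z : C) : slit z -> Carg z = 2 * atan (snd z / (Cmod z + fst z)).
Proof.
  intros hz. destruct (half_angle z hz) as [hc _]. unfold Carg, Re, Im.
  assert (hb := atan_bound (snd z / (Cmod z + fst z))).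
  apply slit_pos in hz. rewrite <- hc.
  destruct (Rlt_dec (snd z) 0) as [n|n].
  - assert (atan (snd z / (Cmod z + fst z)) < 0).
    { rewrite <- atan_0. apply atan_increasing. apply Rlt_div_l; lra. }
    rewrite <- cos_neg, acos_cos; lra.
  - assert (0 <= atan (snd z / (Cmod z + fst z))).
    { rewrite <- atan_0. apply Rnot_lt_le. intros hl.
      assert (h2 : 0 <= snd z / (Cmod z + fst z)) by (apply Rdiv_le_0_compat; lra).
      destruct h2 as [h2|h2]; [apply atan_increasing in h2; lra|rewrite <- h2 in hl; lra]. }
    rewrite acos_cos; lra.
Qed.

Lemma Cexp_Clog (z : C) : slit z -> Cexp (Clog z) = z.
Proof.
  intros hz. destruct (half_angle z hz) as [hc hs]. unfold Clog, Cexp, Re, Im. simpl.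
  rewrite (Carg_atan z hz), hc, hs.
  assert (hm : 0 < Cmod z) by now apply Cmod_gt_0, slit_neq_0.
  rewrite exp_ln by exact hm. apply injective_projections; simpl; field; lra.
Qed.

Lemma cont_fst (z : C) : @continuous CU R_UniformSpace (fun w => fst w) z.
Proof. apply (@contC_pair CU (fun w => w)). apply ccont_id. Qed.

Lemma cont_snd (z : C) : @continuous CU R_UniformSpace (fun w => snd w) z.
Proof. apply (@contC_pair CU (fun w => w)). apply ccont_id. Qed.

Lemma cont_Cmod (z : C) : @continuous CU R_UniformSpace (fun w => Cmod w) z.
Proof. apply (@continuous_Cmod CU (fun w => w)). apply ccont_id. Qed.

Lemma slit_open (z : C) : slit z -> near z slit.
Proof.
  intros hz. assert (hz' := proj1 (slit_pos z) hz). apply near_locally.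
  assert (K : @continuous CU R_UniformSpace (fun w => Cmod w + fst w) z)
    by (apply (@continuous_plus CU R_AbsRing R_NormedModule); [apply cont_Cmod|apply cont_fst]).
  generalize (proj1 (filterlim_locally (U := R_UniformSpace) _ _) K (mkposreal _ hz')).
  apply filter_imp. intros w hw. apply slit_pos.
  change (Rabs ((Cmod w + fst w) - (Cmod z + fst z)) < Cmod z + fst z) in hw.
  apply Rabs_lt_between in hw. lra.
Qed.

Lemma ccont_Clog (z : C) : slit z -> ccont Clog z.
Proof.
  intros hz. assert (hm : 0 < Cmod z) by now apply Cmod_gt_0, slit_neq_0.
  assert (hp := proj1 (slit_pos z) hz).
  apply (@contC_pair CU). split; simpl.
  - apply (@continuous_comp CU R_UniformSpace R_UniformSpace); [apply cont_Cmod|].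
    now apply continuous_ln.
  - apply (@continuous_ext_loc CU R_UniformSpace _ (fun w => 2 * atan (snd w / (Cmod w + fst w)))).
    { apply near_locally. generalize (slit_open z hz). apply near_imp.
      intros w hw. symmetry. now apply Carg_atan. }
    apply (@continuous_mult CU R_AbsRing); [apply continuous_const|].
    apply (@continuous_comp CU R_UniformSpace R_UniformSpace).
    + apply (@continuous_mult CU R_AbsRing); [apply cont_snd|].
      apply (@continuous_comp CU R_UniformSpace R_UniformSpace (fun w => Cmod w + fst w) Rinv).
      * apply (@continuous_plus CU R_AbsRing R_NormedModule); [apply cont_Cmod|apply cont_fst].
      * apply (continuous_Rinv_comp (fun x => x)); [apply continuous_id|lra].
    + apply (continuous_atan_comp (fun x => x)), continuous_id.
Qed.

(** Derivative of an inverse function: in [w - z = q (Clog w) (Clog w - Clog z)] the factor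
    [q (Clog w)] is continuous at [z] with value [z], hence invertible nearby. *)
Lemma cder_Clog (z : C) : slit z -> cder Clog z (/ z)%C.
Proof.
  intros hz. assert (hn := slit_neq_0 z hz). assert (cl := ccont_Clog z hz).
  destruct (cder_Cexp (Clog z)) as [q [hq [e E]]]. rewrite (Cexp_Clog z hz) in e, E.
  assert (cq : ccont (fun w => q (Clog w)) z) by now apply ccont_comp.
  assert (nq : near z (fun w => q (Clog w) <> 0)) by (apply ccont_nonzero; [exact cq|now rewrite e]).
  apply cder_ext with (fun w => Clog z + / q (Clog w) * (w - z))%C.
  - generalize (near_and _ _ _ nq (slit_open z hz)). apply near_imp. intros w [h1 h2].
    specialize (E (Clog w)). rewrite (Cexp_Clog w h2) in E.
    assert (E2 : (w - z = q (Clog w) * (Clog w - Clog z))%C) by (rewrite E at 1; ring).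
    rewrite E2. field. exact h1.
  - exists (fun w => / q (Clog w))%C. split; [|split; [now rewrite e|intros; ring]].
    apply (@contC_inv CU); [now rewrite e|exact cq].
Qed.

Lemma Clog_pos (x : R) : 0 < x -> Clog (RtoC x) = RtoC (ln x).
Proof.
  intros hx. unfold Clog. rewrite Carg_atan by (left; exact hx). simpl.
  unfold Rdiv. rewrite Rmult_0_l, atan_0, Rmult_0_r, Cmod_R, Rabs_pos_eq by lra. reflexivity.
Qed.

(** * The conformal map *)

(** The weights allow [a = 1], [b = s], that is, all points of the segment from [1] to [1 + e^z]. *)
Lemma slit_sector (z : C) (a b : R) : 0 < a -> 0 <= b -> Rabs (snd z) < PI ->
  slit (RtoC a + RtoC b * Cexp z)%C.
Proof.
  intros ha hb hz. apply Rabs_lt_between in hz. assert (hE := exp_pos (fst z)).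
  unfold slit, Cexp, Re, Im. simpl.
  destruct (Req_dec b 0) as [->|nb]; [left; lra|].
  destruct (Req_dec (snd z) 0) as [->|n].
  - left. rewrite cos_0, sin_0. assert (0 <= b * exp (fst z)) by (apply Rmult_le_pos; lra). lra.
  - right. replace (0 + (b * (exp (fst z) * sin (snd z)) + 0 * (exp (fst z) * cos (snd z))))
      with (b * exp (fst z) * sin (snd z)) by ring.
    apply Rmult_integral_contrapositive_currified.
    { apply Rmult_integral_contrapositive_currified; lra. }
    destruct (Rtotal_order (snd z) 0) as [l|[l|l]]; [|now elim n|].
    + assert (k := sin_gt_0 (- snd z)). rewrite sin_neg in k. lra.
    + assert (k := sin_gt_0 (snd z)). lra.
Qed.

Lemma cos_le_cos (y d : R) : Rabs y <= d -> d <= PI -> cos d <= cos y.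
Proof.
  intros h hd. assert (E : cos y = cos (Rabs y)).
  { unfold Rabs. destruct (Rcase_abs y); [now rewrite cos_neg|reflexivity]. }
  rewrite E. assert (h0 := Rabs_pos y). destruct h as [h|h]; [|rewrite h; lra].
  left. apply cos_decreasing_1; lra.
Qed.

(* [|a + b e^z|^2 - cos^2 (d/2) (a + b |e^z|)^2] is at least
   [sin^2 (d/2) (a - b |e^z|)^2]. *)
Lemma sector_lower (z : C) (d a b : R) : 0 < d < PI -> Rabs (snd z) < d ->
  0 <= a -> 0 <= b ->
  cos (d / 2) * (a + b * exp (fst z)) <= Cmod (RtoC a + RtoC b * Cexp z)%C.
Proof.
  intros hd hz ha hb. apply le_of_sqr_le; [apply Cmod_ge_0|].
  rewrite Cmod_sqr. unfold Cexp, Re, Im. simpl.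
  assert (hE := exp_pos (fst z)).
  assert (hc : cos d <= cos (snd z)) by (apply cos_le_cos; lra).
  assert (h2 : 2 * (cos (d / 2) * cos (d / 2)) = 1 + cos d).
  { replace d with (2 * (d / 2)) at 3 by field. rewrite cos_2a_cos. ring. }
  assert (hs := sin2_cos2 (snd z)). unfold Rsqr in hs.
  assert (hd1 := COS_bound d).
  set (E := exp (fst z)) in *. set (c := cos (d / 2)) in *.
  set (u := cos (snd z)) in *. set (v := sin (snd z)) in *.
  assert (hbE : 0 <= b * E) by (apply Rmult_le_pos; lra).
  assert (k1 : 0 <= a * (b * E) * (u - cos d)) by (repeat apply Rmult_le_pos; lra).
  assert (k2 : 0 <= (1 - cos d) * ((a - b * E) * (a - b * E)))
    by (apply Rmult_le_pos; [lra|apply Rle_0_sqr]).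
  replace (c * (a + b * E) * (c * (a + b * E)))
    with (2 * (c * c) * ((a + b * E) * (a + b * E)) / 2) by field.
  rewrite h2.
  replace ((a + (b * (E * u) - 0 * (E * v))) * (a + (b * (E * u) - 0 * (E * v))) +
    (0 + (b * (E * v) + 0 * (E * u))) * (0 + (b * (E * v) + 0 * (E * u))))
    with (a * a + 2 * (a * (b * E) * u) + b * E * (b * E) * (v * v + u * u)) by ring.
  rewrite hs. lra.
Qed.

Lemma cos_half_pos (d : R) : 0 < d < PI -> 0 < cos (d / 2).
Proof. intros h. apply cos_gt_0; lra. Qed.

Lemma slit_strip (z : C) : Rabs (snd z) < PI -> slit (1 + Cexp z)%C.
Proof.
  intros h. replace (1 + Cexp z)%C with (RtoC 1 + RtoC 1 * Cexp z)%C by ring.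
  apply slit_sector; lra.
Qed.

Lemma Cexp_phi2 (z : C) : Rabs (snd z) < PI -> Cexp (phi2 z) = (1 + Cexp z)%C.
Proof. intros h. now apply Cexp_Clog, slit_strip. Qed.

Lemma holo_phi2 (z : C) : Rabs (snd z) < PI -> holo phi2 z.
Proof.
  intros h. apply (holo_comp Clog (fun w => 1 + Cexp w)%C).
  - eexists. now apply cder_Clog, slit_strip.
  - apply holo_plus; [apply holo_const|]. eexists. apply cder_Cexp.
Qed.

Lemma phi2_real (x : R) : phi2 (RtoC x) = RtoC (ln (1 + exp x)).
Proof.
  assert (h := exp_pos x). unfold phi2.
  replace (1 + Cexp (RtoC x))%C with (RtoC (1 + exp x)); [apply Clog_pos; lra|].
  unfold Cexp, Re, Im. simpl. rewrite cos_0, sin_0. apply injective_projections; simpl; ring.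
Qed.

Lemma phi2_phi2_inv (t : R) : 0 < t -> phi2 (RtoC (phi2_inv t)) = RtoC t.
Proof.
  intros ht. rewrite phi2_real. unfold phi2_inv.
  assert (h : 1 < exp t) by (rewrite <- exp_0; now apply exp_increasing).
  rewrite exp_ln by lra. f_equal. replace (1 + (exp t - 1)) with (exp t) by ring. apply ln_exp.
Qed.

Lemma Cexp_opp_phi2 (z : C) : Rabs (snd z) < PI -> Cexp (- phi2 z)%C = (/ (1 + Cexp z))%C.
Proof. intros h. now rewrite Cexp_opp, Cexp_phi2. Qed.

Lemma one_minus_Cexp_phi2 (z : C) : Rabs (snd z) < PI ->
  (1 - Cexp (- phi2 z) <> 0)%C.
Proof.
  intros h. rewrite Cexp_opp_phi2 by exact h. assert (n := slit_neq_0 _ (slit_strip z h)).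
  replace (1 - / (1 + Cexp z))%C with (Cexp z * / (1 + Cexp z))%C by (field; exact n).
  apply Cmult_neq_0; [apply Cexp_neq_0|]. intros e. apply C1_nz.
  rewrite <- (Cinv_r (1 + Cexp z)%C n), e. ring.
Qed.

Lemma phi2_neq_0 (z : C) : Rabs (snd z) < PI -> phi2 z <> 0.
Proof.
  intros h e. apply (one_minus_Cexp_phi2 z h). rewrite e.
  replace (- 0)%C with (RtoC 0) by ring. rewrite Cexp_0. ring.
Qed.

(** Mean value inequality for [Clog] on the segment from [1] to [1 + e^z], which stays at distance
    at least [cos (d / 2)] from 0. *)
Lemma phi2_upper (z : C) (d : R) : 0 < d < PI -> Rabs (snd z) < d ->
  Cmod (phi2 z) <= / cos (d / 2) * exp (fst z).
Proof.
  intros hd hz. assert (hc := cos_half_pos d hd).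
  assert (H := segment_MVT Clog Cinv 1 (1 + Cexp z)%C (/ cos (d / 2))).
  assert (E0 : Clog 1 = 0) by (rewrite (Clog_pos 1 Rlt_0_1); now rewrite ln_1).
  rewrite E0 in H.
  replace (Clog (1 + Cexp z) - 0)%C with (phi2 z) in H by (unfold phi2; ring).
  replace (1 + Cexp z - 1)%C with (Cexp z) in H by ring. rewrite Cmod_Cexp in H.
  apply H. intros s hs w. split.
  - apply cder_Clog. apply slit_sector; lra.
  - apply Cmod_inv_le; [exact hc|].
    eapply Rle_trans; [|apply (sector_lower z d 1 s); lra].
    assert (0 <= s * exp (fst z)) by (apply Rmult_le_pos; [lra|left; apply exp_pos]).
    rewrite <- (Rmult_1_r (cos (d / 2))) at 1. apply Rmult_le_compat_l; lra.
Qed.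

(** With [v = 1 + phi2 z], one has [e^v - 1 = (e - 1) + e e^z], of modulus at least [cos (d / 2)] by
    the sector bound because [e - 1 >= 1]; and [|e^v - 1| <= e |v|] when [|v| <= 1]. *)
Lemma phi2_shift_lower (z : C) (d : R) : 0 < d < PI -> Rabs (snd z) < d ->
  cos (d / 2) / exp 1 <= Cmod (1 + phi2 z)%C.
Proof.
  intros hd hz. assert (hc := cos_half_pos d hd).
  assert (h1 := exp_ineq1 1 ltac:(lra)). assert (hc1 := COS_bound (d / 2)).
  destruct (Rle_dec 1 (Cmod (1 + phi2 z))) as [h|h].
  { eapply Rle_trans; [|exact h]. apply Rle_div_l; lra. }
  apply Rle_div_l; [lra|].
  apply Rle_trans with (Cmod (Cexp (1 + phi2 z) - 1)%C).
  - assert (E1 : Cexp 1 = RtoC (exp 1)).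
    { unfold Cexp. simpl. rewrite cos_0, sin_0. apply injective_projections; simpl; ring. }
    rewrite Cexp_plus, Cexp_phi2, E1 by lra.
    replace (exp 1 * (1 + Cexp z) - 1)%C with (RtoC (exp 1 - 1) + RtoC (exp 1) * Cexp z)%C
      by (rewrite RtoC_minus; ring).
    eapply Rle_trans; [|apply (sector_lower z d); lra].
    assert (0 <= exp 1 * exp (fst z)) by (apply Rmult_le_pos; left; apply exp_pos).
    rewrite <- (Rmult_1_r (cos (d / 2))) at 1. apply Rmult_le_compat_l; lra.
  - eapply Rle_trans; [apply Cexp_minus_1|]. apply Rmult_le_compat_l; [apply Cmod_ge_0|].
    apply exp_le. lra.
Qed.

Lemma Rpower_nonneg_le (a b c : R) : 0 < a -> a <= b -> 0 < c -> Rpower a c <= Rpower b c.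
Proof. intros. apply Rle_Rpower_l; lra. Qed.

Lemma Rpower_scal_exp (A x a : R) : 0 < A -> Rpower (A * exp x) a = Rpower A a * exp (a * x).
Proof.
  intros hA. rewrite <- Rpower_mult_distr by (try exact hA; apply exp_pos).
  unfold Rpower at 2. now rewrite ln_exp.
Qed.

(** * The pulled-back function and its decay in the strip *)

Definition pullback (m : nat) (f : C -> C) (z : C) : C := (f (phi2 z) / g2 m (phi2 z))%C.

Lemma holo_g2 (m : nat) (z : C) : holo (g2 m) z.
Proof.
  apply (holo_pow (fun z => 1 - Cexp (- z))%C). apply holo_minus; [apply holo_const|].
  apply (holo_comp Cexp (fun z => - z)%C); [eexists; apply cder_Cexp|].
  apply holo_ext with (fun z => 0 - z)%C; [apply near_all; intros; ring|].
  apply holo_minus; [apply holo_const|apply holo_id].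
Qed.

Lemma g2_phi2_neq_0 (m : nat) (z : C) : Rabs (snd z) < PI -> g2 m (phi2 z) <> 0.
Proof. intros h. apply Cpow_nz. now apply one_minus_Cexp_phi2. Qed.

Lemma analytic_near (D : C -> Prop) (f : C -> C) (z : C) :
  analytic_on D f -> D z -> near z (holo f).
Proof.
  intros H hz. specialize (H z hz). apply locally_C in H. apply near_locally.
  revert H. apply filter_imp. intros w. apply holo_ex_derive.
Qed.

Lemma holo_pullback (m : nat) (f : C -> C) (d : R) (z : C) : d < PI ->
  analytic_on (phi2_image d) f -> Rabs (snd z) < d -> holo (pullback m f) z.
Proof.
  intros hd H hz. assert (hz' : Rabs (snd z) < PI) by lra.
  apply holo_div; [now apply g2_phi2_neq_0| |].
  - apply (holo_comp f phi2); [|now apply holo_phi2].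
    apply (near_self (phi2 z)), (analytic_near _ _ _ H). now exists z.
  - apply (holo_comp (g2 m) phi2); [apply holo_g2|now apply holo_phi2].
Qed.

(** With [x = Re z], the factor [|phi2 / (1 + phi2)|] is both [O(e^x)] and [O(1)], and
    [|e^(-phi2)| = 1 / |1 + e^z|] is both [O(1)] and [O(e^(-x))]. Each conclusion uses one
    exponential bound and one constant bound. *)
Lemma pullback_decay (m : nat) (d : R) (f : C -> C) (K alpha beta : R) :
  0 < d < PI -> 0 < K -> 0 < alpha -> 0 < beta ->
  (forall z : C, phi2_image d z ->
     Cmod (f z / g2 m z)%C
     <= K * Rpower (Cmod (z / (1 + z))%C) alpha
          * Rpower (Cmod (Cexp (- z)%C)) beta) ->
  exists K', 0 < K' /\ forall z, Rabs (snd z) < d ->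
    Cmod (pullback m f z) <= K' * exp (alpha * fst z) /\
    Cmod (pullback m f z) <= K' * exp (- beta * fst z).
Proof.
  intros hd hK ha hb H. assert (hc := cos_half_pos d hd).
  set (c := cos (d / 2)) in *.
  assert (hic : 0 < / c) by now apply Rinv_0_lt_compat.
  assert (h1 := exp_pos 1).
  assert (hl : 0 < exp 1 / c) by now apply Rdiv_lt_0_compat.
  set (A1 := / c * (exp 1 / c)). set (A2 := 1 + exp 1 / c).
  assert (hA1 : 0 < A1) by now apply Rmult_lt_0_compat.
  set (K1 := Rpower A1 alpha * Rpower (/ c) beta). set (K2 := Rpower A2 alpha * Rpower (/ c) beta).
  assert (p1 : 0 < K1) by (apply Rmult_lt_0_compat; apply exp_pos).
  assert (p2 : 0 < K2) by (apply Rmult_lt_0_compat; apply exp_pos).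
  exists (K * (K1 + K2)). split; [apply Rmult_lt_0_compat; lra|].
  intros z hz. assert (hz' : Rabs (snd z) < PI) by lra.
  assert (hE := exp_pos (fst z)).
  assert (n1 : 0 < Cmod (1 + phi2 z)).
  { eapply Rlt_le_trans; [|apply (phi2_shift_lower z d hd hz)]. now apply Rdiv_lt_0_compat. }
  assert (n1' : (1 + phi2 z)%C <> 0) by now apply Cmod_gt_0.
  assert (i1 : / Cmod (1 + phi2 z) <= exp 1 / c).
  { replace (exp 1 / c) with (/ (c / exp 1)) by (field; lra).
    apply Rinv_le_contravar; [now apply Rdiv_lt_0_compat|now apply phi2_shift_lower]. }
  assert (q0 : 0 < Cmod (phi2 z / (1 + phi2 z))).
  { rewrite Cmod_div by exact n1'. apply Rdiv_lt_0_compat; [|exact n1].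
    now apply Cmod_gt_0, phi2_neq_0. }
  assert (q1 : Cmod (phi2 z / (1 + phi2 z)) <= A1 * exp (fst z)).
  { rewrite Cmod_div by exact n1'. unfold A1.
    replace (/ c * (exp 1 / c) * exp (fst z)) with (/ c * exp (fst z) * (exp 1 / c)) by ring.
    apply Rmult_le_compat; [apply Cmod_ge_0|left; now apply Rinv_0_lt_compat|now apply phi2_upper|exact i1]. }
  assert (q2 : Cmod (phi2 z / (1 + phi2 z)) <= A2).
  { replace (phi2 z / (1 + phi2 z))%C with (1 - / (1 + phi2 z))%C by (field; exact n1').
    unfold Cminus. eapply Rle_trans; [apply Cmod_triangle|].
    rewrite Cmod_1, Cmod_opp, Cmod_inv by exact n1'. unfold A2. lra. }
  assert (n2 : (1 + Cexp z)%C <> 0) by now apply slit_neq_0, slit_strip.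
  assert (s : c * (1 + exp (fst z)) <= Cmod (1 + Cexp z)).
  { replace (1 + Cexp z)%C with (RtoC 1 + RtoC 1 * Cexp z)%C by ring.
    rewrite <- (Rmult_1_l (exp (fst z))). apply sector_lower; lra. }
  assert (r0 : 0 < Cmod (Cexp (- phi2 z))) by (apply Cmod_gt_0, Cexp_neq_0).
  assert (cE : 0 < c * exp (fst z)) by now apply Rmult_lt_0_compat.
  assert (r1 : Cmod (Cexp (- phi2 z)) <= / c).
  { rewrite Cexp_opp_phi2 by exact hz'. apply Cmod_inv_le; lra. }
  assert (r2 : Cmod (Cexp (- phi2 z)) <= / c * exp (- fst z)).
  { rewrite exp_Ropp, <- Rinv_mult. rewrite Cexp_opp_phi2 by exact hz'.
    apply Cmod_inv_le; lra. }
  assert (L := H (phi2 z) (ex_intro _ z (conj hz eq_refl))).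
  fold (pullback m f z) in L.
  assert (t1 : Rpower (Cmod (phi2 z / (1 + phi2 z))) alpha * Rpower (Cmod (Cexp (- phi2 z))) beta
     <= K1 * exp (alpha * fst z)).
  { unfold K1. replace (Rpower A1 alpha * Rpower (/ c) beta * exp (alpha * fst z))
      with (Rpower (A1 * exp (fst z)) alpha * Rpower (/ c) beta)
      by (rewrite Rpower_scal_exp by exact hA1; ring).
    apply Rmult_le_compat; try (left; apply exp_pos); apply Rpower_nonneg_le; assumption. }
  assert (t2 : Rpower (Cmod (phi2 z / (1 + phi2 z))) alpha * Rpower (Cmod (Cexp (- phi2 z))) beta
     <= K2 * exp (- beta * fst z)).
  { unfold K2. replace (Rpower A2 alpha * Rpower (/ c) beta * exp (- beta * fst z))
      with (Rpower A2 alpha * Rpower (/ c * exp (- fst z)) beta)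
      by (rewrite Rpower_scal_exp by exact hic; replace (beta * - fst z) with (- beta * fst z) by ring; ring).
    apply Rmult_le_compat; try (left; apply exp_pos); apply Rpower_nonneg_le; assumption. }
  rewrite Rmult_assoc in L.
  split; eapply Rle_trans; try exact L; rewrite Rmult_assoc; (apply Rmult_le_compat_l; [lra|]);
    eapply Rle_trans; [exact t1| |exact t2|]; (apply Rmult_le_compat_r; [left; apply exp_pos|lra]).
Qed.

(** * Sinc interpolation *)

(** The [p] terms of index [a] to [a + p - 1]: counting terms makes inductions and concatenations
    run on natural numbers. *)
Fixpoint zsum (F : Z -> C) (a : Z) (p : nat) : C :=
  match p with
  | O => 0
  | S q => (zsum F a q + F (a + Z.of_nat q)%Z)%C
  end.

Lemma zsum_ext (F G : Z -> C) (a : Z) (p : nat) : (forall k, F k = G k) -> zsum F a p = zsum G a p.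
Proof. intros H. induction p as [|p IH]; simpl; [reflexivity|now rewrite IH, H]. Qed.

Lemma zsum_scal (c : C) (F : Z -> C) (a : Z) (p : nat) :
  zsum (fun k => c * F k)%C a p = (c * zsum F a p)%C.
Proof. induction p as [|p IH]; simpl; [ring|rewrite IH; ring]. Qed.

Lemma zsum_plus_r (F : Z -> C) (a : Z) (p q : nat) :
  zsum F a (p + q) = (zsum F a p + zsum F (a + Z.of_nat p) q)%C.
Proof.
  induction q as [|q IH]; simpl.
  - rewrite Nat.add_0_r. ring.
  - rewrite Nat.add_succ_r. simpl. rewrite IH, Nat2Z.inj_add, Z.add_assoc. ring.
Qed.

Lemma C_sum_Z_zsum (F : Z -> C) (a b : Z) : C_sum_Z F a b = zsum F a (Z.to_nat (b - a + 1)).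
Proof.
  unfold C_sum_Z. induction (Z.to_nat (b - a + 1)) as [|p IH].
  - apply (sum_n_m_zero (G := C_AbelianMonoid)). lia.
  - rewrite (sum_n_Sm (G := C_AbelianMonoid)) by lia. rewrite IH. simpl zsum.
    replace (a + Z.of_nat (S p) - 1)%Z with (a + Z.of_nat p)%Z by lia. reflexivity.
Qed.

Lemma zsum_telescope (F : Z -> C) (T : Z -> R) (a : Z) (p : nat) :
  (forall k, Cmod (F k) <= T (k + 1)%Z - T k) ->
  Cmod (zsum F a p) <= T (a + Z.of_nat p)%Z - T a.
Proof.
  intros H. induction p as [|p IH]; simpl zsum.
  - rewrite Cmod_0, Z.add_0_r. lra.
  - eapply Rle_trans; [apply Cmod_triangle|]. specialize (H (a + Z.of_nat p)%Z).
    replace (a + Z.of_nat (S p))%Z with (a + Z.of_nat p + 1)%Z by lia. lra.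
Qed.

(** Telescoping with [E e^(g k) / g]: since [e^g - 1 >= g], its increment dominates the term. The
    number of terms does not enter the bound, and [1 / g] becomes the factor [1 / h]. *)
Lemma zsum_increasing_exp (F : Z -> C) (E g : R) (a : Z) (p : nat) : 0 <= E -> 0 < g ->
  (forall k, Cmod (F k) <= E * exp (g * IZR k)) ->
  Cmod (zsum F a p) <= E * exp (g * IZR (a + Z.of_nat p)) / g.
Proof.
  intros hE hg H.
  eapply Rle_trans; [apply (zsum_telescope _ (fun k => E * exp (g * IZR k) / g))|].
  - intros k. eapply Rle_trans; [apply H|]. rewrite plus_IZR, Rmult_plus_distr_l, Rmult_1_r, exp_plus.
    assert (h := exp_ineq1_le g). assert (h2 := exp_pos (g * IZR k)).
    replace (E * (exp (g * IZR k) * exp g) / g - E * exp (g * IZR k) / g)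
      with (E * exp (g * IZR k) * ((exp g - 1) / g)) by (field; lra).
    rewrite <- (Rmult_1_r (E * exp (g * IZR k))) at 1.
    apply Rmult_le_compat_l; [apply Rmult_le_pos; lra|]. apply Rle_div_r; lra.
  - assert (0 <= E * exp (g * IZR a) / g); [|lra].
    apply Rdiv_le_0_compat; [|exact hg]. apply Rmult_le_pos; [lra|left; apply exp_pos].
Qed.

Lemma zsum_decreasing_exp (F : Z -> C) (E g : R) (a : Z) (p : nat) : 0 <= E -> 0 < g ->
  (forall k, Cmod (F k) <= E * exp (- g * IZR k)) ->
  Cmod (zsum F (a + 1) p) <= E * exp (- g * IZR a) / g.
Proof.
  intros hE hg H.
  (* The shift to [k - 1] compensates the decrease, so that the sum from [a + 1] on is bounded by
     the exponential at [a]. *)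
  eapply Rle_trans; [apply (zsum_telescope _ (fun k => - (E * exp (- g * IZR (k - 1)) / g)))|].
  - intros k. eapply Rle_trans; [apply H|].
    replace (k + 1 - 1)%Z with k by lia. rewrite minus_IZR.
    replace (- g * (IZR k - 1)) with (- g * IZR k + g) by ring. rewrite exp_plus.
    assert (h := exp_ineq1_le g). assert (h2 := exp_pos (- g * IZR k)).
    replace (- (E * exp (- g * IZR k) / g) - - (E * (exp (- g * IZR k) * exp g) / g))
      with (E * exp (- g * IZR k) * ((exp g - 1) / g)) by (field; lra).
    rewrite <- (Rmult_1_r (E * exp (- g * IZR k))) at 1.
    apply Rmult_le_compat_l; [apply Rmult_le_pos; lra|]. apply Rle_div_r; lra.
  - replace (a + 1 - 1)%Z with a by lia.
    match goal with |- - ?u - - ?v <= _ => assert (0 <= u); [|lra] end.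
    apply Rdiv_le_0_compat; [|exact hg]. apply Rmult_le_pos; [lra|left; apply exp_pos].
Qed.

(** * Nodes and residues *)

Definition sine (h : R) (z : C) : C := Csin (RtoC (PI / h) * z)%C.
Definition node (h : R) (k : Z) : C := RtoC (IZR k * h).
Definition sinc_at (h : R) (k : Z) (z : C) : C := csinc (RtoC (PI / h) * (z - node h k))%C.

Lemma cder_sine (h : R) (z : C) : cder (sine h) z (RtoC (PI / h) * Ccos (RtoC (PI / h) * z))%C.
Proof.
  replace (RtoC (PI / h) * Ccos (RtoC (PI / h) * z))%C
    with (Ccos (RtoC (PI / h) * z) * (RtoC (PI / h) * 1))%C by ring.
  apply (cder_comp Csin (fun w => RtoC (PI / h) * w)%C); [apply cder_Csin|].
  apply cder_scal, cder_id.
Qed.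

Lemma holo_sine (h : R) (z : C) : holo (sine h) z.
Proof. eexists. apply cder_sine. Qed.

Lemma holo_sinc_at (h : R) (k : Z) (z : C) : holo (sinc_at h k) z.
Proof.
  apply (holo_comp csinc (fun w => RtoC (PI / h) * (w - node h k))%C); [apply holo_csinc|].
  apply holo_mult; [apply holo_const|]. apply holo_minus; [apply holo_id|apply holo_const].
Qed.

(** The sign [(-1)^k], in the form in which [Csin_shift] produces it. *)
Definition parity (k : Z) : C := RtoC (cos (IZR k * PI)).

Lemma parity_sqr (k : Z) : (parity k * parity k)%C = 1.
Proof. unfold parity. now rewrite <- RtoC_mult, cos_IZR_PI_sqr. Qed.

Lemma parity_neq_0 (k : Z) : parity k <> 0.
Proof. intros e. apply C1_nz. rewrite <- (parity_sqr k), e. ring. Qed.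

Lemma sine_sinc_at (h : R) (k : Z) (z : C) : h <> 0 ->
  sine h z = (parity k * (RtoC (PI / h) * (z - node h k)) * sinc_at h k z)%C.
Proof.
  intros hh. unfold sinc_at. rewrite <- Cmult_assoc, <- Csin_csinc. unfold parity.
  rewrite <- Csin_shift. unfold sine. f_equal.
  replace (IZR k * PI) with (PI / h * (IZR k * h)) by (field; exact hh).
  unfold node. rewrite !RtoC_mult. ring.
Qed.

Lemma sine_neq_0 (h : R) (z : C) : 0 < h -> snd z <> 0 -> sine h z <> 0.
Proof.
  intros hh hz e. apply Csin_eq_0 in e. destruct e as [e _]. simpl in e.
  assert (hp := PI_RGT_0). assert (0 < PI / h) by now apply Rdiv_lt_0_compat.
  apply hz. apply Rmult_eq_reg_l with (PI / h); lra.
Qed.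

Lemma PI_div_neq_0 (h : R) : 0 < h -> RtoC (PI / h) <> 0.
Proof.
  intros hh e. apply RtoC_inj in e. assert (0 < PI / h) by (apply Rdiv_lt_0_compat; [apply PI_RGT_0|exact hh]). lra.
Qed.

(** In this cell [sine h w] is [w - k h] times a constant times [sinc_at h k w], which has no zero
    there. The residue thus reduces to Cauchy's formula for [P] divided by the nonvanishing
    factors. *)
Lemma residue_cell (P : C -> C) (h y : R) (k : Z) : 0 < h -> 0 < y ->
  (forall w, inrect ((IZR k - / 2) * h) ((IZR k + / 2) * h) (- y) y w -> holo P w) ->
  rint (fun w => P w / sine h w)%C ((IZR k - / 2) * h) ((IZR k + / 2) * h) (- y) y =
  (2 * PI * Ci * (P (node h k) * (parity k / RtoC (PI / h))))%C.
Proof.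
  intros hh hy H. assert (hp := PI_div_neq_0 h hh). assert (hP := PI_RGT_0).
  set (x1 := (IZR k - / 2) * h) in *. set (x2 := (IZR k + / 2) * h) in *.
  assert (ha : inside x1 x2 (- y) y (node h k)) by (split; simpl; unfold x1, x2; lra).
  assert (hs : forall w, inrect x1 x2 (- y) y w -> sinc_at h k w <> 0).
  { intros w [hw _]. apply csinc_neq_0. simpl.
    replace (PI / h * (fst w + - (IZR k * h)) - 0 * (snd w + - 0))
      with (PI * ((fst w - IZR k * h) / h)) by (field; lra).
    assert (- / 2 <= (fst w - IZR k * h) / h <= / 2).
    { split; [apply Rle_div_r|apply Rle_div_l]; unfold x1, x2 in hw; lra. }
    split; nra. }
  rewrite (rint_ext _ (fun w => (P w * (parity k / RtoC (PI / h)) / sinc_at h k w) / (w - node h k))%C).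
  - rewrite (cauchy_formula (fun w => P w * (parity k / RtoC (PI / h)) / sinc_at h k w)%C); [|exact ha|].
    + replace (sinc_at h k (node h k)) with (RtoC 1).
      * field. exact hp.
      * unfold sinc_at. replace (RtoC (PI / h) * (node h k - node h k))%C with (RtoC 0) by ring.
        symmetry. apply csinc_0.
    + intros w hw. apply holo_div; [now apply hs| |apply holo_sinc_at].
      apply holo_mult; [now apply H|apply holo_const].
  - destruct ha; lra.
  - lra.
  - intros w hw. rewrite (sine_sinc_at h k) by lra.
    assert (n1 := inside_not_edge _ _ _ _ _ _ ha hw).
    assert (n2 := hs w (edge_inrect _ _ _ _ _ hw)). assert (n3 := parity_neq_0 k).
    replace (P w * (parity k / RtoC (PI / h)) / sinc_at h k w / (w - node h k))%C
      with (parity k * parity k * (P w / (parity k * (RtoC (PI / h) * (w - node h k)) * sinc_at h k w)))%C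
      by (field; repeat split; assumption).
    rewrite parity_sqr. ring.
Qed.

Lemma residue_sum (P : C -> C) (h y : R) (a : Z) (p : nat) : 0 < h -> 0 < y ->
  (forall w, inrect ((IZR a - / 2) * h) ((IZR (a + Z.of_nat p) - / 2) * h) (- y) y w -> holo P w) ->
  rint (fun w => P w / sine h w)%C ((IZR a - / 2) * h) ((IZR (a + Z.of_nat p) - / 2) * h) (- y) y =
  (2 * PI * Ci * zsum (fun k => P (node h k) * (parity k / RtoC (PI / h))) a p)%C.
Proof.
  intros hh hy. induction p as [|p IH]; intros H.
  - simpl zsum. rewrite Z.add_0_r. unfold rint. rewrite !Cint_point. ring.
  - replace (a + Z.of_nat (S p))%Z with (a + Z.of_nat p + 1)%Z in * by lia.
    set (b := (a + Z.of_nat p)%Z) in *.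
    assert (hab : IZR a <= IZR b) by (apply IZR_le; unfold b; lia).
    assert (eb : (IZR (b + 1) - / 2) * h = (IZR b + / 2) * h) by (rewrite plus_IZR; lra).
    rewrite eb in *.
    assert (o1 : (IZR a - / 2) * h <= (IZR b - / 2) * h) by (apply Rmult_le_compat_r; lra).
    assert (o2 : (IZR b - / 2) * h <= (IZR b + / 2) * h) by (apply Rmult_le_compat_r; lra).
    (* Cutting off the last cell requires continuity on the horizontal sides, and off the real axis
       the sine has no zero. *)
    assert (cq : forall x v, (IZR a - / 2) * h <= x <= (IZR b + / 2) * h -> - y <= v <= y -> v <> 0 ->
      ccont (fun w => P w / sine h w)%C (x, v)).
    { intros x v hx hv v0. apply (ccont_div P (sine h)).
      - now apply sine_neq_0.
      - apply holo_cont, H. split; assumption.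
      - apply holo_cont, holo_sine. }
    rewrite (rint_hsplit _ _ _ _ _ _ o1 o2) by (intros x hx; split; apply cq; lra).
    rewrite IH by (intros w [h1 h2]; apply H; split; lra).
    rewrite residue_cell by (try assumption; intros w [h1 h2]; apply H; split; lra).
    simpl zsum. fold b. ring.
Qed.

(** Identifies the residue weights with the Sinc functions; when [z] is the node itself, the
    derivative in [ddiff] supplies the value. *)
Lemma ddiff_sine_node (h : R) (k : Z) (z : C) : 0 < h ->
  (ddiff (sine h) z (node h k) * (parity k / RtoC (PI / h)))%C = sinc_at h k z.
Proof.
  intros hh. assert (hp := PI_div_neq_0 h hh).
  destruct (Ceq_dec (node h k) z) as [e|n].
  - rewrite <- e, ddiff_eq, (C_derive_cder _ _ _ (cder_sine h (node h k))).
    replace (Ccos (RtoC (PI / h) * node h k)) with (parity k).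
    + replace (RtoC (PI / h) * parity k * (parity k / RtoC (PI / h)))%C
        with (parity k * parity k)%C by (field; exact hp).
      rewrite parity_sqr. unfold sinc_at.
      replace (RtoC (PI / h) * (node h k - node h k))%C with (RtoC 0) by ring.
      symmetry. apply csinc_0.
    + unfold parity, node, Ccos. simpl.
      replace (PI / h * (IZR k * h) - 0 * 0) with (IZR k * PI) by (field; lra).
      replace (PI / h * 0 + 0 * (IZR k * h)) with 0 by ring.
      rewrite cosh_0, sinh_0. apply injective_projections; simpl; ring.
  - rewrite ddiff_neq by exact n. assert (hn := Cminus_eq_contra _ _ n).
    assert (e0 : sine h (node h k) = 0).
    { rewrite (sine_sinc_at h k) by lra. ring. }
    rewrite e0, (sine_sinc_at h k z) by lra.
    replace ((0 - parity k * (RtoC (PI / h) * (z - node h k)) * sinc_at h k z) / (node h k - z)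
      * (parity k / RtoC (PI / h)))%C with (parity k * parity k * sinc_at h k z)%C
      by (field; split; assumption).
    rewrite parity_sqr. ring.
Qed.

Lemma sinc_interpolation (F : C -> C) (h y : R) (a : Z) (p : nat) (z : C) : 0 < h -> 0 < y ->
  let x1 := (IZR a - / 2) * h in let x2 := (IZR (a + Z.of_nat p) - / 2) * h in
  inside x1 x2 (- y) y z ->
  (forall w, edge x1 x2 (- y) y w -> sine h w <> 0) ->
  (forall w, inrect x1 x2 (- y) y w -> holo F w) ->
  (F z - zsum (fun k => F (node h k) * sinc_at h k z) a p)%C =
  (sine h z / (2 * PI * Ci) * rint (fun w => F w / ((w - z) * sine h w)) x1 x2 (- y) y)%C.
Proof.
  intros hh hy x1 x2 hz hs H.
  assert (hx : x1 <= x2) by (destruct hz; lra). assert (hy' : - y <= y) by lra.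
  assert (n0 := two_pi_i_neq).
  assert (hD : forall w, holo (ddiff (sine h) z) w).
  { intros w. destruct (Ceq_dec w z) as [->|n].
    - apply ddiff_holo, near_all, holo_sine.
    - apply ddiff_holo_neq; [exact n|apply holo_sine]. }
  assert (E1 := cauchy_formula F z _ _ _ _ hz H).
  assert (E2 := residue_sum (fun w => F w * ddiff (sine h) z w)%C h y a p hh hy).
  fold x1 x2 in E2. rewrite (zsum_ext _ (fun k => F (node h k) * sinc_at h k z)%C) in E2
    by (intros k; rewrite <- (ddiff_sine_node h k z hh); ring).
  specialize (E2 (fun w hw => holo_mult _ _ _ (H w hw) (hD w))).
  assert (cF : forall w, edge x1 x2 (- y) y w -> ccont F w)
    by (intros w hw; now apply holo_cont, H, edge_inrect).
  assert (cw : forall w, edge x1 x2 (- y) y w -> ccont (fun w => w - z)%C w)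
    by (intros w hw; apply ccont_minus; [apply ccont_id|apply ccont_const]).
  assert (nw : forall w, edge x1 x2 (- y) y w -> (w - z <> 0)%C)
    by (intros w hw; now apply (inside_not_edge x1 x2 (- y) y)).
  assert (cs : forall w, ccont (sine h) w) by (intros w; apply holo_cont, holo_sine).
  replace (sine h z / (2 * PI * Ci) * rint (fun w => F w / ((w - z) * sine h w)) x1 x2 (- y) y)%C
    with (/ (2 * PI * Ci) * (rint (fun w => F w / (w - z)) x1 x2 (- y) y
      - rint (fun w => F w * ddiff (sine h) z w / sine h w) x1 x2 (- y) y))%C.
  - rewrite E1, E2. field. split; [apply Ci_nz|apply PI_neqC].
  - rewrite <- rint_minus; auto.
    + match goal with |- _ = (_ * ?X)%C =>
        replace (sine h z / (2 * PI * Ci) * X)%C with (/ (2 * PI * Ci) * (sine h z * X))%C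
          by (unfold Cdiv; ring) end.
      f_equal.
      rewrite <- rint_scal; auto.
      * apply rint_ext; auto. intros w hw. specialize (nw w hw). specialize (hs w hw).
        assert (K := ddiff_mult (sine h) z w).
        (* On the contour this turns [1 / (w - z) - D_z(w) / s(w)] into [s(z) / ((w - z) s(w))]. *)
        assert (K' : sine h z = (sine h w - (w - z) * ddiff (sine h) z w)%C) by (rewrite K; ring).
        rewrite K'. field. split; assumption.
      * intros w hw. apply (ccont_div F (fun w => (w - z) * sine h w)%C); auto.
        -- now apply Cmult_neq_0; auto.
        -- apply (ccont_mult (fun w => w - z)%C (sine h)); auto.
    + intros w hw. apply (ccont_div F (fun w => w - z)%C); auto.
    + intros w hw. apply (ccont_div (fun w => F w * ddiff (sine h) z w)%C (sine h)); auto.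
      apply ccont_mult; auto. apply holo_cont, hD.
Qed.

(** * The interpolation error *)

(** Replaces the exponential by a kernel with an arctangent as primitive: with [a = m |x| / 2],
    [e^(2 a) >= (1 + a)^2 >= 1 + a^2]. *)
Lemma exp_decay_le (m x : R) : 0 < m ->
  exp (- m * Rabs x) <= / (1 + (m / 2 * x) * (m / 2 * x)).
Proof.
  intros hm. assert (h0 := Rabs_pos x). assert (hq := Rle_0_sqr (m / 2 * x)). unfold Rsqr in hq.
  replace (- m * Rabs x) with (- (m / 2 * Rabs x + m / 2 * Rabs x)) by field.
  rewrite exp_Ropp. apply Rinv_le_contravar; [lra|].
  rewrite exp_plus. assert (h := exp_ineq1_le (m / 2 * Rabs x)).
  assert (p : 0 <= m / 2 * Rabs x) by (apply Rmult_le_pos; lra).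
  apply Rle_trans with ((1 + m / 2 * Rabs x) * (1 + m / 2 * Rabs x)).
  - replace (m / 2 * x * (m / 2 * x)) with ((m / 2 * Rabs x) * (m / 2 * Rabs x)); [nra|].
    replace (m / 2 * Rabs x * (m / 2 * Rabs x)) with (m / 2 * (m / 2) * (Rabs x * Rabs x)) by ring.
    rewrite <- Rabs_mult, Rabs_pos_eq by apply Rle_0_sqr. ring.
  - apply Rmult_le_compat; lra.
Qed.

Lemma is_RInt_cauchy_kernel (A v a b : R) : 0 < v -> 
  is_RInt (fun x => A * / (1 + v * x * (v * x))) a b (A / v * atan (v * b) - A / v * atan (v * a)).
Proof.
  intros hv.
  apply (is_RInt_derive (V := R_CompleteNormedModule) (fun x => A / v * atan (v * x))).
  - intros x _. assert (hq := Rle_0_sqr (v * x)). unfold Rsqr in hq.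
    auto_derive; trivial. field. split; lra.
  - intros x _. assert (hq := Rle_0_sqr (v * x)). unfold Rsqr in hq.
    apply (ex_derive_continuous (V := R_NormedModule)). auto_derive. lra.
Qed.

(** The bound does not involve [x1] and [x2], so the vertical sides can recede at no cost. *)
Lemma rint_decay (f : C -> C) (x1 x2 y1 y2 A B v : R) : x1 <= x2 -> y1 <= y2 -> 0 < v -> 0 <= A ->
  (forall w, edge x1 x2 y1 y2 w -> ccont f w) ->
  (forall x y, y = y1 \/ y = y2 -> x1 <= x <= x2 ->
     Cmod (f (x, y)) <= A * / (1 + v * x * (v * x))) ->
  (forall x y, x = x1 \/ x = x2 -> y1 <= y <= y2 -> Cmod (f (x, y)) <= B) ->
  Cmod (rint f x1 x2 y1 y2) <= 2 * (A * PI / v) + 2 * B * (y2 - y1).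
Proof.
  intros hx hy hv hA Hf HA HB.
  destruct (rint_correct f x1 x2 y1 y2 hx hy Hf) as [a1 [a2 [a3 a4]]].
  eapply Rle_trans; [apply Cmod_rint_triangle|].
  assert (I := is_RInt_cauchy_kernel A v x1 x2 hv).
  apply (is_Cint_norm _ _ _ _ _ _ hx (fun t ht => HA t y1 (or_introl eq_refl) ht)) with (2 := I) in a1.
  apply (is_Cint_norm _ _ _ _ _ _ hx (fun t ht => HA t y2 (or_intror eq_refl) ht)) with (2 := I) in a3.
  apply is_Cint_norm_const with (B := B) in a2; [|exact hy|intros; apply HB; auto].
  apply is_Cint_norm_const with (B := B) in a4; [|exact hy|intros; apply HB; auto].
  assert (b1 := atan_bound (v * x1)). assert (b2 := atan_bound (v * x2)).
  assert (hAv : 0 <= A / v) by (apply Rdiv_le_0_compat; lra).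
  replace (A * PI / v) with (A / v * PI) by (field; lra). nra.
Qed.

Lemma sinh_lower (x x0 : R) : 0 < x0 <= x -> (1 - exp (- (2 * x0))) / 2 * exp x <= sinh x.
Proof.
  intros h. unfold sinh.
  assert (exp (- x) <= exp (- (2 * x0)) * exp x).
  { rewrite <- exp_plus. apply exp_le. lra. }
  lra.
Qed.

Lemma Cmod_sine_le (h : R) (z : C) : 0 < h -> Cmod (sine h z) <= exp (PI / h * Rabs (snd z)).
Proof.
  intros hh. eapply Rle_trans; [apply Cmod_Csin_le|]. apply exp_le. simpl.
  assert (0 < PI / h) by (apply Rdiv_lt_0_compat; [apply PI_RGT_0|exact hh]).
  replace (PI / h * snd z + 0 * fst z) with (PI / h * snd z) by ring.
  rewrite Rabs_mult, (Rabs_pos_eq (PI / h)) by lra. lra.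
Qed.

Lemma Cmod_sinc_at_le (h : R) (k : Z) (z : C) : 0 < h ->
  Cmod (sinc_at h k z) <= exp (PI / h * Rabs (snd z)).
Proof.
  intros hh. eapply Rle_trans; [apply Cmod_csinc_le|]. apply exp_le. simpl.
  assert (0 < PI / h) by (apply Rdiv_lt_0_compat; [apply PI_RGT_0|exact hh]).
  replace (PI / h * (snd z + - 0) + 0 * (fst z + - (IZR k * h))) with (PI / h * snd z) by ring.
  rewrite Rabs_mult, (Rabs_pos_eq (PI / h)) by lra. lra.
Qed.

Lemma Cmod_sine_lower_h (h x y : R) : 0 < h -> 0 <= y ->
  sinh (PI / h * y) <= Cmod (sine h (x, y)) /\ sinh (PI / h * y) <= Cmod (sine h (x, - y)).
Proof.
  intros hh hy. unfold sine.
  assert (hs := Rle_0_sqr (sin (PI / h * x))). unfold Rsqr in hs.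
  split; apply le_of_sqr_le; try apply Cmod_ge_0; rewrite Cmod_Csin_sqr; simpl.
  - replace (PI / h * x - 0 * y) with (PI / h * x) by ring.
    replace (PI / h * y + 0 * x) with (PI / h * y) by ring. lra.
  - replace (PI / h * x - 0 * - y) with (PI / h * x) by ring.
    replace (PI / h * - y + 0 * x) with (- (PI / h * y)) by ring.
    assert (E : forall t, sinh (- t) = - sinh t) by (intros; unfold sinh; rewrite Ropp_involutive; field).
    rewrite E. lra.
Qed.

(** Midway between two nodes the real sine is [1] or [-1]; this is why cells are bounded by
    half-integers. *)
Lemma Cmod_sine_lower_v (h y : R) (k : Z) : 0 < h -> 1 <= Cmod (sine h ((IZR k - / 2) * h, y)).
Proof.
  intros hh. apply le_of_sqr_le; [apply Cmod_ge_0|]. unfold sine. rewrite Cmod_Csin_sqr. simpl.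
  replace (PI / h * ((IZR k - / 2) * h) - 0 * y) with (- (PI / 2 - IZR k * PI)) by (field; lra).
  rewrite sin_neg, sin_shift.
  match goal with |- _ <= _ + ?u * ?u => assert (hu := Rle_0_sqr u); unfold Rsqr in hu end.
  assert (e := cos_IZR_PI_sqr k). lra.
Qed.

Definition two_sided_decay (F : C -> C) (d K alpha beta : R) : Prop :=
  forall z, Rabs (snd z) < d ->
    Cmod (F z) <= K * exp (alpha * fst z) /\ Cmod (F z) <= K * exp (- beta * fst z).

Lemma two_sided_decay_abs (F : C -> C) (d K alpha beta : R) (z : C) : 0 <= K ->
  two_sided_decay F d K alpha beta -> Rabs (snd z) < d ->
  Cmod (F z) <= K * exp (- Rmin alpha beta * Rabs (fst z)).
Proof.
  intros hK H hz. destruct (H z hz) as [h1 h2].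
  assert (m1 := Rmin_l alpha beta). assert (m2 := Rmin_r alpha beta).
  unfold Rabs. destruct (Rcase_abs (fst z)).
  - eapply Rle_trans; [exact h1|]. apply Rmult_le_compat_l; [exact hK|]. apply exp_le.
    assert (0 <= (alpha - Rmin alpha beta) * - fst z) by (apply Rmult_le_pos; lra). lra.
  - eapply Rle_trans; [exact h2|]. apply Rmult_le_compat_l; [exact hK|]. apply exp_le.
    assert (0 <= (beta - Rmin alpha beta) * fst z) by (apply Rmult_le_pos; lra). lra.
Qed.

(** A finite window with a bound independent of [L] takes the place of the infinite series. [L] may
    depend on [h] and [z], and can be pushed beyond any [L0], later the truncation indices. *)
Lemma cardinal_error (F : C -> C) (d K alpha beta H : R) :
  0 < d -> 0 < K -> 0 < alpha -> 0 < beta -> 0 < H ->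
  (forall z, Rabs (snd z) < d -> holo F z) ->
  two_sided_decay F d K alpha beta ->
  exists A, 0 < A /\ forall h z L0, 0 < h <= H -> Rabs (snd z) <= d / 2 ->
    exists L : nat, (L0 <= L)%nat /\
    Cmod (F z - zsum (fun k => F (node h k) * sinc_at h k z) (- Z.of_nat L) (2 * L + 1))%C
    <= exp (PI / h * Rabs (snd z)) * (A * exp (- (PI * d / h))).
Proof.
  intros hd hK ha hb hH HF Hdec. set (mu := Rmin alpha beta).
  assert (hmu : 0 < mu) by (unfold mu; apply Rmin_case; assumption).
  assert (hp := PI_RGT_0). assert (hp2 := PI2_1).
  (* A lower bound for [PI y / h], valid for [y >= 3 d / 4] and [h <= H]; it makes [kap] independent
     of [h]. *)
  set (x0 := PI * (3 * d / 4) / H).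
  assert (hx0 : 0 < x0) by (unfold x0; apply Rdiv_lt_0_compat; [apply Rmult_lt_0_compat|]; lra).
  set (kap := (1 - exp (- (2 * x0))) / 2).
  assert (hkap : 0 < kap).
  { unfold kap. assert (exp (- (2 * x0)) < 1) by (rewrite <- exp_0; apply exp_increasing; lra). lra. }
  assert (he := exp_pos 1).
  assert (hke : 0 < kap / exp 1) by now apply Rdiv_lt_0_compat.
  set (A1 := K * (4 / d) / (kap / exp 1)).
  assert (hA1 : 0 < A1) by (apply Rdiv_lt_0_compat; [apply Rmult_lt_0_compat; [|apply Rdiv_lt_0_compat]; lra|exact hke]).
  exists (2 * (A1 * PI / (mu / 2)) + 2 * K * (2 * d)).
  assert (hA2 : 0 < A1 * PI / (mu / 2)) by (apply Rdiv_lt_0_compat; [apply Rmult_lt_0_compat|]; lra).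
  split. { assert (0 < K * (2 * d)) by (apply Rmult_lt_0_compat; lra). lra. }
  intros h z L0 [hh hhH] hz.
  (* The second term loses only a factor [e] against [e^(PI d / h)]; the first keeps the side at
     distance [d / 4] from [z] when [h] is large. *)
  set (y := Rmax (3 * d / 4) (d - h / PI)).
  assert (hhp : 0 < h / PI) by now apply Rdiv_lt_0_compat.
  assert (y1 : 3 * d / 4 <= y) by apply Rmax_l.
  assert (y2 : d - h / PI <= y) by apply Rmax_r.
  assert (y3 : y < d) by (unfold y; apply Rmax_case; lra).
  set (u := exp (- (PI * d / h))). assert (hu : 0 < u) by apply exp_pos.
  assert (hS : kap / exp 1 / u <= sinh (PI / h * y)).
  { eapply Rle_trans; [|apply (sinh_lower _ x0)].
    - fold kap. unfold u. rewrite exp_Ropp.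
      replace (kap / exp 1 / / exp (PI * d / h)) with (kap * (/ exp 1 * exp (PI * d / h)))
        by (field; split; apply Rgt_not_eq, exp_pos).
      rewrite <- exp_Ropp, <- exp_plus. apply Rmult_le_compat_l; [lra|]. apply exp_le.
      assert (PI / h * (d - h / PI) <= PI / h * y)
        by (apply Rmult_le_compat_l; [left; now apply Rdiv_lt_0_compat|lra]).
      replace (PI / h * (d - h / PI)) with (PI * d / h - 1) in H0 by (field; lra). lra.
    - split; [exact hx0|]. unfold x0, Rdiv.
      replace (PI * / h * y) with (PI * y * / h) by ring.
      apply Rmult_le_compat; [apply Rmult_le_pos; lra|left; now apply Rinv_0_lt_compat| |].
      + apply Rmult_le_compat_l; lra.
      + now apply Rinv_le_contravar. }
  (* Three requirements: [L >= L0]; the vertical sides at distance at least 1 from [z]; and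
     [mu L h >= PI d / h], so that [F] is at most [K e^(-PI d / h)] on them. *)
  destruct (INR_unbounded (Rmax (Rmax (INR L0) ((Rabs (fst z) + 1) / h)) (PI * d / h / mu / h))) as [L hL].
  assert (l1 : INR L0 < INR L).
  { eapply Rle_lt_trans; [|exact hL]. eapply Rle_trans; [apply Rmax_l|apply Rmax_l]. }
  assert (l2 : (Rabs (fst z) + 1) / h < INR L).
  { eapply Rle_lt_trans; [|exact hL]. eapply Rle_trans; [apply Rmax_r|apply Rmax_l]. }
  assert (l3 : PI * d / h / mu / h < INR L) by (eapply Rle_lt_trans; [apply Rmax_r|exact hL]).
  apply Rlt_div_l in l2; [|exact hh]. apply Rlt_div_l in l3; [|exact hh].
  apply (proj1 (Rlt_div_l _ _ mu hmu)) in l3.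
  exists L. split; [apply INR_le; lra|].
  set (a := (- Z.of_nat L)%Z). set (p := (2 * L + 1)%nat).
  assert (ea : IZR a = - INR L) by (unfold a; rewrite opp_IZR, <- INR_IZR_INZ; reflexivity).
  assert (eb : IZR (a + Z.of_nat p) = INR L + 1).
  { replace (a + Z.of_nat p)%Z with (Z.of_nat L + 1)%Z by (unfold a, p; lia).
    now rewrite plus_IZR, <- INR_IZR_INZ. }
  set (X1 := (IZR a - / 2) * h). set (X2 := (IZR (a + Z.of_nat p) - / 2) * h).
  assert (eX1 : X1 = - (INR L + / 2) * h) by (unfold X1; rewrite ea; ring).
  assert (eX2 : X2 = (INR L + / 2) * h) by (unfold X2; rewrite eb; field).
  assert (hz1 := proj1 (Rabs_le_between _ _) (Rle_refl (Rabs (fst z)))).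
  assert (hz2 := proj1 (Rabs_le_between _ _) hz).
  assert (hin : inside X1 X2 (- y) y z) by (split; [rewrite eX1, eX2|]; lra).
  assert (hX12 : X1 <= X2) by (destruct hin; lra). assert (hyy : - y <= y) by lra.
  assert (hhor : forall x v, v = - y \/ v = y -> kap / exp 1 / u <= Cmod (sine h (x, v))).
  { intros x v hv. destruct (Cmod_sine_lower_h h x y hh) as [q1 q2]; [lra|].
    destruct hv as [-> | ->]; lra. }
  assert (hver : forall x v, x = X1 \/ x = X2 -> 1 <= Cmod (sine h (x, v)))
    by (intros x v [-> | ->]; now apply Cmod_sine_lower_v).
  assert (hku : 0 < kap / exp 1 / u) by now apply Rdiv_lt_0_compat.
  assert (hsn : forall w, edge X1 X2 (- y) y w -> sine h w <> 0).
  { intros [x v] [_ [_ e]]. apply Cmod_gt_0. simpl in e.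
    destruct e as [e|[e|[e|e]]];
      [generalize (hver x v (or_introl e))|generalize (hver x v (or_intror e))
      |generalize (hhor x v (or_introl e))|generalize (hhor x v (or_intror e))]; lra. }
  assert (hFr : forall w, inrect X1 X2 (- y) y w -> holo F w).
  { intros w [_ hw]. apply HF. apply Rabs_lt_between. lra. }
  rewrite (sinc_interpolation F h y a p z hh ltac:(lra) hin hsn hFr). fold X1 X2.
  rewrite Cmod_mult. rewrite Cmod_div by exact two_pi_i_neq.
  rewrite !Cmod_mult, Cmod_Ci, !Cmod_R, !Rabs_pos_eq by lra.
  apply Rmult_le_compat; [apply Rdiv_le_0_compat; [apply Cmod_ge_0|lra]|apply Cmod_ge_0| |].
  { apply Rle_trans with (Cmod (sine h z)); [|now apply Cmod_sine_le].
    apply Rle_div_l; [lra|]. generalize (Cmod_ge_0 (sine h z)). nra. }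
  eapply Rle_trans; [apply (rint_decay _ _ _ _ _ (A1 * u) (K * u) (mu / 2)); try assumption|].
  - lra.
  - apply Rmult_le_pos; lra.
  - intros w hw. apply (ccont_div F (fun w => (w - z) * sine h w)%C).
    + apply Cmult_neq_0; [now apply (inside_not_edge X1 X2 (- y) y)|now apply hsn].
    + now apply holo_cont, hFr, edge_inrect.
    + apply (ccont_mult (fun w => w - z)%C (sine h)); [|apply holo_cont, holo_sine].
      apply ccont_minus; [apply ccont_id|apply ccont_const].
  - intros x v hv hx. assert (hs := hhor x v hv).
    assert (hdist : d / 4 <= Cmod ((x, v) - z)).
    { eapply Rle_trans; [|apply abs_snd_le]. simpl.
      destruct hv as [-> | ->]; [rewrite Rabs_left1|rewrite Rabs_pos_eq]; lra. }
    assert (hvd : Rabs v < d) by (apply Rabs_lt_between; destruct hv; lra).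
    assert (hFb := two_sided_decay_abs F d K alpha beta (x, v) ltac:(lra) Hdec hvd).
    fold mu in hFb. simpl in hFb.
    assert (hexp := exp_decay_le mu x hmu).
    unfold Cdiv. rewrite Cmod_mult, Cmod_inv, Cmod_mult
      by (apply Cmult_neq_0; apply Cmod_gt_0; lra).
    apply Rle_trans with (K * / (1 + mu / 2 * x * (mu / 2 * x)) * / (d / 4 * (kap / exp 1 / u))).
    + apply Rmult_le_compat; [apply Cmod_ge_0|left; apply Rinv_0_lt_compat, Rmult_lt_0_compat; lra| |].
      * eapply Rle_trans; [exact hFb|]. apply Rmult_le_compat_l; lra.
      * apply Rinv_le_contravar; [apply Rmult_lt_0_compat; lra|]. apply Rmult_le_compat; lra.
    + apply Req_le. unfold A1.
      assert (hq := Rle_0_sqr (mu / 2 * x)). unfold Rsqr in hq.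
      assert (hD : 0 < 1 + mu / 2 * x * (mu / 2 * x)) by lra. revert hD.
      generalize (1 + mu / 2 * x * (mu / 2 * x)). intros D hD. field. repeat split; lra.
  - intros x v hx hv. assert (hs := hver x v hx).
    assert (hdist : 1 <= Cmod ((x, v) - z)).
    { eapply Rle_trans; [|apply abs_fst_le]. simpl.
      destruct hx as [-> | ->]; [rewrite Rabs_left1|rewrite Rabs_pos_eq]; rewrite ?eX1, ?eX2; lra. }
    assert (hvd : Rabs v < d) by (apply Rabs_lt_between; lra).
    assert (hFb := two_sided_decay_abs F d K alpha beta (x, v) ltac:(lra) Hdec hvd).
    fold mu in hFb. simpl in hFb.
    unfold Cdiv. rewrite Cmod_mult, Cmod_inv, Cmod_mult
      by (apply Cmult_neq_0; apply Cmod_gt_0; lra).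
    rewrite <- (Rmult_1_r (K * u)).
    apply Rmult_le_compat; [apply Cmod_ge_0|left; apply Rinv_0_lt_compat, Rmult_lt_0_compat; lra| |].
    + eapply Rle_trans; [exact hFb|]. apply Rmult_le_compat_l; [lra|]. apply exp_le.
      assert (hLh : 0 <= INR L * h) by (apply Rmult_le_pos; [apply pos_INR|lra]).
      assert (hx' : INR L * h <= Rabs x)
        by (destruct hx as [-> | ->]; rewrite ?eX1, ?eX2; [rewrite Rabs_left1|rewrite Rabs_pos_eq]; lra).
      assert (mu * (INR L * h) <= mu * Rabs x) by (apply Rmult_le_compat_l; lra). lra.
    + rewrite <- Rinv_1. apply Rinv_le_contravar; [lra|]. nra.
  - replace (2 * (A1 * u * PI / (mu / 2)) + 2 * (K * u) * (y - - y))
      with ((2 * (A1 * PI / (mu / 2)) + 2 * K * (2 * y)) * u) by (field; lra).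
    apply Rmult_le_compat_r; [lra|].
    assert (K * (2 * y) <= K * (2 * d)) by (apply Rmult_le_compat_l; lra). lra.
Qed.

Definition sinc_error (F : C -> C) (h : R) (M N : nat) (z : C) : C :=
  (F z - zsum (fun k => F (node h k) * sinc_at h k z) (- Z.of_nat M) (M + N + 1))%C.

(** In a strip of width proportional to [h], the sine and all Sinc functions are bounded by
    [B = e^(PI d / (2 H))], whatever [h] is. *)
Lemma truncated_error (F : C -> C) (d K alpha beta H : R) :
  0 < d -> 0 < K -> 0 < alpha -> 0 < beta -> 0 < H ->
  (forall z, Rabs (snd z) < d -> holo F z) ->
  two_sided_decay F d K alpha beta ->
  exists A, 0 < A /\ forall h z M N, 0 < h <= H -> Rabs (snd z) <= d / (2 * H) * h ->
    Cmod (sinc_error F h M N z) <=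
    A * (exp (- (PI * d / h)) + (exp (- (alpha * h * INR M)) + exp (- (beta * h * INR N))) / h).
Proof.
  intros hd hK ha hb hH HF Hdec.
  destruct (cardinal_error F d K alpha beta H hd hK ha hb hH HF Hdec) as [A [hA HA]].
  set (B := exp (PI * (d / (2 * H)))). assert (hB : 0 < B) by apply exp_pos.
  assert (hia : 0 < / alpha) by now apply Rinv_0_lt_compat.
  assert (hib : 0 < / beta) by now apply Rinv_0_lt_compat.
  exists (B * A + K * B * (/ alpha + / beta)).
  assert (hKB : 0 < K * B) by now apply Rmult_lt_0_compat.
  assert (hBA : 0 < B * A) by now apply Rmult_lt_0_compat.
  assert (hab : 0 < K * B * (/ alpha + / beta)) by (apply Rmult_lt_0_compat; lra).
  split; [lra|].
  intros h z M N [hh hhH] hz. assert (hp := PI_RGT_0).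
  assert (hz2 : Rabs (snd z) <= d / 2).
  { eapply Rle_trans; [exact hz|]. replace (d / 2) with (d / (2 * H) * H) by (field; lra).
    apply Rmult_le_compat_l; [apply Rdiv_le_0_compat; lra|exact hhH]. }
  destruct (HA h z (Nat.max M N) (conj hh hhH) hz2) as [L [hL HL]].
  assert (hBz : exp (PI / h * Rabs (snd z)) <= B).
  { apply exp_le. replace (PI * (d / (2 * H))) with (PI / h * (d / (2 * H) * h)) by (field; lra).
    apply Rmult_le_compat_l; [left; now apply Rdiv_lt_0_compat|exact hz]. }
  set (T := fun k => (F (node h k) * sinc_at h k z)%C) in *.
  assert (hT : forall k, Cmod (T k) <= K * B * exp (alpha * h * IZR k) /\
                         Cmod (T k) <= K * B * exp (- (beta * h) * IZR k)).
  { intros k. destruct (Hdec (node h k)) as [k1 k2]; [simpl; rewrite Rabs_R0; exact hd|].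
    simpl in k1, k2. assert (k3 := Cmod_sinc_at_le h k z hh). unfold T. rewrite Cmod_mult.
    split.
    - replace (K * B * exp (alpha * h * IZR k)) with (K * exp (alpha * (IZR k * h)) * B)
        by (replace (alpha * (IZR k * h)) with (alpha * h * IZR k) by ring; ring).
      apply Rmult_le_compat; try apply Cmod_ge_0; lra.
    - replace (K * B * exp (- (beta * h) * IZR k)) with (K * exp (- beta * (IZR k * h)) * B)
        by (replace (- beta * (IZR k * h)) with (- (beta * h) * IZR k) by ring; ring).
      apply Rmult_le_compat; try apply Cmod_ge_0; lra. }
  assert (hah : 0 < alpha * h) by now apply Rmult_lt_0_compat.
  assert (hbh : 0 < beta * h) by now apply Rmult_lt_0_compat.
  (* The window from [-L] to [L] is split before [-M] and after [N]; the natural subtractions are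
     exact as [L] is at least both. *)
  replace (2 * L + 1)%nat with ((L - M) + ((M + N + 1) + (L - N)))%nat in HL by lia.
  rewrite (zsum_plus_r T _ (L - M)), (zsum_plus_r T _ (M + N + 1)) in HL.
  assert (SL := zsum_increasing_exp T (K * B) (alpha * h) (- Z.of_nat L) (L - M) ltac:(lra) hah (fun k => proj1 (hT k))).
  replace (- Z.of_nat L + Z.of_nat (L - M))%Z with (- Z.of_nat M)%Z in HL, SL by lia.
  replace (- Z.of_nat M + Z.of_nat (M + N + 1))%Z with (Z.of_nat N + 1)%Z in HL by lia.
  assert (SR := zsum_decreasing_exp T (K * B) (beta * h) (Z.of_nat N) (L - N) ltac:(lra) hbh (fun k => proj2 (hT k))).
  rewrite opp_IZR, <- INR_IZR_INZ in SL. rewrite <- INR_IZR_INZ in SR.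
  replace (alpha * h * - INR M) with (- (alpha * h * INR M)) in SL by ring.
  replace (- (beta * h) * INR N) with (- (beta * h * INR N)) in SR by ring.
  unfold sinc_error. fold T.
  set (s1 := zsum T (- Z.of_nat L) (L - M)) in *.
  set (s2 := zsum T (- Z.of_nat M) (M + N + 1)) in *.
  set (s3 := zsum T (Z.of_nat N + 1) (L - N)) in *.
  replace (F z - s2)%C with (((F z - (s1 + (s2 + s3))) + s1) + s3)%C by ring.
  eapply Rle_trans; [apply Cmod_triangle|].
  eapply Rle_trans; [apply Rplus_le_compat_r, Cmod_triangle|].
  set (e0 := exp (- (PI * d / h))) in *. set (e1 := exp (- (alpha * h * INR M))) in *.
  set (e2 := exp (- (beta * h * INR N))) in *.
  assert (p0 : 0 < e0) by apply exp_pos. assert (p1 : 0 < e1) by apply exp_pos.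
  assert (p2 : 0 < e2) by apply exp_pos.
  assert (HL' : Cmod (F z - (s1 + (s2 + s3))) <= B * A * e0).
  { eapply Rle_trans; [exact HL|]. rewrite Rmult_assoc.
    apply Rmult_le_compat_r; [|exact hBz]. left. now apply Rmult_lt_0_compat. }
  assert (hih : 0 < / h) by now apply Rinv_0_lt_compat.
  replace (K * B * e1 / (alpha * h)) with (K * B * / alpha * (e1 * / h)) in SL by (field; lra).
  replace (K * B * e2 / (beta * h)) with (K * B * / beta * (e2 * / h)) in SR by (field; lra).
  assert (q1 : 0 < e1 * / h) by now apply Rmult_lt_0_compat.
  assert (q2 : 0 < e2 * / h) by now apply Rmult_lt_0_compat.
  replace ((e1 + e2) / h) with (e1 * / h + e2 * / h) by (unfold Rdiv; ring).
  assert (r1 : K * B * / alpha * (e1 * / h) <= K * B * (/ alpha + / beta) * (e1 * / h)).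
  { apply Rmult_le_compat_r; [lra|]. apply Rmult_le_compat_l; lra. }
  assert (r2 : K * B * / beta * (e2 * / h) <= K * B * (/ alpha + / beta) * (e2 * / h)).
  { apply Rmult_le_compat_r; [lra|]. apply Rmult_le_compat_l; lra. }
  set (c := K * B * (/ alpha + / beta)) in *.
  assert (r3 : 0 < B * A * (e1 * / h + e2 * / h)) by (apply Rmult_lt_0_compat; lra).
  assert (r4 : 0 < c * e0) by now apply Rmult_lt_0_compat.
  lra.
Qed.

Lemma holo_zsum (f : Z -> C -> C) (a : Z) (p : nat) (z : C) :
  (forall k, holo (f k) z) -> holo (fun w => zsum (fun k => f k w) a p) z.
Proof.
  intros H. induction p as [|p IH]; simpl; [apply holo_const|].
  apply holo_plus; [exact IH|apply H].
Qed.

Lemma holo_sinc_error (F : C -> C) (h : R) (M N : nat) (z : C) :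
  holo F z -> holo (sinc_error F h M N) z.
Proof.
  intros H. apply holo_minus; [exact H|].
  apply (holo_zsum (fun k w => F (node h k) * sinc_at h k w)%C).
  intros k. apply holo_mult; [apply holo_const|apply holo_sinc_at].
Qed.

Lemma strip_open (d : R) (z : C) : Rabs (snd z) < d -> near z (fun w => Rabs (snd w) < d).
Proof.
  intros hz. exists (d - Rabs (snd z)). split; [lra|]. intros w hw.
  assert (h := abs_snd_le (w - z)%C). simpl in h.
  replace (snd w) with (snd z + (snd w + - snd z)) by ring.
  eapply Rle_lt_trans; [apply Rabs_triang|]. lra.
Qed.

Lemma holo_derive_n (f : C -> C) (n : nat) (z : C) :
  near z (holo f) -> near z (holo (C_derive_n f n)).
Proof.
  intros H. induction n as [|n IH]; [exact H|].
  generalize (near_near _ _ IH). apply near_imp. intros w hw. now apply holo_derive.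
Qed.

(** Each derivative uses up a width [s] of the strip. Only imaginary parts are tracked, as the bound
    holds along the whole real direction. *)
Lemma iterated_cauchy_estimate (f : C -> C) (d r s B : R) : 0 < s -> r < d ->
  (forall z, Rabs (snd z) < d -> holo f z) ->
  (forall z, Rabs (snd z) <= r -> Cmod (f z) <= B) ->
  forall n z, Rabs (snd z) + INR n * s <= r -> Cmod (C_derive_n f n z) <= (2 / s) ^ n * B.
Proof.
  intros hs hr Hf HB. induction n as [|n IH]; intros z hz.
  - simpl in *. rewrite Rmult_1_l. apply HB. lra.
  - simpl C_derive_n. simpl pow. rewrite Rmult_assoc.
    rewrite S_INR in hz. assert (hn := pos_INR n).
    assert (hns : 0 <= INR n * s) by (apply Rmult_le_pos; lra).
    apply cauchy_estimate; [exact hs|]. intros w [_ hw].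
    assert (hw' : Rabs (snd w) <= Rabs (snd z) + s).
    { replace (snd w) with (snd z + (snd w - snd z)) by ring.
      eapply Rle_trans; [apply Rabs_triang|]. apply Rplus_le_compat_l, Rabs_le. lra. }
    split; [|apply IH; lra].
    apply (near_self w), holo_derive_n.
    assert (hwd : Rabs (snd w) < d) by lra.
    generalize (strip_open d w hwd). apply near_imp. apply Hf.
Qed.

(** * Derivatives along the real axis *)

Lemma rder_derive_n (f : C -> C) (n : nat) (t : R) : near (RtoC t) (holo f) ->
  rder (fun s => C_derive_n f n (RtoC s)) t (C_derive_n f (S n) (RtoC t)).
Proof.
  intros H. assert (K := holo_cder _ _ (near_self _ _ (holo_derive_n f n _ H))).
  simpl C_derive_n. replace (C_derive (C_derive_n f n) (RtoC t))
    with (C_derive (C_derive_n f n) (RtoC t) * 1)%C by ring.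
  apply (rder_comp (C_derive_n f n) RtoC); [exact K|].
  split; simpl; auto_derive; trivial.
Qed.

Lemma rder_plus (f g : R -> C) (t : R) (a b : C) :
  rder f t a -> rder g t b -> rder (fun s => f s + g s)%C t (a + b)%C.
Proof. intros [h1 h2] [k1 k2]. split; simpl; now apply (is_derive_plus (V := R_NormedModule)). Qed.

Lemma rder_const (c : C) (t : R) : rder (fun _ => c) t 0.
Proof. split; simpl; apply (is_derive_const (V := R_NormedModule)). Qed.

Lemma rder_scal (c : C) (g : R -> C) (t : R) (a : C) :
  rder g t a -> rder (fun s => c * g s)%C t (c * a)%C.
Proof.
  intros H. apply (rder_comp (fun w => c * w)%C g); [|exact H].
  assert (K := cder_scal c (fun w => w) (g t) 1 (cder_id _)). now rewrite Cmult_1_r in K.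
Qed.

Lemma rder_minus (f g : R -> C) (t : R) (a b : C) :
  rder f t a -> rder g t b -> rder (fun s => f s - g s)%C t (a - b)%C.
Proof. intros [h1 h2] [k1 k2]. split; simpl; now apply (is_derive_minus (V := R_NormedModule)). Qed.

Lemma rder_real_comp (g : R -> C) (r : R -> R) (t r' : R) (a : C) :
  rder g (r t) a -> is_derive r t r' -> rder (fun s => g (r s)) t (RtoC r' * a)%C.
Proof.
  intros [h1 h2] hr. split; simpl.
  - replace (r' * fst a - 0 * snd a) with (scal r' (fst a)) by (unfold scal; simpl; unfold mult; simpl; ring).
    now apply (is_derive_comp (V := R_NormedModule) (fun s => fst (g s))).
  - replace (r' * snd a + 0 * fst a) with (scal r' (snd a)) by (unfold scal; simpl; unfold mult; simpl; ring).
    now apply (is_derive_comp (V := R_NormedModule) (fun s => snd (g s))).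
Qed.

Lemma rder_real_mult (r : R -> R) (g : R -> C) (t r' : R) (a : C) :
  is_derive r t r' -> rder g t a ->
  rder (fun s => RtoC (r s) * g s)%C t (RtoC r' * g t + RtoC (r t) * a)%C.
Proof.
  intros hr [h1 h2]. split.
  - apply is_derive_ext with (fun s => r s * fst (g s)); [intros s; simpl; ring|].
    replace (fst (RtoC r' * g t + RtoC (r t) * a)%C) with (r' * fst (g t) + r t * fst a) by (simpl; ring).
    now apply Derive.is_derive_mult.
  - apply is_derive_ext with (fun s => r s * snd (g s)); [intros s; simpl; ring|].
    replace (snd (RtoC r' * g t + RtoC (r t) * a)%C) with (r' * snd (g t) + r t * snd a) by (simpl; ring).
    now apply Derive.is_derive_mult.
Qed.

Lemma rder_zsum (f : Z -> R -> C) (f' : Z -> C) (a : Z) (p : nat) (t : R) :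
  (forall k, rder (f k) t (f' k)) ->
  rder (fun s => zsum (fun k => f k s) a p) t (zsum f' a p).
Proof.
  intros H. induction p as [|p IH]; simpl; [apply rder_const|]. now apply rder_plus.
Qed.

(** Explicit candidates for the successive derivatives on [t > 0]. By [tower_derive_n], two towers
    that agree at level 0 agree at every level up to [m]. *)
Definition tower (A : nat -> R -> C) (m : nat) : Prop :=
  forall j t, (j < m)%nat -> 0 < t -> rder (A j) t (A (S j) t).

Lemma pos_locally (t : R) : 0 < t -> locally t (fun s => 0 < s).
Proof. intros ht. apply (open_gt 0 t ht). Qed.

Lemma tower_derive_n (F : R -> C) (A : nat -> R -> C) (m : nat) :
  tower A m -> (forall t, 0 < t -> F t = A O t) ->
  forall j t, (j <= m)%nat -> 0 < t -> RC_derive_n F j t = A j t.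
Proof.
  intros HA H0. induction j as [|j IH]; intros t hj ht.
  - unfold RC_derive_n. simpl. rewrite <- H0 by exact ht. now destruct (F t).
  - destruct (HA j t ltac:(lia) ht) as [h1 h2].
    assert (L : locally t (fun s => RC_derive_n F j s = A j s)).
    { generalize (pos_locally t ht). apply filter_imp. intros s hs. apply IH; [lia|exact hs]. }
    unfold RC_derive_n. simpl Derive_n. apply injective_projections; simpl.
    + rewrite (Derive_ext_loc _ (fun s => fst (A j s))); [now apply is_derive_unique|].
      revert L. apply filter_imp. intros s e. now rewrite <- e.
    + rewrite (Derive_ext_loc _ (fun s => snd (A j s))); [now apply is_derive_unique|].
      revert L. apply filter_imp. intros s e. now rewrite <- e.
Qed.

(* [(c, l, i)] stands for [c u^l H_i], where [H_(i+1)] is the derivative of [H_i]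
   and, with [u = 1 - e^(-t)] and [x = phi2_inv t], one has [du/dt = 1 - u] and
   [dx/dt = 1/u]. *)
Definition term_eval (H : nat -> R -> C) (u x : R) (q : R * nat * nat) : C :=
  let '(c, l, i) := q in (RtoC (c * u ^ l) * H i x)%C.

Fixpoint terms_eval (H : nat -> R -> C) (u x : R) (s : list (R * nat * nat)) : C :=
  match s with
  | nil => 0
  | q :: s' => (term_eval H u x q + terms_eval H u x s')%C
  end.

(** The first two terms come from [u^l], the third from [H_i]. For [l = 0] the truncated [pred]
    would falsify the third one, hence the condition [1 <= l] in [rder_term_eval]. *)
Definition term_derive (q : R * nat * nat) : list (R * nat * nat) :=
  let '(c, l, i) := q in
  (c * INR l, pred l, i) :: (- (c * INR l), l, i) :: (c, pred l, S i) :: nil.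

Fixpoint leibniz_terms (m j : nat) : list (R * nat * nat) :=
  match j with
  | O => (1, m, O) :: nil
  | S j' => flat_map term_derive (leibniz_terms m j')
  end.

Lemma terms_eval_app (H : nat -> R -> C) (u x : R) (s1 s2 : list (R * nat * nat)) :
  terms_eval H u x (s1 ++ s2) = (terms_eval H u x s1 + terms_eval H u x s2)%C.
Proof. induction s1 as [|q s1 IH]; simpl; [ring|rewrite IH; ring]. Qed.

(** The bound on [l] guarantees that a power of [u] is left before each of the [m] derivations; the
    bound on [i] limits the derivatives of the error to order [m]. *)
Lemma leibniz_terms_range (m j : nat) (c : R) (l i : nat) :
  In (c, l, i) (leibniz_terms m j) -> (m - j <= l /\ i <= j)%nat.
Proof.
  revert c l i. induction j as [|j IH]; simpl; intros c l i hi.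
  - destruct hi as [e|[]]. injection e as _ <- <-. lia.
  - apply in_flat_map in hi. destruct hi as [[[c' l'] i'] [h1 h2]]. apply IH in h1.
    simpl in h2. destruct h2 as [e|[e|[e|[]]]]; injection e as _ <- <-; lia.
Qed.

Lemma is_derive_u (t : R) : is_derive (fun s => 1 - exp (- s)) t (1 - (1 - exp (- t))).
Proof. auto_derive; trivial. ring. Qed.

Lemma u_pos (t : R) : 0 < t -> 0 < 1 - exp (- t) <= 1.
Proof.
  intros ht. assert (h := exp_pos (- t)).
  assert (exp (- t) < 1) by (rewrite <- exp_0; apply exp_increasing; lra). lra.
Qed.

Lemma is_derive_phi2_inv (t : R) : 0 < t -> is_derive phi2_inv t (/ (1 - exp (- t))).
Proof.
  intros ht. assert (h := u_pos t ht). unfold phi2_inv.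
  assert (h1 : 1 < exp t) by (rewrite <- exp_0; now apply exp_increasing).
  assert (e : exp t * exp (- t) = 1) by (rewrite <- exp_plus, Rplus_opp_r; apply exp_0).
  auto_derive; [lra|]. rewrite exp_Ropp in *. field. split; lra.
Qed.

Lemma rder_term_eval (H : nat -> R -> C) (q : R * nat * nat) (t : R) : 0 < t ->
  (forall i x, rder (H i) x (H (S i) x)) -> (1 <= snd (fst q))%nat ->
  rder (fun s => term_eval H (1 - exp (- s)) (phi2_inv s) q) t
    (terms_eval H (1 - exp (- t)) (phi2_inv t) (term_derive q)).
Proof.
  intros ht HH. destruct q as [[c l] i]. simpl fst. simpl snd. intros hl.
  destruct l as [|l]; [lia|]. assert (hu := u_pos t ht).
  assert (D1 : is_derive (fun s => c * (1 - exp (- s)) ^ S l) t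
    (c * (INR (S l) * (1 - (1 - exp (- t))) * (1 - exp (- t)) ^ l))).
  { apply is_derive_scal, (is_derive_pow (fun s => 1 - exp (- s)) (S l)), is_derive_u. }
  assert (D2 := rder_real_comp _ _ _ _ _ (HH i (phi2_inv t)) (is_derive_phi2_inv t ht)).
  assert (D := rder_real_mult _ _ _ _ _ D1 D2). cbv beta in D.
  set (u := 1 - exp (- t)) in *. unfold term_derive, terms_eval, term_eval.
  simpl pred.
  match type of D with rder _ _ ?v => match goal with |- rder _ _ ?w => replace w with v; [exact D|] end end.
  rewrite Cmult_assoc, <- (RtoC_mult (c * u ^ S l) (/ u)).
  replace (c * u ^ S l * / u) with (c * u ^ l) by (simpl; field; lra).
  replace (c * (INR (S l) * (1 - u) * u ^ l)) with (c * INR (S l) * u ^ l + - (c * INR (S l)) * u ^ S l)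
    by (simpl pow; ring).
  rewrite RtoC_plus. ring.
Qed.

Lemma rder_terms_eval (H : nat -> R -> C) (s : list (R * nat * nat)) (t : R) : 0 < t ->
  (forall i x, rder (H i) x (H (S i) x)) ->
  (forall q, In q s -> (1 <= snd (fst q))%nat) ->
  rder (fun r => terms_eval H (1 - exp (- r)) (phi2_inv r) s) t
    (terms_eval H (1 - exp (- t)) (phi2_inv t) (flat_map term_derive s)).
Proof.
  intros ht HH. induction s as [|q s IH]; intros hs.
  - exact (rder_const 0 t).
  - simpl flat_map. rewrite terms_eval_app.
    apply (rder_plus (fun r => term_eval H (1 - exp (- r)) (phi2_inv r) q)
      (fun r => terms_eval H (1 - exp (- r)) (phi2_inv r) s)).
    + apply rder_term_eval; [exact ht|exact HH|apply hs; now left].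
    + apply IH. intros q' hq'. apply hs. now right.
Qed.

Lemma leibniz_tower (H : nat -> R -> C) (m : nat) :
  (forall i x, rder (H i) x (H (S i) x)) ->
  tower (fun j t => terms_eval H (1 - exp (- t)) (phi2_inv t) (leibniz_terms m j)) m.
Proof.
  intros HH j t hj ht. apply rder_terms_eval; [exact ht|exact HH|].
  intros [[c l] i] hq. apply leibniz_terms_range in hq. simpl. lia.
Qed.

Fixpoint terms_norm (s : list (R * nat * nat)) : R :=
  match s with nil => 0 | q :: s' => Rabs (fst (fst q)) + terms_norm s' end.

Lemma terms_eval_norm (H : nat -> R -> C) (u x B : R) (s : list (R * nat * nat)) :
  0 <= u <= 1 -> 0 <= B ->
  (forall c l i, In (c, l, i) s -> Cmod (H i x) <= B) ->
  Cmod (terms_eval H u x s) <= terms_norm s * B.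
Proof.
  intros hu hB. induction s as [|[[c l] i] s IH]; intros hs; simpl.
  - rewrite Cmod_0. lra.
  - eapply Rle_trans; [apply Cmod_triangle|]. rewrite Rmult_plus_distr_r. apply Rplus_le_compat.
    + rewrite Cmod_mult, Cmod_R, Rabs_mult.
      apply Rmult_le_compat; [apply Rmult_le_pos; apply Rabs_pos|apply Cmod_ge_0| |apply (hs c l i); now left].
      rewrite <- (Rmult_1_r (Rabs c)) at 2. apply Rmult_le_compat_l; [apply Rabs_pos|].
      rewrite Rabs_pos_eq by (apply pow_le; lra). rewrite <- (pow1 l). apply pow_incr. lra.
    + apply IH. intros c' l' i' hi. apply (hs c' l' i'). now right.
Qed.

(** * The approximation error *)

Lemma g2_real (m : nat) (t : R) : g2 m (RtoC t) = RtoC ((1 - exp (- t)) ^ m).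
Proof.
  unfold g2. rewrite RtoC_pow. f_equal. unfold Cexp, Re, Im. simpl.
  rewrite Ropp_0, cos_0, sin_0. apply injective_projections; simpl; ring.
Qed.

Lemma sinc_at_real (h : R) (k : Z) (x : R) : 0 < h ->
  RtoC (Sinc k h x) = sinc_at h k (RtoC x).
Proof.
  intros hh. assert (hp := PI_RGT_0). unfold Sinc, sinc_at, node.
  set (v := PI * (x - IZR k * h) / h).
  replace (RtoC (PI / h) * (RtoC x - RtoC (IZR k * h)))%C with (RtoC v)
    by (unfold v; rewrite <- RtoC_minus, <- RtoC_mult; f_equal; field; lra).
  destruct (Req_EM_T x (IZR k * h)) as [e|n].
  - replace v with 0 by (unfold v; rewrite <- e; field; lra). symmetry. apply csinc_0.
  - assert (hv : v <> 0).
    { unfold v, Rdiv. apply Rmult_integral_contrapositive_currified; [|apply Rinv_neq_0_compat; lra].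
      apply Rmult_integral_contrapositive_currified; [lra|now apply Rminus_eq_contra]. }
    assert (hvC : RtoC v <> 0) by (intros e; apply hv; now apply RtoC_inj).
    rewrite RtoC_div by exact hv.
    replace (RtoC (sin v)) with (Csin (RtoC v)).
    + rewrite Csin_csinc. field. exact hvC.
    + unfold Csin. simpl. rewrite cosh_0, sinh_0. apply injective_projections; simpl; ring.
Qed.

Lemma near_real_image (f : C -> C) (d t : R) : 0 < d -> 0 < t ->
  analytic_on (phi2_image d) f -> near (RtoC t) (holo f).
Proof.
  intros hd ht hf. apply (analytic_near _ _ _ hf). exists (RtoC (phi2_inv t)). split.
  - unfold strip. simpl. now rewrite Rabs_R0.
  - symmetry. now apply phi2_phi2_inv.
Qed.

Lemma sinc_approx_eval (m : nat) (f : C -> C) (M N : nat) (h t : R) : 0 < h -> 0 < t ->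
  sinc_approx m f (Z.of_nat M) (Z.of_nat N) h t =
  zsum (fun k => pullback m f (node h k) *
    terms_eval (fun i x => C_derive_n (sinc_at h k) i (RtoC x))
      (1 - exp (- t)) (phi2_inv t) (leibniz_terms m m))%C (- Z.of_nat M) (M + N + 1).
Proof.
  intros hh ht. unfold sinc_approx. rewrite C_sum_Z_zsum.
  replace (Z.to_nat (Z.of_nat N - - Z.of_nat M + 1)) with (M + N + 1)%nat by lia.
  apply zsum_ext. intros k. f_equal.
  apply (tower_derive_n _ _ m (leibniz_tower (fun i x => C_derive_n (sinc_at h k) i (RtoC x)) m
    (fun i x => rder_derive_n _ i x (near_all _ _ (holo_sinc_at h k))))); [|lia|exact ht].
  intros s hs. rewrite g2_real, sinc_at_real by exact hh. simpl. rewrite Rmult_1_l. ring.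
Qed.

(** The same formal terms apply to every Sinc function and to the error [G]. Two towers arise, one
    from [f] minus the sum, one from [u^m G(x)]; they agree at level 0, so the [m]-th derivatives
    coincide. *)
Lemma error_eval (m : nat) (d : R) (f : C -> C) (M N : nat) (h t : R) :
  0 < d < PI -> analytic_on (phi2_image d) f -> 0 < h -> 0 < t ->
  (C_derive_n f m (RtoC t) - sinc_approx m f (Z.of_nat M) (Z.of_nat N) h t)%C =
  terms_eval (fun i x => C_derive_n (sinc_error (pullback m f) h M N) i (RtoC x))
    (1 - exp (- t)) (phi2_inv t) (leibniz_terms m m).
Proof.
  intros hd hf hh ht. rewrite sinc_approx_eval by assumption.
  set (F := pullback m f). set (G := sinc_error F h M N).
  pose (T := fun j t => (C_derive_n f j (RtoC t) -
    zsum (fun k => F (node h k) * terms_eval (fun i x => C_derive_n (sinc_at h k) i (RtoC x))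
      (1 - exp (- t)) (phi2_inv t) (leibniz_terms m j)) (- Z.of_nat M) (M + N + 1))%C).
  assert (hT : tower T m).
  { intros j s hj hs. unfold T. apply rder_minus.
    - apply rder_derive_n. now apply (near_real_image f d).
    - apply (rder_zsum (fun k s => F (node h k) * terms_eval (fun i x => C_derive_n (sinc_at h k) i (RtoC x))
        (1 - exp (- s)) (phi2_inv s) (leibniz_terms m j))%C). intros k. apply rder_scal.
      apply (leibniz_tower (fun i x => C_derive_n (sinc_at h k) i (RtoC x)) m); try assumption.
      intros i x. apply rder_derive_n, near_all, holo_sinc_at. }
  assert (hG : forall z, Rabs (snd z) < d -> holo G z).
  { intros z hz. apply holo_sinc_error. now apply holo_pullback with d. }
  assert (hU : tower (fun j t => terms_eval (fun i x => C_derive_n G i (RtoC x))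
    (1 - exp (- t)) (phi2_inv t) (leibniz_terms m j)) m).
  { apply leibniz_tower. intros i x. apply rder_derive_n.
    assert (hx : Rabs (snd (RtoC x)) < d) by (simpl; rewrite Rabs_R0; lra).
    generalize (strip_open d _ hx). apply near_imp. exact hG. }
  change (T m t = terms_eval (fun i x => C_derive_n G i (RtoC x)) (1 - exp (- t)) (phi2_inv t) (leibniz_terms m m)).
  rewrite <- (tower_derive_n (T O) T m hT (fun _ _ => eq_refl) m t (le_n m) ht).
  apply (tower_derive_n (T O) _ m hU); [|lia|exact ht].
  intros s hs. unfold T. simpl leibniz_terms. simpl terms_eval. unfold term_eval.
  simpl C_derive_n. unfold G, sinc_error.
  assert (hu := u_pos s hs).
  (* The definition of [F] read backwards: on [t > 0] the factor [u^m] is nonzero and [phi2_inv]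
     inverts [phi2]. *)
  assert (E : f (RtoC s) = (RtoC ((1 - exp (- s)) ^ m) * F (RtoC (phi2_inv s)))%C).
  { unfold F, pullback. rewrite phi2_phi2_inv, g2_real by exact hs. field.
    intros e. apply RtoC_inj in e. revert e. apply pow_nonzero. lra. }
  rewrite E, Rmult_1_l.
  rewrite (zsum_ext _ (fun k => RtoC ((1 - exp (- s)) ^ m) * (F (node h k) * sinc_at h k (RtoC (phi2_inv s))))%C)
    by (intros k; ring).
  rewrite zsum_scal. ring.
Qed.

(* [Stdlib.Reals] also defines a [Zceil], which shadows the one of [Defs]. *)
Lemma Zceil_ge (x : R) : x <= IZR (Defs.Zceil x).
Proof. unfold Defs.Zceil. rewrite opp_IZR. destruct (base_Int_part (- x)) as [h1 h2]. lra. Qed.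

(** The inequality is all that the tail estimates use of the ceiling: it gives [a k h >= mu n h]. *)
Lemma trunc_nat (mu a : R) (n : nat) : 0 < mu -> 0 < a ->
  exists k : nat, trunc mu a n = Z.of_nat k /\ mu * INR n <= a * INR k.
Proof.
  intros hmu ha. assert (h := Zceil_ge (mu / a * INR n)). assert (hn := pos_INR n).
  assert (h0 : 0 <= mu / a * INR n) by (apply Rmult_le_pos; [apply Rdiv_le_0_compat; lra|lra]).
  assert (hz : (0 <= trunc mu a n)%Z) by (apply le_IZR; unfold trunc; exact (Rle_trans _ _ _ h0 h)).
  exists (Z.to_nat (trunc mu a n)). rewrite Z2Nat.id by exact hz. split; [reflexivity|].
  rewrite (INR_IZR_INZ (Z.to_nat _)), Z2Nat.id by exact hz. unfold trunc.
  replace (mu * INR n) with (a * (mu / a * INR n)) by (field; lra).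
  apply Rmult_le_compat_l; lra.
Qed.

(** * The step size and its powers *)

Lemma step_pos (d mu : R) (n : nat) : 0 < d -> 0 < mu -> (1 <= n)%nat -> 0 < step d mu n.
Proof.
  intros hd hmu hn. assert (hN : 1 <= INR n) by (apply (le_INR 1); exact hn).
  apply sqrt_lt_R0. apply Rdiv_lt_0_compat; [|apply Rmult_lt_0_compat; lra].
  apply Rmult_lt_0_compat; [apply PI_RGT_0|exact hd].
Qed.

Lemma step_scaling (d mu : R) (n : nat) : 0 < d -> 0 < mu -> (1 <= n)%nat ->
  step d mu n * sqrt (INR n) = sqrt (PI * d / mu).
Proof.
  intros hd hmu hn. assert (hN : 1 <= INR n) by (apply (le_INR 1); exact hn). assert (hp := PI_RGT_0).
  unfold step. rewrite <- sqrt_mult_alt.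
  - f_equal. field. lra.
  - apply Rdiv_le_0_compat; [|apply Rmult_lt_0_compat; lra]. apply Rmult_le_pos; lra.
Qed.

(** The balance that dictates [h]: the truncation exponent [h mu n] equals the discretization
    exponent [PI d / h]. *)
Lemma step_rate (d mu : R) (n : nat) : 0 < d -> 0 < mu -> (1 <= n)%nat ->
  step d mu n * (mu * INR n) = sqrt (PI * d * mu * INR n) /\
  PI * d / step d mu n = sqrt (PI * d * mu * INR n).
Proof.
  intros hd hmu hn. assert (hN : 1 <= INR n) by (apply (le_INR 1); exact hn). assert (hp := PI_RGT_0).
  assert (hs := step_pos d mu n hd hmu hn).
  assert (hmn : 0 < mu * INR n) by (apply Rmult_lt_0_compat; lra).
  assert (hpd : 0 < PI * d) by now apply Rmult_lt_0_compat.
  assert (e : step d mu n * step d mu n = PI * d / (mu * INR n))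
    by (apply sqrt_sqrt, Rdiv_le_0_compat; lra).
  assert (E : step d mu n * (mu * INR n) = sqrt (PI * d * mu * INR n)).
  { symmetry. apply sqrt_lem_1.
    - replace (PI * d * mu * INR n) with (PI * d * (mu * INR n)) by ring. apply Rmult_le_pos; lra.
    - apply Rmult_le_pos; lra.
    - replace (step d mu n * (mu * INR n) * (step d mu n * (mu * INR n)))
        with (step d mu n * step d mu n * (mu * INR n) * (mu * INR n)) by ring.
      rewrite e. field. lra. }
  split; [exact E|]. rewrite <- E.
  replace (PI * d) with (step d mu n * step d mu n * (mu * INR n)) by (rewrite e; field; lra).
  field. lra.
Qed.

(** The origin of [n^((m+1)/2)]: [1 / h] is a constant times [sqrt n], and it occurs [m] times
    through derivatives and once through the tails. *)
Lemma inv_step_pow (d mu : R) (n m : nat) : 0 < d -> 0 < mu -> (1 <= n)%nat ->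
  (/ step d mu n) ^ S m =
  (/ sqrt (PI * d / mu)) ^ S m * Rpower (INR n) ((INR m + 1) / 2).
Proof.
  intros hd hmu hn. assert (hN : 1 <= INR n) by (apply (le_INR 1); exact hn).
  assert (hs := step_pos d mu n hd hmu hn). assert (hq : 0 < sqrt (INR n)) by (apply sqrt_lt_R0; lra).
  replace (/ step d mu n) with (/ sqrt (PI * d / mu) * sqrt (INR n))
    by (rewrite <- (step_scaling d mu n hd hmu hn); field; lra).
  rewrite Rpow_mult_distr. f_equal.
  rewrite <- (Rpower_pow (S m)) by exact hq.
  rewrite <- Rpower_sqrt by lra. rewrite Rpower_mult. f_equal. rewrite S_INR. field.
Qed.

Lemma step_le (d mu : R) (n : nat) : 0 < d -> 0 < mu -> (1 <= n)%nat ->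
  step d mu n <= sqrt (PI * d / mu).
Proof.
  intros hd hmu hn. assert (hN : 1 <= INR n) by (apply (le_INR 1); exact hn).
  rewrite <- (step_scaling d mu n hd hmu hn). assert (hs := step_pos d mu n hd hmu hn).
  rewrite <- (Rmult_1_r (step d mu n)) at 1. apply Rmult_le_compat_l; [lra|].
  rewrite <- sqrt_1. apply sqrt_le_1_alt. exact hN.
Qed.

Theorem theorem3p1 (m : nat) (d : R) (f : C -> C) (K alpha beta : R)
  (hd0 : 0 < d) (hdpi : d < PI)
  (hf : analytic_on (phi2_image d) f)
  (hK : 0 < K) (halpha : 0 < alpha) (hbeta : 0 < beta)
  (hbound : forall z : C, phi2_image d z ->
     Cmod (f z / g2 m z)%C
     <= K * Rpower (Cmod (z / (1 + z))%C) alpha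
          * Rpower (Cmod (Cexp (- z)%C)) beta) :
  let mu := Rmin alpha beta in
  exists C0 : R, forall n : nat, (1 <= n)%nat ->
    let M := trunc mu alpha n in
    let N := trunc mu beta n in
    let h := step d mu n in
    Rbar_le
      (Lub_Rbar (fun y : R => exists t : R, 0 < t /\
         y = Cmod (C_derive_n f m (RtoC t) - sinc_approx m f M N h t)%C))
      (Finite (C0 * Rpower (INR n) ((INR m + 1) / 2)
               * exp (- sqrt (PI * d * mu * INR n)))).
Proof.
  intros mu. assert (hmu : 0 < mu) by (unfold mu; apply Rmin_case; assumption).
  assert (hp := PI_RGT_0). assert (hp4 := PI_4).
  destruct (pullback_decay m d f K alpha beta (conj hd0 hdpi) hK halpha hbeta hbound) as [K' [hK' HK']].
  set (H := sqrt (PI * d / mu)).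
  assert (hH : 0 < H).
  { apply sqrt_lt_R0, Rdiv_lt_0_compat; [apply Rmult_lt_0_compat|]; lra. }
  assert (hF : forall z, Rabs (snd z) < d -> holo (pullback m f) z)
    by (intros z hz; now apply holo_pullback with d).
  destruct (truncated_error (pullback m f) d K' alpha beta H hd0 hK' halpha hbeta hH hF HK') as [A [hA HA]].
  set (c := d / (2 * H)). assert (hc : 0 < c) by (unfold c; apply Rdiv_lt_0_compat; lra).
  assert (hm := pos_INR m).
  (* In order: the weight of the terms of the [m]-th derivative, the loss in Cauchy's estimates with
     [h] taken out, the bound on the error with [1 / h] taken out, and what remains of [h^(-(m+1))]
     beside the power of [n]. *)
  exists (terms_norm (leibniz_terms m m) * (2 * (INR m + 1) / c) ^ m * (A * (H + 2)) * (/ H) ^ S m).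
  intros n hn M N h.
  assert (hh : 0 < h) by now apply step_pos.
  assert (hhH : h <= H) by now apply step_le.
  destruct (step_rate d mu n hd0 hmu hn) as [r1 r2]. fold h in r1, r2.
  destruct (trunc_nat mu alpha n hmu halpha) as [M' [eM hM]].
  destruct (trunc_nat mu beta n hmu hbeta) as [N' [eN hN]].
  unfold M, N. rewrite eM, eN.
  set (q := sqrt (PI * d * mu * INR n)) in *.
  apply (proj2 (Lub_Rbar_correct _)). intros y [t [ht ->]].
  change (Cmod (C_derive_n f m (RtoC t) - sinc_approx m f (Z.of_nat M') (Z.of_nat N') h t)%C
    <= terms_norm (leibniz_terms m m) * (2 * (INR m + 1) / c) ^ m * (A * (H + 2)) * (/ H) ^ S m
       * Rpower (INR n) ((INR m + 1) / 2) * exp (- q)).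
  rewrite (error_eval m d) by (try assumption; split; assumption).
  (* The two tails give [2 / h]; the contour term 1 is written [h / h] and bounded by [H / h]. *)
  set (B := A * (H + 2) * / h * exp (- q)).
  assert (hB : forall z, Rabs (snd z) <= c * h -> Cmod (sinc_error (pullback m f) h M' N' z) <= B).
  { intros z hz. eapply Rle_trans; [apply HA; [split; assumption|exact hz]|].
    replace B with (A * ((H + 2) * / h * exp (- q))) by (unfold B; ring).
    apply Rmult_le_compat_l; [lra|]. rewrite r2.
    assert (i1 : exp (- (alpha * h * INR M')) <= exp (- q)).
    { apply exp_le. rewrite <- r1. assert (h * (mu * INR n) <= h * (alpha * INR M')) by (apply Rmult_le_compat_l; lra). lra. }
    assert (i2 : exp (- (beta * h * INR N')) <= exp (- q)).
    { apply exp_le. rewrite <- r1. assert (h * (mu * INR n) <= h * (beta * INR N')) by (apply Rmult_le_compat_l; lra). lra. }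
    assert (hq := exp_pos (- q)). assert (hih : 0 < / h) by now apply Rinv_0_lt_compat.
    apply Rle_trans with (h * / h * exp (- q) + (exp (- q) + exp (- q)) * / h).
    - rewrite Rinv_r by lra. apply Rplus_le_compat; [lra|]. apply Rmult_le_compat_r; lra.
    - assert (0 <= (H - h) * (/ h * exp (- q))) by (apply Rmult_le_pos; [lra|left; now apply Rmult_lt_0_compat]).
      lra. }
  (* Up to [m] steps of this width fit in the strip of half-width [c h]; dividing by [m + 1] also
     covers [m = 0]. *)
  set (s := c * h / (INR m + 1)).
  assert (hs : 0 < s) by (unfold s; apply Rdiv_lt_0_compat; [apply Rmult_lt_0_compat|]; lra).
  assert (hcH : c * h <= d / 2).
  { replace (d / 2) with (c * H) by (unfold c; field; lra). apply Rmult_le_compat_l; lra. }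
  (* Then [2 / s >= 1], so the bound for order [i <= m] is at most the one for order [m]; it follows
     from [c h <= d / 2] and [d < PI <= 4]. *)
  assert (hs2 : s <= 2).
  { unfold s. apply Rle_div_l; [lra|]. lra. }
  assert (h2s : 1 <= 2 / s) by (apply Rle_div_r; lra).
  assert (hB0 : 0 <= B).
  { eapply Rle_trans; [apply Cmod_ge_0|apply (hB (RtoC 0))]. simpl. rewrite Rabs_R0. apply Rmult_le_pos; lra. }
  eapply Rle_trans; [apply (terms_eval_norm _ _ _ ((2 / s) ^ m * B))|].
  - generalize (u_pos t ht). lra.
  - apply Rmult_le_pos; [apply pow_le; lra|exact hB0].
  - intros c' l i hi. apply leibniz_terms_range in hi. destruct hi as [_ hi].
    eapply Rle_trans; [apply (iterated_cauchy_estimate _ d (c * h) s B)|]; try assumption.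
    + lra.
    + intros z hz. apply holo_sinc_error. now apply hF.
    + simpl. rewrite Rabs_R0, Rplus_0_l. unfold s.
      replace (INR i * (c * h / (INR m + 1))) with (c * h * (INR i / (INR m + 1))) by (field; lra).
      rewrite <- (Rmult_1_r (c * h)) at 2. apply Rmult_le_compat_l; [apply Rmult_le_pos; lra|].
      apply Rle_div_l; [lra|]. apply le_INR in hi. lra.
    + apply Rmult_le_compat_r; [exact hB0|]. now apply Rle_pow.
  - apply Req_le. rewrite Rmult_assoc with (r3 := Rpower (INR n) ((INR m + 1) / 2)).
    unfold H at 2. rewrite <- (inv_step_pow d mu n m hd0 hmu hn). fold h.
    replace (2 / s) with (2 * (INR m + 1) / c * / h) by (unfold s; field; lra).
    rewrite Rpow_mult_distr. unfold B. simpl pow. ring.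
Qed.
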